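(* Let $\mathcal{G}$ be the pseudogroup of local diffeomorphisms preserving the shape of the Kundt metrics $g= du\,(dv+H\,du+W_i\,dx^i)+h_{ij}\,dx^i\,dx^j$ (with $H=H(u,x,v)$, $W_i=W_i(u,x,v)$, $h_{ij}=h_{ij}(u,x)$ and $(h_{ij})$ positive definite). The transformations in $\mathcal{G}$ take the form $$\varphi:(u,x^i,v)\mapsto\left(C(u),\,A^i(u,x),\,\frac{v}{C'(u)}+B(u,x)\right),\qquad \det[A^i_{x^j}]\neq 0,\quad C'(u)\neq 0.$$ The Lie algebra $\mathfrak{g}$ of this Lie pseudogroup consists of the vector fields of the form $$\xi=c(u)\,\partial_u+a^i(u,x)\,\partial_{x^i}+\bigl(b(u,x)-c'(u)v\bigr)\,\partial_v .$$
   Context: Let $n\ge 3$ and let $(u,x,v)=(u,x^1,\dots,x^{n-2},v)$ be local coordinates on an $n$-dimensional manifold $M$; $x$ abbreviates $(x^1,\dots,x^{n-2})$, indices $i,j$ run over $1,\dots,n-2$, repeated indices are summed, and products of 1-forms are symmetric products. An $n$-dimensional Kundt spacetime in adapted coordinates is a Lorentzian metric of the displayed form, with $H,W_i$ arbitrary functions of $(u,x,v)$ and $h_{ij}=h_{ji}$ functions of $(u,x)$ only, the matrix $(h_{ij})$ being positive definite. A local diffeomorphism $\varphi$ preserves the shape if, for every metric $g$ of this form, $\varphi^*g$ is again of this form (with some other functions $H,W_i,h_{ij}$ of the same type). Subscripts such as $A^i_{x^j}$ denote partial derivatives; $C,A^i,B,c,a^i,b$ are smooth functions of the indicated arguments.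 *)

(* Defs.v *)
From HB Require Import structures.
From mathcomp Require Import all_boot all_order all_algebra.
From mathcomp Require Import all_classical all_reals all_analysis.

Set Implicit Arguments.
Unset Strict Implicit.
Unset Printing Implicit Defensive.

Import Order.TTheory GRing.Theory Num.Theory.
Import numFieldNormedType.Exports.

Local Open Scope classical_set_scope.
Local Open Scope ring_scope.

(* The statement is local, so the manifold is an open subset of the coordinate
   space of points (u, x, v), with m = n - 2 coordinates x; tangent vectors are
   elements of the same space. *)
Notation coordinates R m := (R * 'rV[R]_m * R)%type.

(* Only meaningful on an open set U and for finite-dimensional E: there, C^k
   can be tested on directional derivatives. *)
Fixpoint class_C (R : realType) (E F : normedModType R) (k : nat) (U : set E)
    (f : E -> F) : Prop :=
  match k with
  | 0 => forall p, U p -> {for p, continuous f}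
  | l.+1 => (forall p, U p -> differentiable f p) /\
            (forall w : E, class_C l U ('D_w f))
  end.

Definition smooth_on (R : realType) (E F : normedModType R) (U : set E)
    (f : E -> F) : Prop :=
  forall k, class_C k U f.

Section Kundt.
Variables (R : realType) (m : nat).
Local Notation E := (coordinates R m).

Implicit Types (U N : set E) (phi : E -> E).

Definition ux (p : E) : R * 'rV[R]_m := p.1.
Definition ucoord (p : E) : R := p.1.1.
Definition vcoord (p : E) : R := p.2.

Definition du (X : E) : R := X.1.1.
Definition dx (i : 'I_m) (X : E) : R := X.1.2 0 i.
Definition dv (X : E) : R := X.2.

(* Symmetric product of two covectors, normalized so that the square of alpha
   is the bilinear form (X, Y) |-> alpha X * alpha Y. *)
Definition sprod (alpha beta : E -> R) (X Y : E) : R :=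
  (alpha X * beta Y + beta X * alpha Y) / 2.

Definition positive_definite (h : 'M[R]_m) : Prop :=
  h^T = h /\ forall y : 'rV[R]_m, y != 0 -> 0 < (y *m h *m y^T) 0 0.

Definition kundt_metric (H : E -> R) (W : E -> 'rV[R]_m)
    (h : R * 'rV[R]_m -> 'M[R]_m) (p X Y : E) : R :=
  sprod du (fun Z => dv Z + H p * du Z + \sum_(i < m) W p 0 i * dx i Z) X Y
  + \sum_(i < m) \sum_(j < m) h (ux p) i j * sprod (dx i) (dx j) X Y.

(* g is a Kundt metric in adapted coordinates on the open set U.  The functions
   are asked for near every point because "h depends on (u, x) only" is a local
   condition, h being constant along the connected pieces of the v-lines in U
   (H, W and h are determined by g, so this matters only for U with disconnected
   v-lines).  Such a g is automatically Lorentzian: du, dx and the remaining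
   factor form a coframe in which g is a hyperbolic plane plus h. *)
Definition kundt_on U (g : E -> E -> E -> R) : Prop :=
  forall p, U p -> exists N (H : E -> R) (W : E -> 'rV[R]_m)
      (h : R * 'rV[R]_m -> 'M[R]_m),
    [/\ [/\ open N, N p & N `<=` U],
        [/\ smooth_on N H, smooth_on N W & smooth_on (ux @` N) h],
        forall q, N q -> positive_definite (h (ux q)) &
        forall q, N q -> forall X Y, g q X Y = kundt_metric H W h q X Y].

Definition pullback phi (g : E -> E -> E -> R) (p X Y : E) : R :=
  g (phi p) ('d phi p X) ('d phi p Y).

(* A local diffeomorphism of the coordinate space: a diffeomorphism of the open
   set U onto an open set. *)
Definition local_diffeomorphism U phi : Prop :=
  [/\ open U, open (phi @` U), smooth_on U phi &
      exists2 psi : E -> E, smooth_on (phi @` U) psi &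
        forall p, U p -> psi (phi p) = p].

Definition preserves_kundt_shape U phi : Prop :=
  forall g, kundt_on (phi @` U) g -> kundt_on U (pullback phi g).

(* phi, with domain U, belongs to the pseudogroup. *)
Definition kundt_pseudogroup U phi : Prop :=
  local_diffeomorphism U phi /\ preserves_kundt_shape U phi.

(* The matrix of the A^i_{x^j} at (u, x). *)
Definition x_jacobian (A : R * 'rV[R]_m -> 'rV[R]_m) (q : R * 'rV[R]_m) :
    'M[R]_m :=
  \matrix_(i, j) 'D_(0 : R, delta_mx 0 j : 'rV[R]_m) (fun r => A r 0 i) q.

Definition has_kundt_form_on N phi : Prop :=
  exists (C : R -> R) (A : R * 'rV[R]_m -> 'rV[R]_m) (B : R * 'rV[R]_m -> R),
    [/\ smooth_on (ucoord @` N) C, smooth_on (ux @` N) A &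
        smooth_on (ux @` N) B] /\
    forall p, N p ->
      [/\ phi p = (C (ucoord p), A (ux p),
                   vcoord p / derive1 C (ucoord p) + B (ux p)),
          \det (x_jacobian A (ux p)) != 0 & derive1 C (ucoord p) != 0].

Definition locally_has_kundt_form U phi : Prop :=
  forall p, U p -> exists N,
    [/\ open N, N p, N `<=` U & has_kundt_form_on N phi].

Definition is_local_flow U (xi : E -> E) (e : R) N (Phi : R -> E -> E) :
    Prop :=
  [/\ smooth_on (`]- e, e[ `*` N) (fun s : R * E => Phi s.1 s.2),
      forall q, N q -> Phi 0 q = q &
      forall t q, t \in `]- e, e[ -> N q ->
        U (Phi t q) /\ is_derive t 1 (Phi ^~ q) (xi (Phi t q))].

(* The Lie algebra (sheaf) of the pseudogroup over U: the smooth vector fields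
   whose local flow consists of elements of the pseudogroup. *)
Definition kundt_lie_algebra U (xi : E -> E) : Prop :=
  smooth_on U xi /\
  forall p, U p -> exists N (e : R) (Phi : R -> E -> E),
    [/\ [/\ open N, N p & N `<=` U], 0 < e,
        is_local_flow U xi e N Phi &
        forall t, t \in `]- e, e[ -> kundt_pseudogroup N (Phi t)].

Definition d_u : E := (1, 0, 0).
Definition d_x (i : 'I_m) : E := (0, delta_mx 0 i, 0).
Definition d_v : E := (0, 0, 1).

Definition has_kundt_generator_form_on N (xi : E -> E) : Prop :=
  exists (c : R -> R) (a : R * 'rV[R]_m -> 'rV[R]_m) (b : R * 'rV[R]_m -> R),
    [/\ smooth_on (ucoord @` N) c, smooth_on (ux @` N) a &
        smooth_on (ux @` N) b] /\
    forall p, N p ->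
      xi p = c (ucoord p) *: d_u + \sum_(i < m) a (ux p) 0 i *: d_x i
             + (b (ux p) - derive1 c (ucoord p) * vcoord p) *: d_v.

Definition locally_has_kundt_generator_form U (xi : E -> E) : Prop :=
  forall p, U p -> exists N,
    [/\ open N, N p, N `<=` U & has_kundt_generator_form_on N xi].

End Kundt.

(* Main.v *)
(* The conditions on both sides are first order and pointwise.  Pulling back the
   two flat metrics du (dv + c du) + dx^2, c = 0, 1, shows that the differential
   L of a shape-preserving phi at any point satisfies du(L d_v) = dx^i(L d_v) =
   du(L d_x) = 0 ("triangular") and du(L d_u) dv(L d_v) = 1 ("adapted").
   Integrating these equations along segments of a small box gives the form
   (C(u), A(u, x), v / C'(u) + B(u, x)), and conversely the pullback of a Kundt
   metric by an adapted local diffeomorphism can be expanded in the coordinate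
   frame.
     Similarly, a vector field xi has the generator form iff its differential L is
   triangular with du(L d_u) + dv(L d_v) = 0.  The differential V of the flow of
   xi solves the linear equation V' = 'd xi (Phi_t) V; differentiating the
   adapted condition at t = 0 gives one inclusion, and for the other the linear
   equation propagates the adapted condition from V = id.  This needs local flows
   depending smoothly on the initial point, obtained by induction on the order k:
   the C^k flow of the prolonged field (f(x), 'd f(x) w) computes the first
   derivatives of the flow of f, which is therefore C^(k+1). *)
Require Import Defs.
From HB Require Import structures.
From mathcomp Require Import all_boot all_order all_algebra.
From mathcomp Require Import all_classical all_reals all_analysis.
From mathcomp Require Import ring lra.

Set Implicit Arguments.
Unset Strict Implicit.
Unset Printing Implicit Defensive.

Import Order.TTheory GRing.Theory Num.Theory.
Import numFieldNormedType.Exports.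

Local Open Scope classical_set_scope.
Local Open Scope ring_scope.

(** Smoothness is expressed through directional derivatives along fixed vectors, while the chain
    rule and the variational equation involve directions that move with the point. Finite dimension,
    given by continuous coordinate functionals, expands a moving direction in fixed ones.
    Differential equations are treated over an arbitrary finite-dimensional [E], because gaining one
    order of differentiability of the flow replaces [E] by [E * E]. The neighbourhood obtained at
    order [k] depends on [k], so smoothness of all orders on one domain has to be recovered by
    propagating it in time. The adapted condition concerns the flag formed by the span of [d_v]
    inside the kernel of [du]. Nondegeneracy of the [x]-block is then deduced from the injectivity
    of the differential of a diffeomorphism. Local diffeomorphisms and vector fields are both maps
    from [E] to [E], so their integration along boxes is shared: the [u] and [x] components need
    only triangularity, and the two cases differ in the slope in [v], which is [1 / C'] or
    [- c']. *)

Section LinearCombinations.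
Context {R : comPzRingType} {V : lmodType R}.

Inductive lmod_expr :=
  | LVar of nat | LZero | LAdd of lmod_expr & lmod_expr
  | LOpp of lmod_expr | LScale of R & lmod_expr.

Fixpoint lmod_eval (env : seq V) e : V :=
  match e with
  | LVar i => nth 0 env i
  | LZero => 0
  | LAdd a b => lmod_eval env a + lmod_eval env b
  | LOpp a => - lmod_eval env a
  | LScale k a => k *: lmod_eval env a
  end.

Fixpoint lmod_coef (i : nat) e : R :=
  match e with
  | LVar j => if i == j then 1 else 0
  | LZero => 0
  | LAdd a b => lmod_coef i a + lmod_coef i b
  | LOpp a => - lmod_coef i a
  | LScale k a => k * lmod_coef i a
  end.

(** Recursion instead of a quantifier over indices: for a concrete number of atoms it computes to a
    conjunction of scalar equations, one [ring] goal per atom. *)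
Fixpoint same_coefs n e1 e2 : Prop :=
  if n is i.+1 then lmod_coef i e1 = lmod_coef i e2 /\ same_coefs i e1 e2 else True.

Lemma lmod_evalE env e :
  lmod_eval env e = \sum_(i < size env) lmod_coef i e *: nth 0 env i.
Proof.
elim: e => /= [j||a -> b ->|a ->|k a ->].
- have [js|js] := ltnP j (size env); last first.
    rewrite nth_default // big1 // => i _; case: eqP => [ij|_]; last by rewrite scale0r.
    by move: (ltn_ord i); rewrite ij ltnNge js.
  rewrite (bigD1 (Ordinal js)) //= eqxx scale1r big1 ?addr0 // => i ij.
  case: eqP => [E|_]; last by rewrite scale0r.
  by case/eqP: ij; apply: val_inj.
- by rewrite big1 // => i _; rewrite scale0r.
- by rewrite -big_split; apply: eq_bigr => i _; rewrite scalerDl.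
- by rewrite -sumrN; apply: eq_bigr => i _; rewrite scaleNr.
- by rewrite scaler_sumr; apply: eq_bigr => i _; rewrite scalerA.
Qed.

Lemma lmod_eval_eq env e1 e2 :
  same_coefs (size env) e1 e2 -> lmod_eval env e1 = lmod_eval env e2.
Proof.
move=> s12; rewrite !lmod_evalE; apply: eq_bigr => i _; congr (_ *: _).
elim: (size env) s12 i => [_ []|n IH /= [h s]] //= i.
have [->//|ni] := eqVneq (i : nat) n.
have il : (i < n)%N by rewrite ltn_neqAle ni -ltnS ltn_ord.
exact: IH s (Ordinal il).
Qed.

End LinearCombinations.

Ltac lmod_index x l :=
  lazymatch l with
  | x :: _ => constr:(0%N)
  | _ :: ?t => let n := lmod_index x t in constr:(S n)
  end.
Ltac lmod_mem x l :=
  lazymatch l with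
  | nil => constr:(false) | x :: _ => constr:(true) | _ :: ?t => lmod_mem x t
  end.
Ltac lmod_atoms l t :=
  lazymatch t with
  | ?a + ?b => let l' := lmod_atoms l a in lmod_atoms l' b
  | - ?a => lmod_atoms l a
  | _ *: ?a => lmod_atoms l a
  | 0 => l
  | _ => let m := lmod_mem t l in
         lazymatch m with true => l | false => constr:(t :: l) end
  end.
Ltac lmod_reify R l t :=
  lazymatch t with
  | ?a + ?b => let x := lmod_reify R l a in let y := lmod_reify R l b in
               constr:(@LAdd R x y)
  | - ?a => let x := lmod_reify R l a in constr:(@LOpp R x)
  | ?k *: ?a => let x := lmod_reify R l a in constr:(@LScale R k x)
  | 0 => constr:(@LZero R)
  | _ => let n := lmod_index t l in constr:(@LVar R n)
  end.
(* Proves an equation between linear combinations in an R-module by comparing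
   coefficients with [ring]. *)
Ltac lmod R :=
  lazymatch goal with |- @eq ?T ?a ?b =>
    let l0 := constr:(@nil T) in
    let l1 := lmod_atoms l0 a in let l := lmod_atoms l1 b in
    let x := lmod_reify R l a in let y := lmod_reify R l b in
    refine (@lmod_eval_eq R _ l x y _);
    cbn -[GRing.add GRing.opp GRing.mul GRing.zero GRing.one]; repeat split; ring
  end.

(** * Differential calculus in normed modules *)

Lemma nbhs_distP (R : realType) (E : normedModType R) (p : E) (A : set E) :
  nbhs p A <-> exists2 r : R, 0 < r & forall x, `|x - p| < r -> A x.
Proof.
split.
  move=> /nbhs_ballP[r r0 rA]; exists r => // x xp; apply: rA.
  by rewrite -ball_normE /= distrC.
move=> [r r0 rA]; apply/nbhs_ballP; exists r => // x.
by rewrite -ball_normE /= distrC; exact: rA.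
Qed.

Lemma open_normP (R : realType) (E : normedModType R) (U : set E) (p : E) : open U -> U p ->
  exists2 r : R, 0 < r & forall x, `|x - p| < r -> U x.
Proof. by move=> oU Up; apply/nbhs_distP; exact: open_nbhs_nbhs. Qed.

Section EpsilonDelta.
Context {R : realType} {E F : normedModType R}.
Implicit Types (f : E -> F) (p w : E).

Lemma continuous_atP f p : {for p, continuous f} <->
  forall e : R, 0 < e -> exists2 d : R, 0 < d & forall x, `|x - p| < d -> `|f x - f p| <= e.
Proof.
split.
  move=> /cvgrPdist_le fc e e0; apply/nbhs_distP.
  by apply: filterS (fc e e0) => x /=; rewrite distrC.
move=> fc; apply/cvgrPdist_le => e e0; apply/nbhs_distP.
by have [d d0 fd] := fc e e0; exists d => // x /fd; rewrite distrC.
Qed.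

(** Clearing the denominator admits [h = 0] and removes the punctured filter, so that error terms
    can be added and composed as plain inequalities. *)
Lemma is_deriveP p w f D : is_derive p w f D <->
  forall e : R, 0 < e -> exists2 d : R, 0 < d &
    forall h : R, `|h| < d -> `|f (p + h *: w) - f p - h *: D| <= e * `|h|.
Proof.
have quo (h : R) : h != 0 -> `|f (p + h *: w) - f p - h *: D| =
    `|h| * `|D - h^-1 *: ((f \o shift p) (h *: w) - f p)|.
  move=> h0; rewrite distrC -normrZ scalerBr scalerA divff // scale1r /=.
  by rewrite [h *: w + p]addrC.
split.
  move=> [/cvg_ex[l fl] Dl]; have lD : l = D by rewrite -Dl; apply/esym/cvg_lim.
  subst l; move=> e e0.
  have /nbhs_distP[d d0 dP] : nbhs (0 : R) (fun h => h != 0 ->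
    `|D - h^-1 *: ((f \o shift p) (h *: w) - f p)| <= e).
    exact: (cvgrPdist_le _ _).1 fl e e0.
  exists d => // h hd.
  have [->|h0] := eqVneq h 0; first by rewrite !scale0r addr0 !subrr !normr0 mulr0.
  by rewrite quo // mulrC ler_wpM2r //; apply: dP => //; rewrite subr0.
move=> fD; have fl : (h^-1 *: ((f \o shift p) (h *: w) - f p)) @[h --> 0^'] --> D.
  apply/cvgrPdist_le => e e0; rewrite near_withinE; apply/nbhs_distP.
  have [d d0 dP] := fD e e0; exists d => // h; rewrite subr0 => hd h0.
  have := dP h hd; rewrite quo // mulrC ler_pM2r //.
  by rewrite normr_gt0.
by split; [apply/cvg_ex; exists D|apply/cvg_lim].
Qed.

Lemma differentiable_normP (L : {linear E -> F}) p f : continuous L ->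
  (forall e : R, 0 < e -> exists2 d : R, 0 < d &
    forall h, `|h| < d -> `|f (p + h) - f p - L h| <= e * `|h|) ->
  differentiable f p /\ 'd f p = L :> (E -> F).
Proof.
move=> cL fL.
have fo : f \o shift p = cst (f p) + L +o_ 0 id.
  apply/eqaddoP => e e0; have [d d0 dP] := fL e e0.
  apply/nbhs_distP; exists d => // h; rewrite subr0 => /dP.
  by rewrite -[X in _ -> `|X| <= _]/(f (h + p) - (f p + L h)) opprD addrA [h + p]addrC.
have dE : 'd f p = L :> (E -> F) by exact: diff_unique.
by split=> //; apply/diff_locallyP; rewrite dE.
Qed.

Lemma differentiable_norm p f : differentiable f p ->
  forall e : R, 0 < e -> exists2 d : R, 0 < d &
    forall h, `|h| < d -> `|f (p + h) - f p - 'd f p h| <= e * `|h|.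
Proof.
move=> /diff_locallyP[_ /eqaddoP fo] e e0.
have /nbhs_distP[d d0 dP] := fo e e0; exists d => // h hd.
have := dP h; rewrite subr0 => /(_ hd).
by rewrite -[X in `|X| <= _ -> _]/(f (h + p) - (f p + 'd f p h)) opprD addrA [h + p]addrC.
Qed.

Lemma is_derive_diff p w f : differentiable f p -> is_derive p w f ('d f p w).
Proof. by move=> df; split; [exact: diff_derivable|exact: deriveE]. Qed.

Lemma is_derive_unique p w f D D' :
  is_derive p w f D -> is_derive p w f D' -> D = D'.
Proof. by move=> [_ <-] [_ <-]. Qed.

End EpsilonDelta.

Lemma is_derive_line (R : realType) (E F : normedModType R) p w (f : E -> F) (t : R) D :
  is_derive (p + t *: w) w f D -> is_derive t 1 (fun s : R => f (p + s *: w)) D.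
Proof.
move=> /is_deriveP fD; apply/is_deriveP => e /fD [d d0 dP]; exists d => // h.
by rewrite [h *: 1]mulr1 scalerDl addrA; exact: dP.
Qed.

Lemma is_derive_continuous (R : realType) (F : normedModType R) (f : R -> F) (t : R) D :
  is_derive t 1 f D -> {for t, continuous f}.
Proof. by move=> [/derivable1_diffP /differentiable_continuous]. Qed.

Section MeanValue.
Context {R : realType} {V : normedModType R}.

(** There is no intermediate point for vector values. Instead, with a slack [e], the function [psi]
    attains a maximum on the segment, and that maximum can only be at [a], where [psi] is zero;
    hence [psi b <= 0]. *)
Lemma mean_value_le (G g : R -> V) (a b M : R) : a <= b ->
  (forall t, a <= t <= b -> is_derive t 1 G (g t)) ->
  (forall t, a <= t <= b -> `|g t| <= M) -> `|G b - G a| <= M * (b - a).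
Proof.
move=> ab dG gM.
have M0 : 0 <= M by apply: le_trans (gM a _) => //; rewrite lexx.
apply/ler_addgt0Pr => e0 e0gt.
have [->|nab] := eqVneq b a; first by rewrite !subrr normr0 mulr0 add0r ltW.
have {nab} ab' : a < b by rewrite lt_neqAle eq_sym nab.
pose e := e0 / (b - a); have e_gt : 0 < e by rewrite divr_gt0 // subr_gt0.
suff : `|G b - G a| <= (M + e) * (b - a).
  by rewrite mulrDl /e divfK // gt_eqF // subr_gt0.
pose psi t := `|G t - G a| - (M + e) * (t - a).
have psic : {within `[a, b], continuous psi}.
  apply: continuous_in_subspaceT => t /set_mem; rewrite /= in_itv /= => tab.
  have Gc := is_derive_continuous (dG t tab).
  apply: cvgB; first by apply: cvg_norm; apply: cvgB => //; exact: cvg_cst.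
  by apply: cvgM; [exact: cvg_cst|apply: cvgB; [exact: cvg_id|exact: cvg_cst]].
have [c cab cmax] := EVT_max ab psic.
have bab : b \in `[a, b] by rewrite in_itv /= lexx ltW.
have := cmax b bab.
have [ca|nca] := eqVneq c a.
  by rewrite /psi ca !subrr normr0 mulr0 subr0 subr_le0.
move: (cab); rewrite in_itv /= => /andP[ac cb].
have {nca} ac' : a < c by rewrite lt_neqAle eq_sym nca.
have dGc : is_derive c 1 G (g c) by apply: dG; rewrite ac cb.
have /(_ (e / 2)) := (is_deriveP _ _ _ _).1 dGc.
case; first by rewrite divr_gt0.
move=> d d0 dP.
(* A step to the left of the maximum, short enough for the first-order estimate at [c] and for
   [c - k] to stay in the segment. It raises [psi] by at least [e * k / 2], against maximality. *)
pose k := Num.min (d / 2) (c - a).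
have k0 : 0 < k by rewrite /k lt_min divr_gt0 //= subr_gt0.
have kd : k < d by rewrite /k gt_min; apply/orP; left; rewrite ltr_pdivrMr // ltr_pMr // ltr1n.
have kc : k <= c - a by rewrite /k ge_min lexx orbT.
have := dP (- k); rewrite normrN gtr0_norm // => /(_ kd).
rewrite [(- k)%:A]mulr1 scaleNr opprK => h1.
have ckab : c - k \in `[a, b] by rewrite in_itv /=; apply/andP; split; lra.
have := cmax _ ckab; rewrite /psi => h2.
have h3 : `|k *: g c| <= k * M by rewrite normrZ gtr0_norm // ler_wpM2l ?gM ?ac // ltW.
have h4 : `|G c - G a| <= `|G (c - k) - G a| + `|G (c - k) - G c + k *: g c| + `|k *: g c|.
  have -> : G c - G a = (G (c - k) - G a) - (G (c - k) - G c + k *: g c) + k *: g c.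
    by rewrite opprD opprB addrA subrK addrC addrA subrK.
  by apply: le_trans (ler_normD _ _) _; rewrite lerD2r; exact: ler_normB.
have : (M + e) * k <= (M + e / 2) * k by lra.
have ek : 0 < e * k by rewrite mulr_gt0.
lra.
Qed.

Lemma mean_value_norm (G g : R -> V) (a b M : R) :
  (forall t, (a <= t <= b) || (b <= t <= a) -> is_derive t 1 G (g t)) ->
  (forall t, (a <= t <= b) || (b <= t <= a) -> `|g t| <= M) ->
  `|G b - G a| <= M * `|b - a|.
Proof.
move=> dG gM; have [ab|/ltW ba] := leP a b.
  rewrite ger0_norm ?subr_ge0 //; apply: (@mean_value_le G g) => // t tab.
    by apply: dG; rewrite tab.
  by apply: gM; rewrite tab.
rewrite distrC [X in _ * X]distrC ger0_norm ?subr_ge0 //.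
apply: (@mean_value_le G g) => // t tab.
  by apply: dG; rewrite tab orbT.
by apply: gM; rewrite tab orbT.
Qed.

End MeanValue.

Lemma mean_value_segment (R : realType) (E V : normedModType R) (f : E -> V)
    (D : R -> V) p w (M : R) :
  (forall s, 0 <= s <= 1 -> is_derive (p + s *: w) w f (D s)) ->
  (forall s, 0 <= s <= 1 -> `|D s| <= M) -> `|f (p + w) - f p| <= M.
Proof.
move=> dD DM.
have := @mean_value_le R V (fun s => f (p + s *: w)) D 0 1 M ler01.
rewrite scale1r scale0r addr0 subr0 mulr1; apply=> // t t01.
exact/is_derive_line/dD.
Qed.

Section LinearMaps.
Context {R : realType}.

Lemma linear_norm_le (E F : normedModType R) (f : {linear E -> F}) :
  continuous f -> exists2 k : R, 0 < k & forall x, `|f x| <= k * `|x|.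
Proof.
move=> fc; have [k k0 kP] := linear_lipschitz fc.
by exists k.
Qed.

Lemma diff_linear (E F : normedModType R) (f : {linear E -> F}) p :
  continuous f -> differentiable f p /\ 'd f p = f :> (E -> F).
Proof. by move=> fc; split; [exact: linear_differentiable|exact: diff_lin]. Qed.

Lemma derive_linear (E F : normedModType R) (f : {linear E -> F}) w :
  continuous f -> 'D_w f = cst (f w).
Proof.
move=> fc; apply/funext => p; have [df dE] := diff_linear p fc.
by rewrite deriveE // dE.
Qed.

Lemma scale_is_bilinear (V : normedModType R) :
  bilinear_for
    (GRing.Scale.Law.clone _ _ *:%R _) (GRing.Scale.Law.clone _ _ *:%R _)
    (fun (k : R) (v : V) => k *: v).
Proof.
split=> [u'|u] a x y /=; first by rewrite scalerDl scalerA.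
by rewrite scalerDr !scalerA mulrC.
Qed.

Lemma diff_scale (E V : normedModType R) (f : E -> R) (g : E -> V) p :
  differentiable f p -> differentiable g p ->
  differentiable (fun x => f x *: g x) p /\
  'd (fun x => f x *: g x) p = (fun h => f p *: 'd g p h + 'd f p h *: g p) :> (E -> V).
Proof.
move=> df dg.
pose B := bilinear_isBilinear.Build R R V V _ _ _ (scale_is_bilinear V).
pose b : {bilinear R -> V -> V} := HB.pack (fun (k : R) (v : V) => k *: v) B.
have bc : continuous (fun q : R * V => b q.1 q.2) by exact: scale_continuous.
have db q : differentiable (fun q : R * V => b q.1 q.2) q.
  exact: differentiable_bilin.
have dp := differentiable_pair df dg.
split; first exact: (@differentiable_comp _ _ _ _ (fun x => (f x, g x)) _ _ dp (db _)).
have := @diff_comp _ _ _ _ (fun x => (f x, g x)) _ _ dp (db (f p, g p)).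
rewrite (diff_bilin (f p, g p) bc) diff_pair // => bE.
Qed.

End LinearMaps.

(** * Closure properties of [class_C] *)

Section ClassC.
Context {R : realType}.
Implicit Types E F : normedModType R.

Lemma class_CS E F k (U : set E) (f : E -> F) : class_C k.+1 U f -> class_C k U f.
Proof.
elim: k f => [|k IH] f [df Df].
  by move=> p /df; exact: differentiable_continuous.
by split=> // w; exact: IH.
Qed.

Lemma class_C_le E F k l (U : set E) (f : E -> F) : (k <= l)%N ->
  class_C l U f -> class_C k U f.
Proof.
move=> /subnK <-; elim: (l - k)%N => // d IH; rewrite addSn => /class_CS; exact: IH.
Qed.

Lemma class_C_continuous E F k (U : set E) (f : E -> F) : class_C k U f ->
  forall p, U p -> {for p, continuous f}.
Proof. by move=> /(class_C_le (leq0n k)). Qed.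

(** Every clause of [class_C] is a condition on the germ of [f] in the ambient space at points of
    the set, so any set [N] containing the point will do. *)
Lemma class_C_local E F k (U : set E) (f : E -> F) :
  (forall p, U p -> exists2 N : set E, N p & class_C k N f) -> class_C k U f.
Proof.
elim: k f => [|k IH] f Uf.
  by move=> p /Uf[N Np]; exact.
split=> [p /Uf[N Np [df _]]|w]; first exact: df.
by apply: IH => p /Uf[N Np [_ Df]]; exists N => //; exact: Df.
Qed.

Lemma class_C_sub E F k (U V : set E) (f : E -> F) : V `<=` U ->
  class_C k U f -> class_C k V f.
Proof. by move=> VU Uf; apply: class_C_local => p /VU Up; exists U. Qed.

Lemma differentiable_ext E F (U : set E) (f g : E -> F) p : open U -> U p ->
  (forall q, U q -> f q = g q) -> differentiable f p ->
  differentiable g p /\ 'd g p = 'd f p :> (E -> F).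
Proof.
move=> oU Up fg df; apply: differentiable_normP; first exact: diff_continuous.
move=> e e0; have [d d0 dP] := differentiable_norm df e0.
have [r r0 rU] := open_normP oU Up.
exists (Num.min d r); first by rewrite lt_min d0.
move=> h; rewrite lt_min => /andP[hd hr].
by rewrite -!fg ?dP //; apply: rU; rewrite addrC addKr.
Qed.

Lemma derive_ext E F (U : set E) (f g : E -> F) p w : open U -> U p ->
  (forall q, U q -> f q = g q) -> 'D_w f p = 'D_w g p.
Proof.
move=> oU Up fg; apply: near_eq_derive.
by apply: filterS (open_nbhs_nbhs (conj oU Up)) => q; exact: fg.
Qed.

Lemma class_C_ext E F k (U : set E) (f g : E -> F) : open U ->
  (forall q, U q -> f q = g q) -> class_C k U f -> class_C k U g.
Proof.
move=> oU; elim: k f g => [|k IH] f g fg.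
  move=> fc p Up; apply/continuous_atP => e e0.
  have /continuous_atP /(_ e e0) [d d0 dP] := fc p Up.
  have [r r0 rU] := open_normP oU Up.
  exists (Num.min d r); first by rewrite lt_min d0.
  move=> x; rewrite lt_min => /andP[xd xr].
  by rewrite -!fg ?dP //; apply: rU.
move=> [df Df]; split=> [p Up|w].
  exact: (differentiable_ext oU Up fg (df p Up)).1.
by apply: IH (Df w) => q Uq; exact: derive_ext oU Uq fg.
Qed.

Lemma class_C_cst E F k (U : set E) (c : F) : class_C k U (cst c : E -> F).
Proof.
elim: k c => [|k IH] c; first by move=> p _; exact: cst_continuous.
split=> [p _|w]; first exact: differentiable_cst.
rewrite (_ : 'D_w _ = cst 0); first exact: IH.
by apply/funext => p; exact: derive_cst.
Qed.

Lemma class_C_linear E F k (U : set E) (f : {linear E -> F}) :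
  continuous f -> class_C k U f.
Proof.
move=> fc; case: k => [|k]; first by move=> p _; exact: fc.
split=> [p _|w]; first exact: linear_differentiable.
by rewrite derive_linear //; exact: class_C_cst.
Qed.

Lemma class_C_linear_comp E F (G : normedModType R) k (U : set E) (f : E -> F)
    (l : {linear F -> G}) : open U ->
  continuous l -> class_C k U f -> class_C k U (l \o f).
Proof.
move=> oU lc; elim: k f => [|k IH] f.
  by move=> fc p Up; apply: continuous_comp; [exact: fc|exact: lc].
move=> [df Df]; split=> [p Up|w].
  by apply: differentiable_comp; [exact: df|exact: linear_differentiable].
apply: class_C_ext (IH _ (Df w)) => // q Uq /=.
have dl : differentiable l (f q) by exact: linear_differentiable.
have dc : differentiable (l \o f) q by apply: differentiable_comp => //; exact: df.
rewrite (deriveE _ dc) (deriveE _ (df q Uq)).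
by rewrite (diff_comp (df q Uq) dl) /= diff_lin.
Qed.

Lemma class_C_add E F k (U : set E) (f g : E -> F) : open U ->
  class_C k U f -> class_C k U g -> class_C k U (fun x => f x + g x).
Proof.
move=> oU; elim: k f g => [|k IH] f g.
  by move=> fc gc p Up; apply: continuousD; [exact: fc|exact: gc].
move=> [df Df] [dg Dg]; split=> [p Up|w].
  by apply: differentiableD; [exact: df|exact: dg].
apply: class_C_ext (IH _ _ (Df w) (Dg w)) => // q Uq.
rewrite -[RHS]/('D_w (f + g) q) deriveD //.
- by apply: diff_derivable; exact: df.
- by apply: diff_derivable; exact: dg.
Qed.

Lemma class_C_sum E F k (U : set E) n (f : 'I_n -> E -> F) : open U ->
  (forall i, class_C k U (f i)) -> class_C k U (fun x => \sum_i f i x).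
Proof.
move=> oU; elim: n f => [|n IH] f fC.
  by rewrite (_ : (fun _ => _) = cst 0); [exact: class_C_cst|apply/funext => x; rewrite big_ord0].
rewrite (_ : (fun _ => _) = fun x => \sum_i f (widen_ord (leqnSn n) i) x + f ord_max x).
  by apply: class_C_add => //; exact: IH.
by apply/funext => x; rewrite big_ord_recr.
Qed.

Lemma class_C_scale E F k (U : set E) (f : E -> R) (g : E -> F) : open U ->
  class_C k U f -> class_C k U g -> class_C k U (fun x => f x *: g x).
Proof.
move=> oU; elim: k f g => [|k IH] f g.
  by move=> fc gc p Up; apply: cvgZ; [exact: fc|exact: gc].
move=> Cf Cg; have [[df Df] [dg Dg]] := (Cf, Cg); split=> [p Up|w].
  exact: (diff_scale (df p Up) (dg p Up)).1.
apply: class_C_ext (class_C_add oU (IH _ _ (class_CS Cf) (Dg w)) (IH _ _ (Df w) (class_CS Cg))) => // q Uq.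
have [dfg dE] := diff_scale (df q Uq) (dg q Uq).
by rewrite (deriveE _ dfg) dE (deriveE _ (df q Uq)) (deriveE _ (dg q Uq)).
Qed.

Lemma class_C_mul E k (U : set E) (f g : E -> R) : open U ->
  class_C k U f -> class_C k U g -> class_C k U (fun x => f x * g x).
Proof. exact: class_C_scale. Qed.

Lemma class_C_pair E F (G : normedModType R) k (U : set E) (f : E -> F) (g : E -> G) :
  open U -> class_C k U f -> class_C k U g -> class_C k U (fun x => (f x, g x)).
Proof.
move=> oU; elim: k f g => [|k IH] f g.
  by move=> fc gc p Up; apply: cvg_pair; [exact: fc|exact: gc].
move=> [df Df] [dg Dg]; split=> [p Up|w].
  by apply: differentiable_pair; [exact: df|exact: dg].
apply: class_C_ext (IH _ _ (Df w) (Dg w)) => // q Uq.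
have dp := differentiable_pair (df q Uq) (dg q Uq).
by rewrite (deriveE _ dp) (deriveE _ (df q Uq)) (deriveE _ (dg q Uq)) diff_pair //; [exact: df|exact: dg].
Qed.

(** The derivative of the inverse contains the inverse again, squared, so the induction hypothesis
    is applied to the inverse itself one order below. *)
Lemma class_C_inv E k (U : set E) (f : E -> R) : open U ->
  (forall p, U p -> f p != 0) -> class_C k U f -> class_C k U (fun x => (f x)^-1).
Proof.
move=> oU f0; elim: k => [|k IH].
  by move=> fc p Up; apply: cvgV; [exact: f0|exact: fc].
move=> Cf; have [df Df] := Cf; split=> [p Up|w].
  by apply: differentiableV; [exact: df|exact: f0].
have If := IH (class_CS Cf).
have Ck := class_C_mul oU (class_C_cst k U (-1 : R)) (class_C_mul oU (class_C_mul oU If If) (Df w)).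
apply: (class_C_ext oU _ Ck) => q Uq.
rewrite deriveV ?f0 //; last by apply: diff_derivable; exact: df.
by rewrite /cst mulN1r scaleNr -exprVn expr2.
Qed.

End ClassC.

(** * Finite dimension and the chain rule *)

Section FiniteDimension.
Context {R : realType}.

(** A reconstruction formula with continuous functionals gives coordinatewise estimates and limits
    directly, and is stable under products. *)
Definition coordinate_system (E : normedModType R) n (e : 'I_n -> E)
    (l : 'I_n -> {linear E -> R}) : Prop :=
  (forall i, continuous (l i)) /\ forall x, x = \sum_i l i x *: e i.

Definition finite_dim (E : normedModType R) : Prop :=
  exists n (e : 'I_n -> E) (l : 'I_n -> {linear E -> R}), coordinate_system e l.

(** The prolonged flow is controlled only for short tangent vectors, so the directions in which the
    flow is differentiated must be rescaled to be short. *)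
Lemma finite_dim_small (E : normedModType R) (r : R) : finite_dim E -> 0 < r ->
  exists n (e : 'I_n -> E) (l : 'I_n -> {linear E -> R}),
    coordinate_system e l /\ forall i, `|e i| < r.
Proof.
move=> [n [e [l [lc le]]]] r0.
have [c c0 ec] : exists2 c : R, 0 < c & forall i, c * `|e i| < r.
  (* The summand 1 makes [M] positive even for an empty family and the final inequality strict. *)
  pose M := \sum_i `|e i| + 1.
  have M0 : 0 < M by rewrite ltr_wpDl // sumr_ge0.
  exists (r / M) => [|i]; first by rewrite divr_gt0.
  rewrite mulrAC ltr_pdivrMr // ltr_pM2l // /M (bigD1 i) //=.
  rewrite -addrA ltrDl ltr_wpDl // sumr_ge0 //.
pose l' i : {linear E -> R} := c^-1 \*: l i.
exists n, (fun i => c *: e i), l'; split; last first.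
  by move=> i; rewrite normrZ gtr0_norm.
split=> [i|x].
  by move=> x; apply: cvgZr; exact: lc.
rewrite [LHS]le; apply: eq_bigr => i _.
by rewrite /l' /= scalerA mulrAC mulVf ?mul1r // gt_eqF.
Qed.

Lemma coordinate_system_R : coordinate_system (fun _ : 'I_1 => 1 : R) (fun _ => idfun : {linear R -> R}).
Proof.
split=> [i|x]; first by move=> x; exact: cvg_id.
by rewrite big_ord1 /= [RHS]mulr1.
Qed.

Lemma finite_dim_R : finite_dim R.
Proof. by do 3 eexists; exact: coordinate_system_R. Qed.

Definition pair_basis (E F : normedModType R) m n (e : 'I_m -> E) (e' : 'I_n -> F)
    (i : 'I_(m + n)) : (E * F)%type :=
  match fintype.split i with inl j => (e j, 0) | inr j => (0, e' j) end.

Definition pair_coord (E F : normedModType R) m n (l : 'I_m -> {linear E -> R})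
    (l' : 'I_n -> {linear F -> R}) (i : 'I_(m + n)) : {linear (E * F)%type -> R} :=
  match fintype.split i with
  | inl j => l j \o fst : {linear (E * F)%type -> R}
  | inr j => l' j \o snd : {linear (E * F)%type -> R}
  end.

Lemma coordinate_system_pair (E F : normedModType R) m n (e : 'I_m -> E) (e' : 'I_n -> F) l l' :
  coordinate_system e l -> coordinate_system e' l' ->
  coordinate_system (pair_basis e e') (pair_coord l l').
Proof.
move=> [lc le] [lc' le']; split=> [i|[x y]].
  rewrite /pair_coord; case: fintype.split => j p; apply: continuous_comp.
  - exact: cvg_fst.
  - exact: lc.
  - exact: cvg_snd.
  - exact: lc'.
rewrite big_split_ord /= /pair_basis /pair_coord.
under eq_bigr do rewrite -[lshift _ _]/(unsplit (inl _)) unsplitK /=.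
under [X in _ = _ + X]eq_bigr do rewrite -[rshift _ _]/(unsplit (inr _)) unsplitK /=.
apply: injective_projections.
  rewrite /= !raddf_sum /= -le [X in _ = _ + X]big1 ?addr0 // => i _.
  by rewrite scaler0.
rewrite /= !raddf_sum /= -le' [X in _ = X + _]big1 ?add0r // => i _.
by rewrite scaler0.
Qed.

Lemma finite_dim_pair (E F : normedModType R) :
  finite_dim E -> finite_dim F -> finite_dim (E * F)%type.
Proof.
move=> [m [e [l el]]] [n [e' [l' el']]].
by exists (m + n)%N, (pair_basis e e'), (pair_coord l l'); exact: coordinate_system_pair.
Qed.

Lemma coord_is_linear m n (i : 'I_m) (j : 'I_n) :
  linear (fun M : 'M[R]_(m, n) => M i j : R).
Proof. by move=> a x y; rewrite !mxE. Qed.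

Definition mx_entry m n i j : {linear 'M[R]_(m, n) -> R} :=
  HB.pack (fun M : 'M[R]_(m, n) => M i j : R)
    (GRing.isLinear.Build _ _ _ _ _ (@coord_is_linear m n i j)).

Lemma coordinate_system_mx m n :
  coordinate_system
    (fun k : 'I_(#|{: 'I_m * 'I_n}|) => delta_mx (enum_val k).1 (enum_val k).2 : 'M[R]_(m, n))
    (fun k => mx_entry (enum_val k).1 (enum_val k).2).
Proof.
split=> [k|A]; first exact: coord_continuous.
rewrite [LHS]matrix_sum_delta pair_big /=.
by rewrite (reindex (@enum_val _ {: 'I_m * 'I_n}))//=; exact: onW_bij (enum_val_bij _).
Qed.

Lemma finite_dim_mx m n : finite_dim 'M[R]_(m, n).
Proof. by do 3 eexists; exact: coordinate_system_mx. Qed.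

Lemma derive_basis (E F : normedModType R) n (e : 'I_n -> E) l (f : E -> F) p w :
  coordinate_system e l -> differentiable f p ->
  'D_w f p = \sum_i l i w *: 'D_(e i) f p.
Proof.
move=> [lc le] df; rewrite deriveE // [in LHS](le w) linear_sum.
by apply: eq_bigr => i _; rewrite linearZ deriveE.
Qed.

Lemma class_C_coord (E F : normedModType R) n (e : 'I_n -> F) l k (U : set E) (f : E -> F) :
  open U -> coordinate_system e l -> (forall i, class_C k U (l i \o f)) -> class_C k U f.
Proof.
move=> oU [lc le] lf.
rewrite (_ : f = fun x => \sum_i l i (f x) *: e i); last by apply/funext => x; exact: le.
apply: class_C_sum => // i; apply: class_C_scale => //; first exact: lf.
exact: class_C_cst.
Qed.

(** The derivative of the composite is that of [g] in the direction ['D_w f x], which varies with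
    [x]. Expanding it in the fixed vectors [e i] gives a sum of products of functions already known
    to be of class [k]. *)
Lemma class_C_comp (E F G : normedModType R) k (U : set E) (V : set F)
    (f : E -> F) (g : F -> G) : finite_dim F -> open U ->
  (forall p, U p -> V (f p)) -> class_C k U f -> class_C k V g -> class_C k U (g \o f).
Proof.
move=> [n [e [l el]]] oU UV; elim: k g => [|k IH] g.
  by move=> fc gc p Up; apply: continuous_comp; [exact: fc|apply: gc; exact: UV].
move=> Cf Cg; have [[df Df] [dg Dg]] := (Cf, Cg); split=> [p Up|w].
  by apply: differentiable_comp; [exact: df|apply: dg; exact: UV].
have Ck : class_C k U (fun x => \sum_i l i ('D_w f x) *: ('D_(e i) g \o f) x).
  apply: class_C_sum => // i; apply: class_C_scale => //.
    by apply: (class_C_linear_comp oU (el.1 i)); exact: Df.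
  by apply: IH; [exact: class_CS|exact: Dg].
apply: (class_C_ext oU _ Ck) => q Uq.
have dgq := dg _ (UV q Uq).
have dc : differentiable (g \o f) q by apply: differentiable_comp => //; exact: df.
rewrite (deriveE _ dc) (diff_comp (df q Uq) dgq) /=.
by rewrite -deriveE // -deriveE; [rewrite (derive_basis _ el dgq)|exact: df].
Qed.

End FiniteDimension.

(** * Partial derivatives, Lipschitz bounds and Taylor remainders *)

Section PartialDerivatives.
Context {R : realType}.

Lemma is_derive_scalel (V : normedModType R) (D : V) (t : R) :
  is_derive t 1 (fun s : R => s *: D) D.
Proof.
apply/is_deriveP => e e0; exists 1 => // h _.
rewrite [h *: 1]mulr1 (_ : _ - _ - _ = 0) ?normr0 ?mulr_ge0 // ?ltW //.
by lmod R.
Qed.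

Lemma is_derive_sub (E V : normedModType R) (f g : E -> V) p w Df Dg :
  is_derive p w f Df -> is_derive p w g Dg ->
  is_derive p w (fun x => f x - g x) (Df - Dg).
Proof. by move=> df dg; exact: is_deriveB. Qed.

Lemma between_norm (s c : R) : (0 <= s <= c) || (c <= s <= 0) -> `|s| <= `|c|.
Proof.
case/orP => /andP[h1 h2].
  by rewrite !ger0_norm //; exact: le_trans h1 h2.
by rewrite !ler0_norm ?lerN2 //; exact: le_trans h1 h2.
Qed.

Lemma derivable_increment (E V : normedModType R) (f : E -> V) q w (c eps : R) D :
  (forall s : R, (0 <= s <= c) || (c <= s <= 0) ->
    derivable f (q + s *: w) w /\ `|'D_w f (q + s *: w) - D| <= eps) ->
  `|f (q + c *: w) - f q - c *: D| <= eps * `|c|.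
Proof.
move=> fD.
have := @mean_value_norm R V (fun s => f (q + s *: w) - s *: D)
  (fun s => 'D_w f (q + s *: w) - D) 0 c eps.
rewrite !scale0r addr0 !subr0 => mv.
rewrite addrAC; apply: mv => s /fD[df Df //].
apply: is_derive_sub; last exact: is_derive_scalel.
by apply: is_derive_line; split.
Qed.

(** The point is reached by moving along one coordinate direction after the other. Bounding the
    total length of this broken path by [d] keeps all its segments where the partial derivatives are
    close to [D]. *)
Lemma telescoped_increment (E V : normedModType R) n (e : 'I_n -> E) (f : E -> V)
    (p : E) (D : 'I_n -> V) (c : 'I_n -> R) (d eps : R) :
  (forall x, `|x - p| < d -> forall i, derivable f x (e i) /\
     `|'D_(e i) f x - D i| <= eps) ->
  forall (s : seq 'I_n) q, `|q - p| + \sum_(i <- s) `|c i| * `|e i| < d ->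
  `|f (q + \sum_(i <- s) c i *: e i) - f q - \sum_(i <- s) c i *: D i|
    <= eps * \sum_(i <- s) `|c i|.
Proof.
move=> fD; elim=> [|i s IH] q.
  by move=> _; rewrite !big_nil addr0 subrr subr0 normr0 mulr0.
rewrite !big_cons => qd.
have s0 : 0 <= \sum_(j <- s) `|c j| * `|e j| by apply: sumr_ge0 => j _; exact: mulr_ge0.
have pt (t : R) : `|t| <= `|c i| -> `|q + t *: e i - p| + \sum_(j <- s) `|c j| * `|e j| < d.
  move=> tc; apply: le_lt_trans qd; rewrite addrA lerD2r addrAC.
  by apply: le_trans (ler_normD _ _) _; rewrite lerD2l normrZ ler_wpM2r.
have pt' (t : R) : `|t| <= `|c i| -> `|q + t *: e i - p| < d.
  by move=> /pt; apply: le_lt_trans; rewrite lerDl.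
have h1 := IH (q + c i *: e i) (pt (c i) (lexx _)).
have h2 : `|f (q + c i *: e i) - f q - c i *: D i| <= eps * `|c i|.
  by apply: derivable_increment => t /between_norm /pt' /fD.
rewrite addrA mulrDr opprD addrA.
set S := \sum_(j <- s) c j *: e j in h1 *; set T := \sum_(j <- s) c j *: D j in h1 *.
have -> : f (q + c i *: e i + S) - f q - c i *: D i - T =
  (f (q + c i *: e i) - f q - c i *: D i) + (f (q + c i *: e i + S) - f (q + c i *: e i) - T).
  by lmod R.
by apply: le_trans (ler_normD _ _) _; exact: lerD.
Qed.

Lemma sum_scale_is_linear (E V : normedModType R) n (l : 'I_n -> {linear E -> R})
  (D : 'I_n -> V) : linear (fun h => \sum_i l i h *: D i).
Proof.
move=> a x y; rewrite scaler_sumr -big_split /=; apply: eq_bigr => i _.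
by rewrite linearP scalerDl scalerA.
Qed.

(** One constant for two uses: the first sum measures the accumulated error along a coordinate path,
    the second the length of that path. *)
Lemma coord_bound (E : normedModType R) n (e : 'I_n -> E) l : coordinate_system e l ->
  exists2 K : R, 0 < K & forall h, \sum_i `|l i h| <= K * `|h| /\
    \sum_i `|l i h| * `|e i| <= K * `|h|.
Proof.
move=> [lc _].
have /choice[k kP] i : exists k : R, 0 < k /\ forall x, `|l i x| <= k * `|x|.
  by have [k k0 kP] := linear_norm_le (lc i); exists k.
have k0 i : 0 <= k i by exact/ltW/(kP i).1.
exists (\sum_i k i * (1 + `|e i|) + 1) => [|h].
  by rewrite ltr_wpDl // sumr_ge0 // => i _; rewrite mulr_ge0 // addr_ge0.
have S (F : 'I_n -> R) : (forall i, F i <= k i * (1 + `|e i|) * `|h|) ->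
    \sum_i F i <= (\sum_i k i * (1 + `|e i|) + 1) * `|h|.
  move=> FP; rewrite mulrDl mul1r mulr_suml -[leLHS]addr0 lerD //.
  by apply: ler_sum => i _; exact: FP.
split; apply: S => i; have lk := (kP i).2 h; have e0 := normr_ge0 (e i).
  by apply: le_trans lk _; rewrite ler_wpM2r // ler_peMr // lerDl.
apply: le_trans (ler_wpM2r e0 lk) _.
rewrite mulrAC ler_wpM2r // ler_wpM2l // lerDr //.
Qed.

Lemma differentiable_partials (E F : normedModType R) n (e : 'I_n -> E) l
    (f : E -> F) (U : set E) p : coordinate_system e l -> open U -> U p ->
  (forall i q, U q -> derivable f q (e i)) ->
  (forall i, {for p, continuous ('D_(e i) f)}) -> differentiable f p.
Proof.
move=> el oU Up df Dc.
pose L : {linear E -> F} := HB.pack (fun h => \sum_i l i h *: 'D_(e i) f p)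
    (GRing.isLinear.Build _ _ _ _ _ (sum_scale_is_linear l (fun i => 'D_(e i) f p))).
have Lc : continuous L.
  move=> x; suff /(_ x) : class_C 0 setT L by apply.
  apply: (class_C_sum openT) => i.
  by apply: (class_C_scale openT); [apply: class_C_linear; exact: el.1|exact: class_C_cst].
apply: (proj1 (@differentiable_normP _ _ _ L _ _ Lc _)) => eps eps0.
have [K K0 KP] := coord_bound el.
have /nbhs_distP[d d0 dP] : nbhs p (fun x => U x /\
    forall i, `|'D_(e i) f x - 'D_(e i) f p| <= eps / K).
  apply: filterI; first exact: open_nbhs_nbhs.
  apply: filter_forall => i; apply/nbhs_distP.
  have /continuous_atP := Dc i; apply.
  by rewrite divr_gt0.
exists (d / K) => [|h hd]; first by rewrite divr_gt0.
have [h1 h2] := KP h.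
have := @telescoped_increment _ _ n e f p (fun i => 'D_(e i) f p) (fun i => l i h) d (eps / K).
move=> /(_ _ (index_enum _) p); rewrite -el.2 subrr normr0 add0r => T.
apply: le_trans (T _ _) _.
- by move=> x /dP[Ux Dx] i; split=> //; exact: df.
- by apply: le_lt_trans h2 _; rewrite mulrC -ltr_pdivlMr.
- apply: le_trans (ler_wpM2l _ h1) _; first by rewrite divr_ge0 // ltW.
  by rewrite mulrA divfK // gt_eqF.
Qed.

(** This raises the regularity of a flow: its time derivative and its derivatives along basis
    vectors are known explicitly and are of class [k]. *)
Lemma class_C_partials (E F : normedModType R) n (e : 'I_n -> E) l k
    (f : E -> F) (U : set E) : coordinate_system e l -> open U ->
  (forall i q, U q -> derivable f q (e i)) ->
  (forall i, class_C k U ('D_(e i) f)) -> class_C k.+1 U f.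
Proof.
move=> el oU df Dk.
have dif p : U p -> differentiable f p.
  move=> Up; apply: (differentiable_partials el oU Up df) => i.
  exact: class_C_continuous (Dk i) p Up.
split=> // w.
have Ck : class_C k U (fun x => \sum_i l i w *: 'D_(e i) f x).
  apply: class_C_sum => // i; apply: class_C_scale => //; exact: class_C_cst.
by apply: (class_C_ext oU _ Ck) => q Uq; rewrite (derive_basis _ el) //; exact: dif.
Qed.

(* Both iterated derivatives are limits of the second difference of [f] over
   [s ^ 2], which is symmetric in [v] and [w]. *)
Lemma derive_commute (E F : normedModType R) (f : E -> F) (U : set E) p v w :
  open U -> U p -> class_C 2 U f -> 'D_v ('D_w f) p = 'D_w ('D_v f) p.
Proof.
move=> oU Up Cf.
have [df Df] := Cf.
have key v' w' (eps : R) : 0 < eps -> exists2 d : R, 0 < d & forall s : R, 0 < s -> s < d ->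
    `|f (p + s *: v' + s *: w') - f (p + s *: v') - f (p + s *: w') + f p
      - (s * s) *: 'D_v' ('D_w' f) p| <= eps * (s * s).
  move=> eps0.
  have [dDf cDf] := Df w'.
  have /nbhs_distP[r r0 rP] : nbhs p (fun x => U x /\
      `|'D_v' ('D_w' f) x - 'D_v' ('D_w' f) p| <= eps).
    apply: filterI; first exact: open_nbhs_nbhs.
    by apply/nbhs_distP; have /continuous_atP := cDf v' p Up; apply.
  pose M := `|v'| + `|w'| + 1.
  have M0 : 0 < M by rewrite ltr_wpDl // addr_ge0.
  exists (r / M) => [|s s0 sr]; first by rewrite divr_gt0.
  have near_p (a b : R) : `|a| <= s -> `|b| <= s -> `|p + a *: v' + b *: w' - p| < r.
    move=> as_ bs; rewrite (_ : _ - p = a *: v' + b *: w'); last by lmod R.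
    apply: le_lt_trans (ler_normD _ _) _; rewrite !normrZ.
    move: sr; rewrite ltr_pdivlMr // => sr; apply: le_lt_trans sr.
    have h1 := ler_wpM2r (normr_ge0 v') as_; have h2 := ler_wpM2r (normr_ge0 w') bs.
    rewrite /M; lra.
  set A := 'D_v' ('D_w' f) p.
  have inner (t : R) : `|t| <= s ->
      `|'D_w' f (p + t *: w' + s *: v') - 'D_w' f (p + t *: w') - s *: A| <= eps * s.
    move=> ts; rewrite -[X in _ <= eps * X](gtr0_norm s0).
    apply: (@derivable_increment _ _ ('D_w' f) (p + t *: w') v' s eps A) => u.
    move=> /between_norm; rewrite (gtr0_norm s0) => us.
    have := rP _ (near_p u t us ts); rewrite addrAC => -[Uq Dq]; split=> //.
    by apply: diff_derivable; exact: dDf.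
  have := @mean_value_norm R F
    (fun t => f (p + s *: v' + t *: w') - f (p + t *: w') - t *: (s *: A))
    (fun t => 'D_w' f (p + s *: v' + t *: w') - 'D_w' f (p + t *: w') - s *: A) 0 s (eps * s).
  rewrite !scale0r !addr0 !subr0 (gtr0_norm s0) !scalerA => mv.
  have -> : f (p + s *: v' + s *: w') - f (p + s *: v') - f (p + s *: w') + f p - (s * s) *: A
     = f (p + s *: v' + s *: w') - f (p + s *: w') - (s * s) *: A - (f (p + s *: v') - f p).
    by lmod R.
  rewrite mulrA; apply: mv => t tb.
    have ts : `|t| <= s by move/between_norm: tb; rewrite (gtr0_norm s0).
    have ss : `|s| <= s by rewrite gtr0_norm.
    have s00 : `|0 : R| <= s by rewrite normr0 ltW.
    apply: is_derive_sub; last exact: is_derive_scalel.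
    apply: is_derive_sub; apply: is_derive_line.
      have [Uq _] := rP _ (near_p _ _ ss ts).
      by split=> //; apply: diff_derivable; exact: df.
    have [Uq _] := rP _ (near_p _ _ s00 ts); rewrite scale0r addr0 in Uq.
    by split=> //; apply: diff_derivable; exact: df.
  have ts : `|t| <= s by move/between_norm: tb; rewrite (gtr0_norm s0).
  by rewrite [p + s *: v' + _]addrAC; exact: inner.
apply/eqP; rewrite -subr_eq0 -normr_le0; apply/ler_addgt0Pr => e e0.
have e2 : 0 < e / 2 by rewrite divr_gt0.
have [d1 d10 d1P] := key v w _ e2; have [d2 d20 d2P] := key w v _ e2.
pose s := Num.min d1 d2 / 2.
have s0 : 0 < s by rewrite divr_gt0 // lt_min d10.
have sd : s < Num.min d1 d2 by rewrite ltr_pdivrMr // ltr_pMr ?ltr1n // lt_min d10.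
move: sd; rewrite lt_min => /andP[sd1 sd2].
have h1 := d1P s s0 sd1; have := d2P s s0 sd2.
set A := 'D_v ('D_w f) p in h1 *; set B := 'D_w ('D_v f) p.
rewrite [p + s *: w + _]addrAC [X in `|X + _ - _|]addrAC => h2.
have ss0 : 0 < s * s by rewrite mulr_gt0.
rewrite add0r -(ler_pM2l ss0) -[X in X * `|_|](gtr0_norm ss0) -normrZ scalerBr.
set X := _ + f p in h1 h2.
have -> : (s * s) *: A - (s * s) *: B = (X - (s * s) *: B) - (X - (s * s) *: A).
  by lmod R.
apply: le_trans (ler_normB _ _) _.
apply: le_trans (lerD h2 h1) _; lra.
Qed.

Lemma norm_segment_lt (E : normedModType R) (p x w : E) (r s : R) : 0 <= s <= 1 ->
  `|x - p| < r -> `|x + w - p| < r -> `|x + s *: w - p| < r.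
Proof.
move=> /andP[s0 s1] xr wr.
have -> : x + s *: w - p = (1 - s) *: (x - p) + s *: (x + w - p).
  by lmod R.
apply: le_lt_trans (ler_normD _ _) _.
rewrite !normrZ ger0_norm ?subr_ge0 // ger0_norm //.
have [->|sn] := eqVneq s 0; first by rewrite mul0r addr0 subr0 mul1r.
have sp : 0 < s by rewrite lt_neqAle eq_sym sn.
have h1 : (1 - s) * `|x - p| <= (1 - s) * r by rewrite ler_wpM2l ?subr_ge0 // ltW.
have h2 : s * `|x + w - p| < s * r by rewrite ltr_pM2l.
lra.
Qed.

(** Continuity bounds the finitely many basis derivatives near [p], coordinates make the bound
    uniform over directions, and the mean value inequality on the convex ball turns it into a
    Lipschitz constant. *)
Lemma locally_lipschitz (E F : normedModType R) (f : E -> F) (U : set E) p :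
  finite_dim E -> open U -> U p -> class_C 1 U f ->
  exists L r : R, [/\ 0 < L, 0 < r,
    (forall x, `|x - p| < r -> U x),
    (forall x, `|x - p| < r -> forall w, `|'D_w f x| <= L * `|w|) &
    (forall x y, `|x - p| < r -> `|y - p| < r -> `|f x - f y| <= L * `|x - y|)].
Proof.
move=> [n [e [l el]]] oU Up [df Df].
have [K K0 KP] := coord_bound el.
pose M := \sum_i `|'D_(e i) f p| + 1.
have M0 : 0 < M by rewrite ltr_wpDl // sumr_ge0.
have /nbhs_distP[r r0 rP] : nbhs p (fun x => U x /\ forall i, `|'D_(e i) f x| <= M).
  apply: filterI; first exact: open_nbhs_nbhs.
  apply: filter_forall => i; apply/nbhs_distP.
  have /continuous_atP /(_ 1 ltr01)[d d0 dP] := Df (e i) p Up.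
  exists d => // x /dP; set a := 'D_(e i) f x => h.
  have -> : a = (a - 'D_(e i) f p) + 'D_(e i) f p by rewrite subrK.
  apply: le_trans (ler_normD _ _) _; rewrite addrC lerD //.
  by rewrite (bigD1 i) //= lerDl sumr_ge0.
have Dle x : `|x - p| < r -> forall w, `|'D_w f x| <= M * K * `|w|.
  move=> /rP[Ux Dx] w; rewrite (derive_basis _ el); last exact: df.
  apply: le_trans (ler_norm_sum _ _ _) _.
  apply: (@le_trans _ _ (\sum_i M * `|l i w|)).
    by apply: ler_sum => i _; rewrite normrZ mulrC ler_wpM2r.
  by rewrite -mulr_sumr -mulrA ler_wpM2l ?(KP w).1 // ltW.
exists (M * K), r; split=> //; first by rewrite mulr_gt0.
  by move=> x /rP[].
move=> x y xr yr; have -> : x = y + (x - y) by rewrite addrC subrK.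
rewrite [y + _ - y]addrC addKr.
have seg s : 0 <= s <= 1 -> `|y + s *: (x - y) - p| < r.
  by move=> s01; apply: norm_segment_lt => //; rewrite [y + _]addrC subrK.
apply: (@mean_value_segment _ _ _ f (fun s => 'D_(x - y) f (y + s *: (x - y)))) => s /seg sr.
  by split=> //; apply: diff_derivable; apply: df; have [] := rP _ sr.
exact: Dle.
Qed.

(** The constant is uniform in the base point [x], because the remainder will be estimated at every
    point of a trajectory. It comes from Lipschitz bounds on the basis derivatives of [f]. *)
Lemma quadratic_remainder (E F : normedModType R) (f : E -> F) (U : set E) p :
  finite_dim E -> open U -> U p -> class_C 2 U f ->
  exists K r : R, [/\ 0 < K, 0 < r & forall x y, `|x - p| < r -> `|y - p| < r ->
    `|f y - f x - 'D_(y - x) f x| <= K * `|y - x| ^+ 2].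
Proof.
move=> fE oU Up Cf; have [n [e [l el]]] := fE; have [df Df] := Cf.
have [K K0 KP] := coord_bound el.
have /choice[Lr LrP] i : exists Lr : R * R, [/\ 0 < Lr.1, 0 < Lr.2,
    (forall x, `|x - p| < Lr.2 -> U x) &
    forall x y, `|x - p| < Lr.2 -> `|y - p| < Lr.2 ->
      `|'D_(e i) f x - 'D_(e i) f y| <= Lr.1 * `|x - y|].
  have [L [r [L0 r0 rU _ rL]]] := locally_lipschitz fE oU Up (Df (e i)).
  by exists (L, r).
have /nbhs_distP[r r0 rP] : nbhs p (fun x => U x /\ forall i, `|x - p| < (Lr i).2).
  apply: filterI; first exact: open_nbhs_nbhs.
  by apply: filter_forall => i; apply/nbhs_distP; exists (Lr i).2 => //; have [] := LrP i.
pose M := \sum_i (Lr i).1 + 1.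
have Lr0 i : 0 <= (Lr i).1 by have [/ltW] := LrP i.
have M0 : 0 < M by rewrite ltr_wpDl // sumr_ge0.
exists (M * K), r; split=> //; first by rewrite mulr_gt0.
move=> x y xr yr; set w := y - x.
have yE : y = x + w by rewrite addrC subrK.
have seg s : 0 <= s <= 1 -> `|x + s *: w - p| < r.
  by move=> s01; apply: norm_segment_lt => //; rewrite -yE.
have := @derivable_increment _ _ f x w 1 (M * K * `|w| ^+ 2) ('D_w f x).
rewrite !scale1r normr1 mulr1 -yE; apply=> s.
(* The increment is [c = 1], so the reversed range [1 <= s <= 0] is empty. *)
case/orP => [s01|/andP[/le_trans h /h]]; last by rewrite ler10.
have Us : U (x + s *: w) by have [] := rP _ (seg s s01).
have Ux : U x by have [] := rP _ xr.
split; first by apply: diff_derivable; exact: df.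
rewrite !(derive_basis _ el); try exact: df.
rewrite -sumrB; apply: le_trans (ler_norm_sum _ _ _) _.
apply: (@le_trans _ _ (\sum_i `|l i w| * (M * `|w|))).
  apply: ler_sum => i _; rewrite -scalerBr normrZ ler_wpM2l //.
  have [_ _ _ Li] := LrP i.
  apply: le_trans (Li _ _ _ _) _.
  - by have [_ +] := rP _ (seg s s01); apply.
  - by have [_ +] := rP _ xr; apply.
  - rewrite (_ : x + s *: w - x = s *: w); last by lmod R.
    rewrite normrZ mulrA ler_wpM2r //.
    have /andP[s0 s1] := s01; rewrite ger0_norm //.
    apply: (@le_trans _ _ (Lr i).1); first by rewrite ler_piMr.
    by rewrite /M (bigD1 i) //= -addrA lerDl addr_ge0 // sumr_ge0.
rewrite -mulr_suml; have := (KP w).1.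
set S := \sum_i _ => h.
apply: le_trans (ler_wpM2r _ h) _; first by rewrite mulr_ge0 // ltW.
by rewrite le_eqVlt; apply/orP; left; apply/eqP; ring.
Qed.

End PartialDerivatives.

(** * Ordinary differential equations *)

Section Curves.
Context {R : realType}.

(** The local hypothesis is symmetric in [s] and [s'], so it also propagates the failure of [P]. The
    points where [P] holds and those where it fails are both open, and the interval is connected. *)
Lemma interval_propagation (P : R -> Prop) (a b t0 : R) : a < t0 < b -> P t0 ->
  (forall t, a < t < b -> exists2 d : R, 0 < d &
    forall s s', a < s < b -> a < s' < b -> `|s - t| < d -> `|s' - t| < d ->
      P s -> P s') ->
  forall t, a < t < b -> P t.
Proof.
move=> t0ab Pt0 loc t tab.
have opn (Q : R -> Prop) : (forall u, a < u < b -> Q u -> exists2 d : R, 0 < d &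
    forall s, a < s < b -> `|s - u| < d -> Q s) -> open [set x | a < x < b /\ Q x].
  move=> Qloc; rewrite openE => x [/= xab Qx].
  have [d d0 dP] := Qloc x xab Qx.
  have : nbhs x (fun s => a < s < b /\ `|s - x| < d).
    apply: filterI; last by apply/nbhs_distP; exists d.
    have := open_nbhs_nbhs (conj (@interval_open R (BRight a) (BLeft b) isT isT) _).
    by move=> /(_ x); rewrite /= in_itv /= => /(_ xab); apply: filterS => s /=; rewrite in_itv.
  by apply: filterS => s [sab sx]; split=> //; exact: dP.
have conn : connected `]a, b[%classic by apply/connected_intervalP; exact: interval_is_interval.
have := conn [set x | a < x < b /\ P x].
have -> : `]a, b[%classic = [set x | a < x < b] by apply/seteqP; split=> x; rewrite /= in_itv.
move=> /(_ _ _ _)/seteqP[| | |_ /(_ t tab)[]//].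
- by exists t0.
- exists [set x | a < x < b /\ P x]; last by apply/seteqP; split=> x /= [? ?//]; case.
  apply: opn => u uab Pu; have [d d0 dP] := loc u uab.
  by exists d => // s sab su; apply: (dP u s) => //; rewrite subrr normr0.
- exists (~` [set x | a < x < b /\ ~ P x]).
    apply: open_closedC; apply: opn => u uab Pu; have [d d0 dP] := loc u uab.
    by exists d => // s sab su Ps; apply: Pu; apply: (dP s u) => //; rewrite subrr normr0.
  apply/seteqP; split=> x /= [xab xP]; split=> //; first by case.
  by apply: contrapT => nP; apply: xP.
Qed.

Lemma gronwall_small (V : normedModType R) (z g : R -> V) (a b t0 L r : R) :
  a < t0 < b -> 0 <= L -> 0 <= r -> (b - a) * L <= 1 / 2 ->
  (forall t, a < t < b -> is_derive t 1 z (g t)) ->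
  (forall t, a < t < b -> `|g t| <= L * `|z t| + r) ->
  forall t, a < t < b -> `|z t| <= 2 * (`|z t0| + r * (b - a)).
Proof.
move=> /andP[at0 t0b] L0 r0 Lab dz gz t /andP[at_ tb].
(* The open interval provides no maximum, but the compact segment between [t0] and [t] inside it
   does. *)
pose lo := Num.min t0 t; pose hi := Num.max t0 t.
have sub s : lo <= s <= hi -> a < s < b.
  move=> /andP[los shi]; apply/andP; split.
    by apply: lt_le_trans los; rewrite lt_min at0.
  by apply: le_lt_trans shi _; rewrite gt_max t0b.
have lohi : lo <= hi by rewrite ge_min; apply/orP; left; rewrite le_max lexx.
have zc : {within `[lo, hi], continuous (fun s => `|z s|)}.
  apply: continuous_in_subspaceT => s /set_mem; rewrite /= in_itv /= => /sub sab.
  apply: cvg_norm; exact: is_derive_continuous (dz s sab).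
have [c] := EVT_max lohi zc; rewrite in_itv /= => chl cmax.
have tS : `|z t| <= `|z c|.
  by apply: cmax; rewrite in_itv /= /lo /hi ge_min le_max !lexx !orbT.
have btw s : (t0 <= s <= c) || (c <= s <= t0) -> lo <= s <= hi.
  have /andP[lc ch] := chl.
  have lt0 : lo <= t0 by rewrite ge_min lexx.
  have ht0 : t0 <= hi by rewrite le_max lexx.
  case/orP => /andP[h1 h2]; apply/andP; split.
  - exact: le_trans h1.
  - exact: le_trans ch.
  - exact: le_trans h1.
  - exact: le_trans ht0.
have := @mean_value_norm R V z g t0 c (L * `|z c| + r).
move=> /(_ _ _)/wrap[].
- by move=> s /btw /sub; exact: dz.
- move=> s /btw sb; apply: le_trans (gz s (sub s sb)) _.
  by rewrite lerD2r ler_wpM2l // cmax // in_itv.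
move=> h.
have cab : `|c - t0| <= b - a.
  have /sub/andP[ac cb] := chl.
  by rewrite ler_norml; apply/andP; split; lra.
have h1 : `|z c| <= `|z t0| + (L * `|z c| + r) * (b - a).
  have -> : z c = z t0 + (z c - z t0) by rewrite addrC subrK.
  apply: le_trans (ler_normD _ _) _; rewrite lerD2l.
  rewrite [z t0 + _]addrC subrK; apply: le_trans h _; rewrite ler_wpM2l //.
  by rewrite addr_ge0 // mulr_ge0.
(* This half is absorbed into the left side of [h1], whence the factor 2 of the conclusion. *)
have h2 : (L * `|z c|) * (b - a) <= 1 / 2 * `|z c|.
  by rewrite mulrAC [L * _]mulrC ler_wpM2r.
have h3 := normr_ge0 (z c).
apply: le_trans tS _; lra.
Qed.

(** The bound is asked for only near zeros of [z], with a constant depending on the zero. This is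
    what local Lipschitz constants around a common point of two trajectories, or around a point of
    one trajectory, can provide. *)
Lemma vanishing_of_derivative_bound (V : normedModType R) (z g : R -> V) (a b t0 : R) :
  a < t0 < b -> z t0 = 0 ->
  (forall t, a < t < b -> is_derive t 1 z (g t)) ->
  (forall t, a < t < b -> z t = 0 -> exists d L : R, 0 < d /\
    forall s, a < s < b -> `|s - t| < d -> `|g s| <= L * `|z s|) ->
  forall t, a < t < b -> z t = 0.
Proof.
move=> t0ab zt0 dz gz; apply: (interval_propagation t0ab zt0) => t tab.
have [zt|zt] := eqVneq (z t) 0; last first.
  (* Near a time where [z] does not vanish it stays nonzero, so the implication to be propagated is
     vacuous there. *)
  have zc := is_derive_continuous (dz t tab).
  have e0 : 0 < `|z t| / 2 by rewrite divr_gt0 // normr_gt0.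
  have [d d0 dP] := (continuous_atP _ _).1 zc _ e0.
  exists d => // s s' _ _ sd _ zs.
  have := dP s sd; rewrite zs sub0r normrN => h.
  have : 0 < `|z t| by rewrite normr_gt0.
  by move=> zt0'; exfalso; lra.
have [d [L [d0 dL]]] := gz t tab zt.
pose L' := `|L| + 1; have L'0 : 0 < L' by rewrite ltr_wpDl.
(* An interval of radius [d'] has length at most [2 * d'], and [2 * d' * L' <= 1 / 2] is the
   smallness required by [gronwall_small]. *)
pose d' := Num.min d (1 / (4 * L')).
have d'0 : 0 < d' by rewrite lt_min d0 divr_gt0 // mulr_gt0.
exists d' => // s s' /andP[as_ sb] /andP[as' s'b] sd s'd zs.
pose a' := Num.max a (t - d'); pose b' := Num.min b (t + d').
have inab u : a' < u < b' -> (a < u < b) /\ `|u - t| < d'.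
  rewrite gt_max lt_min => /andP[/andP[h1 h2] /andP[h3 h4]].
  by rewrite h1 h3 ltr_norml; split=> //; apply/andP; split; lra.
have inab' u : a < u < b -> `|u - t| < d' -> a' < u < b'.
  move=> /andP[h1 h2]; rewrite ltr_norml => /andP[h3 h4].
  by apply/andP; split; [rewrite gt_max h1|rewrite lt_min h2] => /=; lra.
have sab : a' < s < b' by apply: inab' => //; apply/andP.
have s'ab : a' < s' < b' by apply: inab' => //; apply/andP.
have bad : b' - a' <= 2 * d'.
  have h1 : b' <= t + d' by rewrite ge_min lexx orbT.
  have h2 : t - d' <= a' by rewrite le_max lexx orbT.
  by lra.
have dd : d' * (4 * L') <= 1.
  by rewrite -ler_pdivlMr ?mulr_gt0 // ge_min lexx orbT.
have := @gronwall_small V z g a' b' s L' 0 sab (ltW L'0) (lexx 0).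
move=> /(_ _ _ _ s' s'ab)/wrap[].
- have h := ler_wpM2r (ltW L'0) bad.
  apply: le_trans h _; lra.
- by move=> u /inab[uab _]; exact: dz.
- move=> u /inab[uab ud]; rewrite addr0.
  apply: le_trans (dL u uab _) _; first by apply: lt_le_trans ud _; rewrite ge_min lexx.
  by rewrite ler_wpM2r // /L' (le_trans (ler_norm _)) // lerDl.
by rewrite zs normr0 mul0r addr0 mulr0 normr_le0 => /eqP.
Qed.

Lemma ode_unique (E : normedModType R) (U : set E) (f : E -> E) (y1 y2 : R -> E)
    (a b t0 : R) : finite_dim E -> open U -> class_C 1 U f -> a < t0 < b ->
  y1 t0 = y2 t0 ->
  (forall t, a < t < b -> U (y1 t) /\ is_derive t 1 y1 (f (y1 t))) ->
  (forall t, a < t < b -> U (y2 t) /\ is_derive t 1 y2 (f (y2 t))) ->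
  forall t, a < t < b -> y1 t = y2 t.
Proof.
move=> fE oU Cf t0ab y12 s1 s2 t tab; apply/eqP; rewrite -subr_eq0; apply/eqP.
apply: (@vanishing_of_derivative_bound _ (fun s => y1 s - y2 s)
  (fun s => f (y1 s) - f (y2 s)) a b t0) => //.
- by rewrite y12 subrr.
- by move=> s sab; apply: is_derive_sub; [exact: (s1 s sab).2|exact: (s2 s sab).2].
move=> s sab /eqP; rewrite subr_eq0 => /eqP ys.
have [L [r [L0 r0 _ _ Lr]]] := locally_lipschitz fE oU (s1 s sab).1 Cf.
have r2 : 0 < r / 2 by rewrite divr_gt0.
have rr : r / 2 < r by rewrite ltr_pdivrMr // ltr_pMr // ltr1n.
have [d1 d10 d1P] := (continuous_atP _ _).1 (is_derive_continuous (s1 s sab).2) _ r2.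
have [d2 d20 d2P] := (continuous_atP _ _).1 (is_derive_continuous (s2 s sab).2) _ r2.
exists (Num.min d1 d2), L; split; first by rewrite lt_min d10.
move=> u uab; rewrite lt_min => /andP[u1 u2]; apply: Lr.
  exact: le_lt_trans (d1P u u1) rr.
by rewrite ys; exact: le_lt_trans (d2P u u2) rr.
Qed.

Lemma real_primitive (f : R -> R) (T : R) : 0 < T -> continuous f ->
  exists G : R -> R, forall t : R, `|t| < T -> is_derive t 1 G (f t).
Proof.
move=> T0 fc.
exists (fun x => (\int[lebesgue_measure]_(t in [set` Interval (BLeft (- T)) (BRight x)]) f t)%R).
move=> t; rewrite ltr_norml => /andP[Tt tT].
have int : lebesgue_measure.-integrable [set` Interval (BLeft (- T)) (BRight T)] (EFin \o f).
  apply: continuous_compact_integrable; first exact: segment_compact.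
  by apply: continuous_subspaceT.
have [] := @continuous_FTC1 R f (BLeft (- T)) t T tT int _ (fc t).
  by rewrite /Order.lt /=.
by move=> dG; rewrite derive1E => GE; exact: DeriveDef dG GE.
Qed.

(** Integrating the coordinates separately avoids integrals with values in [E]. *)
Lemma finite_dim_primitive (E : normedModType R) (f : R -> E) (T : R) :
  finite_dim E -> 0 < T -> continuous f ->
  exists G : R -> E, G 0 = 0 /\ forall t : R, `|t| < T -> is_derive t 1 G (f t).
Proof.
move=> [n [e [l [lc le]]]] T0 fc.
have /choice[G GP] i : exists G : R -> R, forall t : R, `|t| < T -> is_derive t 1 G (l i (f t)).
  by apply: real_primitive => // t; apply: continuous_comp; [exact: fc|exact: lc].
pose H t := \sum_i G i t *: e i.
exists (fun t => H t - H 0); split; first by rewrite subrr.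
move=> t tT; suff dH : is_derive t 1 H (f t).
  by have := is_derive_sub dH (is_derive_cst (H 0) t 1); rewrite subr0.
rewrite [f t]le (_ : H = \sum_i (fun t => G i t *: e i)); last first.
  by apply/funext => s; rewrite fct_sumE.
apply: is_derive_sum => i.
apply/is_deriveP => eps eps0.
have k0 : 0 < `|e i| + 1 by rewrite ltr_wpDl.
have [d d0 dP] := (is_deriveP _ _ _ _).1 (GP i t tT) (eps / (`|e i| + 1)) (divr_gt0 eps0 k0).
exists d => // h /dP hd.
rewrite (_ : _ - _ - _ = (G i (t + h *: 1) - G i t - h *: l i (f t)) *: e i); last first.
  by rewrite !scalerBl scalerA.
rewrite normrZ; apply: le_trans (ler_wpM2r (normr_ge0 _) hd) _.
rewrite mulrAC ler_wpM2r // -mulrA ler_piMr ?(ltW eps0) //.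
by rewrite mulrC ler_pdivrMr // mul1r lerDl.
Qed.

(** The radius [s k = 2 * C / 2 ^+ k] is the tail of the geometric series from rank [k], so the
    intervals of radius [s k] around [u k] are nested; the supremum of their left ends lies in all
    of them. *)
Lemma real_geometric_limit (u : nat -> R) (C : R) :
  (forall k, `|u k.+1 - u k| <= C / 2 ^+ k) ->
  exists x : R, forall k, `|x - u k| <= 2 * C / 2 ^+ k.
Proof.
move=> uC; have C0 : 0 <= C by apply: le_trans (normr_ge0 _) (le_trans (uC 0%N) _); rewrite expr0 divr1.
pose s k := 2 * C / 2 ^+ k.
have sS k : s k = s k.+1 + C / 2 ^+ k.
  rewrite /s exprS; field. by rewrite expf_neq0.
have mono k d : u k - s k <= u (k + d)%N - s (k + d)%N /\ u (k + d)%N + s (k + d)%N <= u k + s k.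
  elim: d => [|d [IH1 IH2]]; first by rewrite addn0 !lexx.
  have := uC (k + d)%N; rewrite ler_norml => /andP[h1 h2].
  have := sS (k + d)%N; rewrite addnS => h3.
  by split; lra.
have s0 k : 0 <= s k by rewrite /s divr_ge0 ?mulr_ge0 // exprn_ge0.
have ub k j : u j - s j <= u k + s k.
  have [kj|jk] := leqP k j.
    have := mono k (j - k)%N; rewrite subnKC // => -[_ h]; have := s0 j; lra.
  have := mono j (k - j)%N; rewrite subnKC ?(ltnW jk) // => -[h _]; have := s0 k; lra.
pose A := [set u k - s k | k in [set: nat]].
have A0 : A !=set0 by exists (u 0%N - s 0%N), 0%N.
have Aub k : ubound A (u k + s k) by move=> _ [j _ <-].
have hA : has_sup A by split=> //; exists (u 0%N + s 0%N).
exists (sup A) => k; rewrite ler_norml; apply/andP; split.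
  have : u k - s k <= sup A by apply: sup_upper_bound => //; exists k.
  rewrite -/(s k); lra.
have : sup A <= u k + s k by apply: ge_sup.
rewrite -/(s k); lra.
Qed.

Lemma geometric_small (a e : R) : 0 <= a -> 0 < e -> exists k, a / 2 ^+ k < e.
Proof.
move=> a0 e0; exists (Num.bound (a / e)).
have := archi_boundP (divr_ge0 a0 (ltW e0)).
rewrite !ltr_pdivrMr ?exprn_gt0 // => /lt_le_trans; apply.
rewrite mulrC ler_wpM2l ?(ltW e0) // -natrX ler_nat ltnW // ltn_expl //.
Qed.

(** Completeness of [E] is replaced by limits of the coordinates. The factor [A] is chosen before
    the sequence, so the same one serves all times of the Picard iteration. *)
Lemma geometric_limit (E : normedModType R) : finite_dim E -> exists2 A : R, 0 < A &
  forall (u : nat -> E) (C : R), (forall k, `|u k.+1 - u k| <= C / 2 ^+ k) ->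
  exists x : E, forall k, `|x - u k| <= A * C / 2 ^+ k.
Proof.
move=> [n [e [l el]]]; have [K K0 KP] := coord_bound el.
pose B := \sum_i `|e i| + 1.
have B0 : 0 < B by rewrite ltr_wpDl // sumr_ge0.
exists (2 * K * B) => [|u C uC]; first by rewrite !mulr_gt0.
have /choice[x xP] i : exists x : R, forall k, `|x - l i (u k)| <= 2 * (K * C) / 2 ^+ k.
  apply: real_geometric_limit => k; rewrite -linearB.
  rewrite -mulrA; apply: le_trans (ler_wpM2l (ltW K0) (uC k)).
  apply: le_trans _ (KP _).1; rewrite (bigD1 i) //= lerDl sumr_ge0 //.
exists (\sum_i x i *: e i) => k.
rewrite [u k]el.2 -sumrB; apply: le_trans (ler_norm_sum _ _ _) _.
apply: (@le_trans _ _ (\sum_i (2 * (K * C) / 2 ^+ k) * `|e i|)).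
  by apply: ler_sum => i _; rewrite -scalerBl normrZ ler_wpM2r.
rewrite -mulr_sumr.
have C0 : 0 <= C by apply: le_trans (normr_ge0 _) (le_trans (uC 0%N) _); rewrite expr0 divr1.
have p0 : 0 <= 2 * (K * C) / 2 ^+ k.
  by rewrite divr_ge0 ?exprn_ge0 // mulr_ge0 // mulr_ge0 // ltW.
have SB : \sum_i `|e i| <= B by rewrite lerDl.
by apply: le_trans (ler_wpM2l p0 SB) _; rewrite le_eqVlt; apply/orP; left; apply/eqP; ring.
Qed.

Lemma clamp_continuous (T : R) : continuous (fun t : R => Num.max (- T) (Num.min T t)).
Proof.
move=> t; apply/continuous_atP => e e0; exists e => // x.
rewrite ltr_norml ler_norml !maxEle !minEle => /andP[h1 h2].
case: (leP T x) => hx; case: (leP T t) => ht; case: (leP (- T) T) => hT;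
  case: (leP (- T) x) => hx'; case: (leP (- T) t) => ht';
  by apply/andP; split; lra.
Qed.

(** The existence time [T] is common to all initial points of the half-radius ball; a flow defined
    on a product of a time interval and a neighbourhood depends on this. *)
Lemma picard_lindelof (E : normedModType R) (f : E -> E) p (r L : R) :
  finite_dim E -> 0 < r -> 0 < L ->
  (forall x y, `|x - p| < r -> `|y - p| < r -> `|f x - f y| <= L * `|x - y|) ->
  exists2 T : R, 0 < T & forall q, `|q - p| < r / 2 -> exists y : R -> E,
    y 0 = q /\ forall t : R, `|t| < T -> `|y t - p| < r /\ is_derive t 1 y (f (y t)).
Proof.
move=> fE r0 L0 fL.
pose M := `|f p| + L * r.
have M0 : 0 < M by rewrite ltr_wpDl // mulr_gt0.
have fM x : `|x - p| < r -> `|f x| <= M.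
  move=> xr; have -> : f x = f p + (f x - f p) by rewrite addrC subrK.
  apply: le_trans (ler_normD _ _) _; rewrite lerD2l.
  apply: le_trans (fL x p xr _) _; first by rewrite subrr normr0.
  by rewrite ler_wpM2l // ltW.
(* The first bound keeps the iterates issued from the half-radius ball inside the ball of radius
   [r]; the second makes the Picard map halve uniform distances. *)
pose T := Num.min (r / (2 * M)) (1 / (2 * L)).
have T0 : 0 < T by rewrite lt_min !divr_gt0 // mulr_gt0.
have TM : T * M <= r / 2.
  apply: (@le_trans _ _ (r / (2 * M) * M)); first by rewrite ler_wpM2r ?ge_min ?lexx // ltW.
  by rewrite invfM mulrA divfK // gt_eqF.
have TL : T * L <= 1 / 2.
  apply: (@le_trans _ _ (1 / (2 * L) * L)); first by rewrite ler_wpM2r ?ge_min ?lexx ?orbT // ltW.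
  by rewrite invfM mulrA divfK // gt_eqF.
clearbody T.
(* Clamping time makes the iterates continuous on the whole line. Primitives are taken on the
   interval of radius [2 * T], which contains the clamped times in its interior. *)
pose tau (t : R) := Num.max (- T) (Num.min T t).
have tauT t : `|tau t| <= T.
  by rewrite ler_norml le_max lexx /= ge_max ge_min lexx /= andbT lerNl; lra.
have tauT2 t : `|tau t| < 2 * T by apply: le_lt_trans (tauT t) _; lra.
have tau0 : tau 0 = 0 by rewrite /tau min_r ?(ltW T0) // max_r //; lra.
have tauE t : `|t| < T -> tau t = t.
  by rewrite ltr_norml => /andP[h1 h2]; rewrite /tau min_r ?ltW // max_r // ltW.
have tauc : continuous tau by exact: clamp_continuous.
exists T => // q qr.
pose good (y : R -> E) := continuous y /\ forall t, `|y t - p| < r.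
(* The Picard map as a relation, because primitives are only known to exist; the sequence of
   iterates is then extracted by choice. *)
pose Step (y y' : R -> E) := exists G : R -> E, [/\ G 0 = 0,
   forall t : R, `|t| < 2 * T -> is_derive t 1 G (f (y t)) & forall t, y' t = q + G (tau t)].
have stepex y : good y -> exists y', Step y y'.
  move=> [yc yr].
  have fyc : continuous (fun t => f (y t)).
    move=> t; apply: continuous_comp; first exact: yc.
    apply/continuous_atP => e e0.
    have rt : 0 < r - `|y t - p| by rewrite subr_gt0.
    exists (Num.min (r - `|y t - p|) (e / L)); first by rewrite lt_min rt divr_gt0.
    move=> x; rewrite lt_min => /andP[x1 x2].
    have xr : `|x - p| < r.
      rewrite (_ : x - p = (x - y t) + (y t - p)); last by lmod R.
      by apply: le_lt_trans (ler_normD _ _) _; rewrite -ltrBrDr.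
    apply: le_trans (fL _ _ xr (yr t)) _.
    by rewrite mulrC -ler_pdivlMr // ltW.
  have [|G [G0 dG]] := @finite_dim_primitive E _ (2 * T) fE _ fyc; first by lra.
  by exists (fun t => q + G (tau t)), G.
have Gbound y G : (forall t, `|y t - p| < r) -> G 0 = 0 ->
    (forall t : R, `|t| < 2 * T -> is_derive t 1 G (f (y t))) -> forall t, `|G (tau t)| <= r / 2.
  move=> yr G0 dG t.
  have := @mean_value_norm R E G (fun s => f (y s)) 0 (tau t) M.
  rewrite G0 !subr0 => mv; apply: le_trans (mv _ _) _.
  - by move=> s /between_norm st; apply: dG; exact: le_lt_trans st (tauT2 t).
  - by move=> s _; exact: fM.
  - by apply: le_trans TM; rewrite mulrC ler_wpM2r // ltW.
have pr : `|q - p| + r / 2 < r by lra.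
have stepgood y y' : good y -> Step y y' -> good y'.
  move=> [yc yr] [G [G0 dG y'E]]; split=> t.
    rewrite (_ : y' = (fun s => q + G (tau s))); last by apply/funext.
    apply: continuousD; first exact: cst_continuous.
    apply: continuous_comp; first exact: tauc.
    exact: is_derive_continuous (dG _ (tauT2 t)).
  rewrite y'E (_ : _ - p = (q - p) + G (tau t)); last by lmod R.
  apply: le_lt_trans (ler_normD _ _) (le_lt_trans _ pr).
  by rewrite lerD2l; exact: Gbound dG t.
have stepdist y y' w w' D : good y -> good w -> Step y y' -> Step w w' ->
    (forall t, `|y t - w t| <= D) -> forall t, `|y' t - w' t| <= D / 2.
  move=> [_ yr] [_ wr] [G [G0 dG y'E]] [H [H0 dH w'E]] yw t.
  have D0 : 0 <= D by exact: le_trans (yw 0).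
  rewrite y'E w'E (_ : _ - _ = G (tau t) - H (tau t)); last by lmod R.
  have := @mean_value_norm R E (fun s => G s - H s) (fun s => f (y s) - f (w s)) 0 (tau t) (L * D).
  rewrite G0 H0 !subr0 => mv; apply: le_trans (mv _ _) _.
  - move=> s /between_norm st; have s2 := le_lt_trans st (tauT2 t).
    by apply: is_derive_sub; [exact: dG|exact: dH].
  - by move=> s _; apply: le_trans (fL _ _ (yr s) (wr s)) _; rewrite ler_wpM2l // ltW.
  - have h := ler_wpM2l (mulr_ge0 (ltW L0) D0) (tauT t).
    apply: le_trans h _.
    have := ler_wpM2r D0 TL; lra.
have good0 : good (fun=> q) by split=> [t|t]; [exact: cst_continuous|lra].
pose gt := {y : R -> E | good y}.
have /choice[nxt nxtP] (y : gt) : exists y' : gt, Step (sval y) (sval y').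
  have [y' yy'] := stepex _ (svalP y).
  by exists (exist _ y' (stepgood _ _ (svalP y) yy')).
pose Y k := sval (iter k nxt (exist _ _ good0)).
have Yg k : good (Y k) by exact: svalP.
have YS k : Step (Y k) (Y k.+1) by exact: nxtP.
have Yd k t : `|Y k.+1 t - Y k t| <= (r / 2) / 2 ^+ k.
  elim: k t => [|k IH] t.
    have [G [G0 dG YE]] := YS 0%N; rewrite YE expr0 divr1.
    rewrite (_ : _ - _ = G (tau t)); last by rewrite /Y /=; lmod R.
    by apply: (Gbound (Y 0%N)) => //; have [] := Yg 0%N.
  have := stepdist _ _ _ _ _ (Yg k.+1) (Yg k) (YS k.+1) (YS k) IH t.
  by rewrite exprS invfM mulrCA [2^-1 * _]mulrC.
have [A A0 AP] := geometric_limit fE.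
have /choice[y yP] t := AP (fun k => Y k t) _ (fun k => Yd k t).
have pw (e : R) : 0 < e -> exists k, A * (r / 2) / 2 ^+ k < e.
  by apply: geometric_small; rewrite mulr_ge0 ?divr_ge0 // ltW.
have yr t : `|y t - p| <= `|q - p| + r / 2.
  apply/ler_addgt0Pr => e e0; have [k kP] := pw e e0.
  have Yr : `|Y k t - p| <= `|q - p| + r / 2.
    case: k {kP} => [|j]; first by rewrite /Y /= lerDl divr_ge0 // ltW.
    have [G [G0 dG YE]] := YS j.
    rewrite YE; have -> : q + G (tau t) - p = (q - p) + G (tau t) by lmod R.
    apply: le_trans (ler_normD _ _) _; rewrite lerD2l; apply: (Gbound (Y j)) => //.
    by have [] := Yg j.
  rewrite (_ : y t - p = (Y k t - p) + (y t - Y k t)); last by lmod R.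
  by apply: le_trans (ler_normD _ _) _; apply: lerD => //; exact: le_trans (yP t k) (ltW kP).
have yc : continuous y.
  move=> t; apply/continuous_atP => e e0.
  have e3 : 0 < e / 3 by rewrite divr_gt0.
  have [k kP] := pw _ e3.
  have [d d0 dP] := (continuous_atP _ _).1 ((Yg k).1 t) _ e3.
  exists d => // s /dP h.
  rewrite (_ : y s - y t = (y s - Y k s) + (Y k s - Y k t) - (y t - Y k t)); last by lmod R.
  apply: le_trans (ler_normB _ _) _.
  have h1 := yP s k; have h2 := yP t k.
  have := ler_normD (y s - Y k s) (Y k s - Y k t).
  lra.
have yg : good y by split=> // t; exact: le_lt_trans (yr t) pr.
have [y' yy'] := stepex y yg.
(* The limit is a fixed point: [y'] is half as far from [Y k.+1] as [y] is from [Y k], and both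
   distances tend to zero. *)
have y'y t : y' t = y t.
  apply/eqP; rewrite -subr_eq0 -normr_le0; apply/ler_addgt0Pr => e e0.
  have e2 : 0 < e / 2 by rewrite divr_gt0.
  have [k kP] := pw _ e2.
  have h1 := stepdist _ _ _ _ _ yg (Yg k) yy' (YS k) (fun s => yP s k) t.
  have h2 : `|y t - Y k.+1 t| <= e / 2.
    apply: le_trans (yP t k.+1) _; apply: le_trans (ltW kP).
    rewrite exprS invfM mulrCA ler_piMl //.
      by rewrite !mulr_ge0 ?invr_ge0 ?exprn_ge0 // ltW // divr_gt0.
    by rewrite invf_le1 // ler1n.
  rewrite (_ : y' t - y t = (y' t - Y k.+1 t) - (y t - Y k.+1 t)); last by lmod R.
  apply: le_trans (ler_normB _ _) _; lra.
exists y; have [G [G0 dG y'E]] := yy'; split.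
  by rewrite -y'y y'E tau0 G0 addr0.
move=> t tT; split; first exact: yg.2.
have tT2 : `|t| < 2 * T by lra.
(* Near a time [t] with [|t| < T] the clamping is the identity, so [y] is there the unclamped
   primitive. *)
apply: (@near_eq_is_derive _ _ _ (fun s => q + G s)).
  apply/nbhs_distP; exists (T - `|t|); first by rewrite subr_gt0.
  move=> s st; rewrite -y'y y'E tauE //.
  have -> : s = (s - t) + t by rewrite subrK.
  by apply: le_lt_trans (ler_normD _ _) _; rewrite -ltrBrDr.
have := is_deriveD (is_derive_cst q t 1) (dG t tT2).
by rewrite add0r.
Qed.

End Curves.

(** * Local flows and their continuity *)

Section Flows.
Context {R : realType}.

Lemma norm_pair_lt (E F : normedModType R) (x : E) (y : F) (d : R) :
  (`|(x, y)| < d) = (`|x| < d) && (`|y| < d).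
Proof. by rewrite prod_normE gt_max. Qed.

Lemma is_derive_linear_comp (E F G : normedModType R) (f : E -> F) (l : {linear F -> G})
    p w D : continuous l -> is_derive p w f D -> is_derive p w (fun x => l (f x)) (l D).
Proof.
move=> lc /is_deriveP fD; have [k k0 kP] := linear_norm_le lc.
apply/is_deriveP => e e0; have [d d0 dP] := fD (e / k) (divr_gt0 e0 k0).
exists d => // h hd; rewrite -linearZ -!linearB.
apply: le_trans (kP _) _; apply: le_trans (ler_wpM2l (ltW k0) (dP h hd)) _.
by rewrite mulrA mulrCA divff ?mulr1 // gt_eqF.
Qed.

Lemma is_derive_shift_arg (E : normedModType R) (f : R -> E) (s t : R) D :
  is_derive (s + t) 1 f D -> is_derive t 1 (fun u => f (s + u)) D.
Proof.
move=> /is_deriveP fD; apply/is_deriveP => e /fD [d d0 dP]; exists d => // h.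
by rewrite addrA; exact: dP.
Qed.

Lemma open_preimage_class_C (E F : normedModType R) k (U : set E) (V : set F) (f : E -> F) :
  open U -> open V -> class_C k U f -> open (U `&` f @^-1` V).
Proof.
move=> oU oV Cf; rewrite openE => p [Up Vfp]; apply: filterI; first exact: open_nbhs_nbhs.
exact: (class_C_continuous Cf Up) (open_nbhs_nbhs (conj oV Vfp)).
Qed.

Definition flow_domain (E : normedModType R) (e : R) (N : set E) : set (R * E)%type :=
  [set s | `|s.1| < e /\ N s.2].

Definition is_flow (E : normedModType R) (U : set E) (f : E -> E) (e : R) (N : set E)
    (Phi : R -> E -> E) : Prop :=
  (forall q, N q -> Phi 0 q = q) /\
  forall (t : R) q, `|t| < e -> N q -> U (Phi t q) /\ is_derive t 1 (Phi ^~ q) (f (Phi t q)).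

Lemma open_flow_domain (E : normedModType R) (e : R) (N : set E) :
  open N -> open (flow_domain e N).
Proof.
move=> oN; rewrite openE => -[t q] [/= te Nq].
have [d d0 dP] := open_normP oN Nq.
apply/nbhs_distP; exists (Num.min (e - `|t|) d); first by rewrite lt_min subr_gt0 te.
move=> [t' q']; rewrite norm_pair_lt !lt_min /= => /andP[/andP[h _] /andP[_ h']].
split; last exact: dP.
have -> : t' = (t' - t) + t by rewrite subrK.
by apply: le_lt_trans (ler_normD _ _) _; rewrite -ltrBrDr.
Qed.

Lemma is_flow_unique (E : normedModType R) (U : set E) (f : E -> E) (y1 y2 : R -> E) (e : R) :
  finite_dim E -> open U -> class_C 1 U f -> y1 0 = y2 0 ->
  (forall t : R, `|t| < e -> U (y1 t) /\ is_derive t 1 y1 (f (y1 t))) ->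
  (forall t : R, `|t| < e -> U (y2 t) /\ is_derive t 1 y2 (f (y2 t))) ->
  forall t : R, `|t| < e -> y1 t = y2 t.
Proof.
move=> fE oU Cf y12 s1 s2 t te.
have e0 : 0 < e by exact: le_lt_trans te.
have nE s : (`|s| < e) = (- e < s < e) by rewrite ltr_norml.
apply: (@ode_unique _ _ U f y1 y2 (- e) e 0) => //; last by rewrite -nE.
- by rewrite -nE normr0.
- by move=> s; rewrite -nE; exact: s1.
- by move=> s; rewrite -nE; exact: s2.
Qed.

(** Joint continuity splits into a bound [2 * |q - q0|] uniform in time, from [gronwall_small], and
    the continuity in time of the single trajectory of [q0]. *)
Lemma local_flow_continuous (E : normedModType R) (f : E -> E) (U : set E) p :
  finite_dim E -> open U -> class_C 1 U f -> U p ->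
  exists (e : R) (N : set E) (Phi : R -> E -> E), [/\ 0 < e, open N, N p,
    is_flow U f e N Phi & class_C 0 (flow_domain e N) (fun s => Phi s.1 s.2)].
Proof.
move=> fE oU Cf Up.
have [L [r [L0 r0 rU _ fL]]] := locally_lipschitz fE oU Up Cf.
have [T T0 TP] := picard_lindelof fE r0 L0 fL.
have /choice[y yP] q : exists y : R -> E, `|q - p| < r / 2 ->
    y 0 = q /\ forall t : R, `|t| < T -> `|y t - p| < r /\ is_derive t 1 y (f (y t)).
  have [qr|nqr] := pselect (`|q - p| < r / 2); first by have [y] := TP q qr; exists y.
  by exists (fun=> q).
(* The time interval has length [2 * e], and [2 * e * L <= 1 / 2]. *)
pose e := Num.min T (1 / (4 * L)).
have e0 : 0 < e by rewrite lt_min T0 divr_gt0 // mulr_gt0.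
have eT (t : R) : `|t| < e -> `|t| < T by move=> /lt_le_trans; apply; rewrite ge_min lexx.
have eL : (e - - e) * L <= 1 / 2.
  have : e * (4 * L) <= 1 by rewrite -ler_pdivlMr ?mulr_gt0 // ge_min lexx orbT.
  lra.
pose N := [set q | `|q - p| < r / 2].
have oN : open N.
  rewrite openE => q Nq; apply/nbhs_distP; exists (r / 2 - `|q - p|); first by rewrite subr_gt0.
  move=> x xq; rewrite /N /= (_ : x - p = (x - q) + (q - p)); last by lmod R.
  by apply: le_lt_trans (ler_normD _ _) _; rewrite -ltrBrDr.
exists e, N, (fun t q => y q t); split=> //.
- by rewrite /N /= subrr normr0 divr_gt0.
- split=> [q Nq|t q te Nq]; first exact: (yP q Nq).1.
  by have [h1 h2] := (yP q Nq).2 t (eT t te); split=> //; exact: rU.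
move=> [t0 q0] [/= t0e Nq0]; apply/continuous_atP => eps eps0.
have lip q (t : R) : N q -> `|t| < e -> `|y q t - y q0 t| <= 2 * `|q - q0|.
  move=> Nq; rewrite ltr_norml => te.
  have := @gronwall_small _ E (fun s => y q s - y q0 s)
    (fun s => f (y q s) - f (y q0 s)) (- e) e 0 L 0.
  rewrite (yP q Nq).1 (yP q0 Nq0).1 mul0r addr0; apply=> //.
  - by rewrite oppr_lt0 e0.
  - exact: ltW.
  - move=> s; rewrite -ltr_norml => /eT sT.
    by apply: is_derive_sub; [exact: ((yP q Nq).2 s sT).2|exact: ((yP q0 Nq0).2 s sT).2].
  - move=> s; rewrite -ltr_norml addr0 => /eT sT.
    by apply: fL; [exact: ((yP q Nq).2 s sT).1|exact: ((yP q0 Nq0).2 s sT).1].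
have cont0 := is_derive_continuous ((yP q0 Nq0).2 t0 (eT t0 t0e)).2.
have eps2 : 0 < eps / 2 by rewrite divr_gt0.
have [d1 d10 d1P] := (continuous_atP _ _).1 cont0 _ eps2.
have [d2 d20 d2P] := open_normP (@open_flow_domain E e N oN) (conj t0e Nq0 : flow_domain e N (t0, q0)).
exists (Num.min (Num.min d1 d2) (eps / 4)).
  by rewrite !lt_min d10 d20 divr_gt0.
move=> [t q]; rewrite !lt_min norm_pair_lt => /andP[/andP[tqd1 tqd2] tqe].
have [/= te Nq] := d2P (t, q) tqd2.
move: tqd1 tqe; rewrite !norm_pair_lt /= => /andP[h1 _] /andP[_ h2].
have -> : y q t - y q0 t0 = (y q t - y q0 t) + (y q0 t - y q0 t0) by lmod R.
apply: le_trans (ler_normD _ _) _.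
have := lip q t Nq te; have := d1P t h1; lra.
Qed.

End Flows.

(** * Smooth dependence of flows on the initial point *)

Section SmoothFlows.
Context {R : realType}.

(* The field [(f x, 'd f x w)], written in coordinates so that it is visibly smooth
   when [f] is. *)
Definition prolongation (E : normedModType R) n (e : 'I_n -> E) (l : 'I_n -> {linear E -> R})
    (f : E -> E) (z : (E * E)%type) : (E * E)%type :=
  (f z.1, \sum_i l i z.2 *: 'D_(e i) f z.1).

Lemma open_prolongation (E : normedModType R) (U : set E) : open U ->
  open [set z : (E * E)%type | U z.1].
Proof.
move=> oU; rewrite openE => -[x y] /= Ux; have [d d0 dP] := open_normP oU Ux.
apply/nbhs_distP; exists d => // -[x' y']; rewrite norm_pair_lt /= => /andP[h _].
exact: dP.
Qed.

Lemma class_C_fst (E F : normedModType R) k (U : set (E * F)%type) : class_C k U fst.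
Proof. by apply: class_C_linear => p; exact: cvg_fst. Qed.

Lemma class_C_snd (E F : normedModType R) k (U : set (E * F)%type) : class_C k U snd.
Proof. by apply: class_C_linear => p; exact: cvg_snd. Qed.

Lemma class_C_id (E : normedModType R) k (U : set E) : class_C k U (fun x => x).
Proof. by apply: (class_C_linear k U (f := idfun)) => p; exact: cvg_id. Qed.

Lemma smooth_prolongation (E : normedModType R) n (e : 'I_n -> E) l (f : E -> E) (U : set E) :
  coordinate_system e l -> open U -> smooth_on U f ->
  smooth_on [set z : (E * E)%type | U z.1] (prolongation e l f).
Proof.
move=> el oU sf k; have oU' := open_prolongation oU.
have fE : finite_dim E by exists n, e, l.
apply: class_C_pair => //.
  apply: (class_C_comp (V := U) fE oU' _ (class_C_fst _ _) (sf k)) => //.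
apply: class_C_sum => // i; apply: class_C_scale => //.
  by apply: (class_C_linear_comp oU' (el.1 i)); exact: class_C_snd.
by apply: (class_C_comp (V := U) fE oU' _ (class_C_fst _ _) ((sf k.+1).2 (e i))).
Qed.

(* The error bound is quadratic in [w], so the second component of the prolonged
   flow is the derivative of the flow of [f] in the direction [w]. *)
Lemma class_C_first_variation (E : normedModType R) (f : E -> E) (U : set E) p k
    n (e : 'I_n -> E) l (eps : R) (N : set (E * E)%type) (Phi : R -> (E * E)%type -> (E * E)%type) :
  coordinate_system e l -> open U -> smooth_on U f -> U p ->
  0 < eps -> open N -> N (p, 0) ->
  is_flow [set z : (E * E)%type | U z.1] (prolongation e l f) eps N Phi ->
  class_C k (flow_domain eps N) (fun s => Phi s.1 s.2) ->
  exists (eps' rho C : R), [/\ 0 < eps', 0 < rho, eps' <= eps & forall q w,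
    `|q - p| < rho -> `|w| < rho -> N (q, w) /\ forall t : R, `|t| < eps' ->
    `|(Phi t (q + w, 0)).1 - (Phi t (q, 0)).1 - (Phi t (q, w)).2| <= C * `|w| ^+ 2 /\
    forall s : R, `|s| <= 1 -> (Phi t (q, s *: w)).2 = s *: (Phi t (q, w)).2].
Proof.
move=> el oU sf Up eps0 oN Np [Phi0 dPhi] Ck.
have fE : finite_dim E by exists n, e, l.
have [L [r1 [L0 r10 rU DL fL]]] := locally_lipschitz fE oU Up (sf 1%N).
have [K [r2 [K0 r20 fK]]] := quadratic_remainder fE oU Up (sf 2%N).
pose r := Num.min r1 r2.
have r0 : 0 < r by rewrite lt_min r10.
have rr1 x : `|x - p| < r -> `|x - p| < r1 by move=> /lt_le_trans; apply; rewrite ge_min lexx.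
have rr2 x : `|x - p| < r -> `|x - p| < r2 by move=> /lt_le_trans; apply; rewrite ge_min lexx orbT.
have dom0 : flow_domain eps N (0, (p, 0)) by split; rewrite //= normr0.
have [d1 d10 d1P] := open_normP (open_flow_domain oN) dom0.
have r_2 : 0 < r / 2 by rewrite divr_gt0.
have [d2 d20 d2P] := (continuous_atP _ _).1 (class_C_continuous Ck dom0) _ r_2.
pose d := Num.min d1 d2.
have d0 : 0 < d by rewrite lt_min d10.
have box (t : R) q w : `|t| < d -> `|q - p| < d -> `|w| < d ->
    [/\ `|t| < eps, N (q, w) & `|(Phi t (q, w)).1 - p| < r].
  move=> td qd wd; have h : `|(t, (q, w)) - (0, (p, 0))| < d.
    by rewrite !norm_pair_lt !subr0 td qd wd.
  move: (h); rewrite lt_min => /andP[/d1P[/= te Nqw] /d2P /= h2].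
  rewrite Phi0 // in h2; split=> //.
  have h3 : `|Phi t (q, w) - (p, 0)| < r by apply: le_lt_trans h2 _; lra.
  by move: h3; case: (Phi t (q, w)) => a b; rewrite norm_pair_lt => /andP[].
pose eps' := Num.min d (1 / (4 * L)).
have eps'0 : 0 < eps' by rewrite lt_min d0 divr_gt0 // mulr_gt0.
have eL : (eps' - - eps') * L <= 1 / 2.
  have : eps' * (4 * L) <= 1 by rewrite -ler_pdivlMr ?mulr_gt0 // ge_min lexx orbT.
  lra.
have ed (t : R) : `|t| < eps' -> `|t| < d by move=> /lt_le_trans; apply; rewrite ge_min lexx.
have d2d : d / 2 < d by lra.
have dd (w : E) : `|w| < d / 2 -> `|w| < d by move=> /lt_trans; apply.
have zd : `|0 : E| < d by rewrite normr0.
have ep0 : - eps' < 0 < eps' by rewrite oppr_lt0 eps'0.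
exists eps', (d / 2), (2 * (K * 4 * (eps' - - eps'))); split=> //.
- by rewrite divr_gt0.
- rewrite leNgt; apply/negP => h.
  have [] := box eps p 0; rewrite ?subrr ?normr0 // ?gtr0_norm ?ltxx //.
  by apply: lt_le_trans h _; rewrite ge_min lexx.
move=> q w qd wd.
have sw (s : R) : `|s| <= 1 -> `|s *: w| < d.
  by move=> s1; rewrite normrZ; apply: le_lt_trans (dd w wd); rewrite ler_piMl.
have qwd : `|q + w - p| < d.
  rewrite (_ : _ - p = (q - p) + w); last by lmod R.
  by apply: le_lt_trans (ler_normD _ _) _; lra.
have dY (t : R) q' w' : `|t| < d -> `|q' - p| < d -> `|w'| < d ->
    is_derive t 1 (fun s => (Phi s (q', w')).1) (f (Phi t (q', w')).1).
  move=> td q'd w'd; have [te Nq' _] := box t q' w' td q'd w'd.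
  have := (dPhi t (q', w') te Nq').2.
  by move=> /(is_derive_linear_comp (l := fst)); apply=> z; exact: cvg_fst.
have dPsi (t : R) q' w' : `|t| < d -> `|q' - p| < d -> `|w'| < d ->
    is_derive t 1 (fun s => (Phi s (q', w')).2) ('D_((Phi t (q', w')).2) f (Phi t (q', w')).1).
  move=> td q'd w'd; have [te Nq' _] := box t q' w' td q'd w'd.
  have [Ut dt] := dPhi t (q', w') te Nq'.
  rewrite (derive_basis _ el); last exact: (sf 1%N).1.
  by apply: (is_derive_linear_comp (l := snd) _ dt) => z; exact: cvg_snd.
(* The first component of the prolonged flow is a trajectory of [f] itself, so by uniqueness it
   ignores the tangent vector. *)
have YE (t : R) q' w' : `|t| < d -> `|q' - p| < d -> `|w'| < d ->
    (Phi t (q', w')).1 = (Phi t (q', 0)).1.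
  move=> td q'd w'd.
  apply: (@is_flow_unique _ E U f (fun s => (Phi s (q', w')).1) (fun s => (Phi s (q', 0)).1) d fE oU (sf 1%N)) => //.
  - have [_ N1 _] := box t q' w' td q'd w'd; have [_ N2 _] := box t q' 0 td q'd zd.
    by rewrite !Phi0.
  - move=> s sd; have [se Nq' _] := box s q' w' sd q'd w'd.
    by split; [exact: (dPhi s _ se Nq').1|exact: dY].
  - move=> s sd; have [se Nq' _] := box s q' 0 sd q'd zd.
    by split; [exact: (dPhi s _ se Nq').1|exact: dY].
have td0 : `|0 : R| < d by rewrite normr0.
have qd' := lt_trans qd d2d; have wd' := dd w wd.
have init q' w' : `|q' - p| < d -> `|w'| < d -> Phi 0 (q', w') = (q', w').
  by move=> q'd w'd; have [_ Nq' _] := box 0 q' w' td0 q'd w'd; rewrite Phi0.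
split; first by have [] := box 0 q w td0 qd' wd'.
have Ydist (t : R) : - eps' < t < eps' -> `|(Phi t (q + w, 0)).1 - (Phi t (q, 0)).1| <= 2 * `|w|.
  move=> te.
  have := @gronwall_small _ E (fun s => (Phi s (q + w, 0)).1 - (Phi s (q, 0)).1)
    (fun s => f (Phi s (q + w, 0)).1 - f (Phi s (q, 0)).1) (- eps') eps' 0 L 0.
  rewrite !init // mul0r addr0 /= (_ : q + w - q = w); last by lmod R.
  apply=> //; first exact: ltW.
  - by move=> s; rewrite -ltr_norml => /ed sd; apply: is_derive_sub; exact: dY.
  - move=> s; rewrite -ltr_norml => /ed sd; rewrite addr0.
    have [_ _ h1] := box s (q + w) 0 sd qwd zd; have [_ _ h2] := box s q 0 sd qd' zd.
    by apply: fL; exact: rr1.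
move=> t te'; have te : - eps' < t < eps' by rewrite -ltr_norml.
split.
  have := @gronwall_small _ E
    (fun s => (Phi s (q + w, 0)).1 - (Phi s (q, 0)).1 - (Phi s (q, w)).2)
    (fun s => f (Phi s (q + w, 0)).1 - f (Phi s (q, 0)).1 - 'D_((Phi s (q, w)).2) f (Phi s (q, w)).1)
    (- eps') eps' 0 L (K * 4 * `|w| ^+ 2) ep0 (ltW L0).
  rewrite !init //= (_ : q + w - q - w = 0); last by lmod R.
  rewrite normr0 add0r => G.
  apply: le_trans (G _ eL _ _ t te) _.
  - by rewrite mulr_ge0 ?exprn_ge0 // mulr_ge0 // ltW.
  - move=> s; rewrite -ltr_norml => /ed sd; apply: is_derive_sub; last exact: dPsi.
    by apply: is_derive_sub; exact: dY.
  - move=> s se; have sd : `|s| < d by apply: ed; rewrite ltr_norml.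
    rewrite (YE s q w) //.
    have [_ _ h1] := box s (q + w) 0 sd qwd zd; have [se1 Ns h2] := box s q 0 sd qd' zd.
    have Us : U (Phi s (q, 0)).1 by exact: (dPhi s _ se1 Ns).1.
    set Y1 := (Phi s (q + w, 0)).1 in h1 *; set Y0 := (Phi s (q, 0)).1 in h2 Us *.
    set psi := (Phi s (q, w)).2.
    have df : differentiable f Y0 by exact: (sf 1%N).1.
    (* A Taylor remainder, at most [K * (2 * |w|) ^+ 2], plus the derivative of [f] applied to the
       error being estimated: this is the form of inequality that [gronwall_small] takes. *)
    have -> : f Y1 - f Y0 - 'D_psi f Y0 = (f Y1 - f Y0 - 'D_(Y1 - Y0) f Y0) + 'D_(Y1 - Y0 - psi) f Y0.
      rewrite !deriveE // !linearB /=; lmod R.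
    apply: le_trans (ler_normD _ _) _; rewrite addrC; apply: lerD.
      by apply: DL; exact: rr1.
    apply: le_trans (fK _ _ (rr2 _ h2) (rr2 _ h1)) _.
    rewrite -mulrA ler_wpM2l ?(ltW K0) //.
    have := Ydist s se; rewrite -/Y1 -/Y0 => h3.
    have -> : 4 * `|w| ^+ 2 = (2 * `|w|) ^+ 2 by rewrite exprMn; congr (_ * _); ring.
    by rewrite ler_pXn2r // nnegrE // mulr_ge0.
  - by rewrite le_eqVlt; apply/orP; left; apply/eqP; ring.
(* The difference solves the linear variational equation with zero initial value. Homogeneity in [w]
   lets increments in the direction [h *: w] be compared with the value at the single vector [w]. *)
move=> s s1; apply/eqP; rewrite -subr_eq0 -normr_le0.
have := @gronwall_small _ E (fun u => (Phi u (q, s *: w)).2 - s *: (Phi u (q, w)).2)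
  (fun u => 'D_((Phi u (q, s *: w)).2) f (Phi u (q, s *: w)).1 - s *: 'D_((Phi u (q, w)).2) f (Phi u (q, w)).1)
  (- eps') eps' 0 L 0 ep0 (ltW L0) (lexx 0) eL.
rewrite !init ?sw //= subrr normr0 mul0r addr0 mulr0; apply=> //.
- move=> u; rewrite -ltr_norml => /ed ud; apply: is_derive_sub; first by apply: dPsi => //; exact: sw.
  apply: is_deriveZ; exact: dPsi.
- move=> u; rewrite -ltr_norml => /ed ud; rewrite addr0 (YE u q (s *: w)) ?sw // (YE u q w) //.
  have [ue Nu h2] := box u q 0 ud qd' zd.
  have Us : U (Phi u (q, 0)).1 by exact: (dPhi u _ ue Nu).1.
  have df : differentiable f (Phi u (q, 0)).1 by exact: (sf 1%N).1.
  rewrite !deriveE // -linearZ -linearB -deriveE //.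
  by apply: DL; exact: rr1.
Qed.

(** The induction is over all spaces at once, since the step applies the hypothesis to the
    prolongation on [E * E] at [(p, 0)]. Both [e] and [N] depend on [k]. *)
Lemma local_flow_class_C k (E : normedModType R) (f : E -> E) (U : set E) p :
  finite_dim E -> open U -> smooth_on U f -> U p ->
  exists (e : R) (N : set E) (Phi : R -> E -> E), [/\ 0 < e, open N, N p,
    is_flow U f e N Phi & class_C k (flow_domain e N) (fun s => Phi s.1 s.2)].
Proof.
elim: k E f U p => [|k IH] E f U p fE oU sf Up.
  exact: (local_flow_continuous fE oU (sf 1%N) Up).
have [n [b [l bl]]] := fE.
have oU' := open_prolongation oU.
have [eps [N [Phi [eps0 oN Np flPhi Ck]]]] :=
  IH (E * E)%type _ [set z : (E * E)%type | U z.1] (p, 0) (finite_dim_pair fE fE) oU' (smooth_prolongation bl oU sf) Up.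
have [e [rho [C [e0 rho0 ee var]]]] := class_C_first_variation bl oU sf Up eps0 oN Np flPhi Ck.
have [Phi0 dPhi] := flPhi.
pose M := [set q | `|q - p| < rho].
have oM : open M.
  rewrite openE => q Mq; apply/nbhs_distP; exists (rho - `|q - p|); first by rewrite subr_gt0.
  move=> x xq; rewrite /M /= (_ : x - p = (x - q) + (q - p)); last by lmod R.
  by apply: le_lt_trans (ler_normD _ _) _; rewrite -ltrBrDr.
have z_rho : `|0 : E| < rho by rewrite normr0.
pose Y (t : R) q := (Phi t (q, 0)).1.
have te' (t : R) : `|t| < e -> `|t| < eps by move=> /lt_le_trans; apply.
have NM q : M q -> N (q, 0) by move=> Mq; have [] := var q 0 Mq z_rho.
have dY (t : R) q : `|t| < e -> M q -> is_derive t 1 (Y ^~ q) (f (Y t q)).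
  move=> /te' te Mq; have := (dPhi t (q, 0) te (NM q Mq)).2.
  by move=> /(is_derive_linear_comp (l := fst)); apply=> z; exact: cvg_fst.
exists e, M, Y; split=> //.
- by rewrite /M /= subrr normr0.
- split=> [q Mq|t q te Mq]; first by rewrite /Y Phi0 //; exact: NM.
  by split; [exact: (dPhi t _ (te' t te) (NM q Mq)).1|exact: dY].
have oD := open_flow_domain (e := e) oM.
have CPhi w : `|w| < rho -> class_C k (flow_domain e M) (fun s => Phi s.1 (s.2, w)).
  move=> wr.
  apply: (@class_C_comp _ _ _ _ k (flow_domain e M) (flow_domain eps N)
    (fun s : (R * E)%type => (s.1, (s.2, w))) (fun s => Phi s.1 s.2)) => //.
  - by apply: finite_dim_pair; [exact: finite_dim_R|exact: finite_dim_pair].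
  - by move=> [t q] [/= te Mq]; split; [exact: te'|have [] := var q w Mq wr].
  - apply: class_C_pair => //; first exact: class_C_fst.
    by apply: class_C_pair => //; [exact: class_C_snd|exact: class_C_cst].
have CY : class_C k (flow_domain e M) (fun s => Y s.1 s.2).
  by apply: (class_C_linear_comp oD (l := fst) _ (CPhi 0 z_rho)) => z; exact: cvg_fst.
have [n' [b' [l' [bl' b'small]]]] := finite_dim_small fE rho0.
have dtime s : flow_domain e M s -> is_derive s (1, 0) (fun s => Y s.1 s.2) (f (Y s.1 s.2)).
  move=> [te Mq]; have := dY s.1 s.2 te Mq => /is_deriveP h.
  apply/is_deriveP => eta /h[d d0 dP]; exists d => // x /dP.
  by rewrite /= scaler0 addr0.
have dspace s i : flow_domain e M s ->
    is_derive s (0, b' i) (fun s => Y s.1 s.2) (Phi s.1 (s.2, b' i)).2.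
  case: s => t q [/= te Mq].
  apply/is_deriveP => eta eta0.
  pose B := C * `|b' i| ^+ 2.
  have B0 : 0 < `|B| + 1 by rewrite ltr_wpDl.
  (* The bound 1 allows homogeneity and keeps [h *: b' i] in the domain; the other bound makes
     [B * |h|] at most [eta]. *)
  exists (Num.min 1 (eta / (`|B| + 1))); first by rewrite lt_min ltr01 divr_gt0.
  move=> h; rewrite lt_min /= scaler0 addr0 => /andP[h1 h2].
  have hb : `|h *: b' i| < rho.
    by rewrite normrZ; apply: le_lt_trans (b'small i); rewrite ler_piMl // ltW.
  have [_ /(_ t te)[q1 _]] := var q (h *: b' i) Mq hb.
  have [_ /(_ t te)[_ q2]] := var q (b' i) Mq (b'small i).
  rewrite q2 ?(ltW h1) // in q1.
  apply: le_trans q1 _.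
  have -> : C * `|h *: b' i| ^+ 2 = B * `|h| * `|h| by rewrite normrZ /B; ring.
  rewrite ler_wpM2r //.
  apply: (@le_trans _ _ ((`|B| + 1) * `|h|)).
    by rewrite ler_wpM2r // (le_trans (ler_norm _)) // lerDl.
  by rewrite mulrC -ler_pdivlMr // ltW.
apply: (class_C_partials (coordinate_system_pair coordinate_system_R bl') oD) => i.
  move=> s Ds; rewrite /pair_basis; case: fintype.split => j.
    by have [] := dtime s Ds.
  by have [] := dspace s j Ds.
rewrite /pair_basis; case: fintype.split => j.
  have CfY : class_C k (flow_domain e M) (f \o (fun s => Y s.1 s.2)).
    apply: (class_C_comp fE oD _ CY (sf k)) => s [te Mq].
    by exact: (dPhi s.1 _ (te' _ te) (NM _ Mq)).1.
  by apply: (class_C_ext oD _ CfY) => s Ds; have [_ ->] := dtime s Ds.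
have CPsi := class_C_linear_comp oD (l := snd) _ (CPhi (b' j) (b'small j)).
apply: (class_C_ext oD _ (CPsi _)) => [s Ds|z]; last exact: cvg_snd.
by have [_ ->] := dspace s j Ds.
Qed.

(* The smoothness of [Phi t] near a point propagates in [t]: near [t] the flow is
   [Phi s] followed by a smooth local flow around [Phi t q0]. *)
Lemma smooth_flow (E : normedModType R) (f : E -> E) (U N : set E) (e : R) (Phi : R -> E -> E) :
  finite_dim E -> open U -> open N -> smooth_on U f -> is_flow U f e N Phi ->
  smooth_on (flow_domain e N) (fun s => Phi s.1 s.2).
Proof.
move=> fE oU oN sf [Phi0 dPhi] k; apply: class_C_local => -[t0 q0] [/= t0e Nq0].
have e0 : 0 < e by exact: le_lt_trans t0e.
have nE s : (- e < s < e) = (`|s| < e) by rewrite ltr_norml.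
(* The neighbourhood [M] of [q0] may shrink as [t] moves; only its existence is propagated along the
   time interval. *)
pose P t := exists M : set E, [/\ open M, M q0, M `<=` N & class_C k M (Phi t)].
have step t : `|t| < e -> exists2 d : R, 0 < d & forall s, `|s| < e -> `|s - t| < d -> P s ->
    exists M : set E, [/\ open M, M q0, M `<=` N &
      class_C k [set z : (R * E)%type | [/\ `|z.1| < e, `|z.1 - t| < d & M z.2]] (fun z => Phi z.1 z.2)].
  move=> te; have [Ut dt] := dPhi t q0 te Nq0.
  have [et [Nt [phi [et0 oNt Ntq [phi0 dphi] Cphi]]]] := local_flow_class_C k fE oU sf Ut.
  have ct := is_derive_continuous dt.
  have [r r0 rP] := open_normP oNt Ntq.
  have r20 : 0 < r / 2 by rewrite divr_gt0.
  have [d1 d10 d1P] := (continuous_atP _ _).1 ct _ r20.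
  exists (Num.min d1 (et / 2)); first by rewrite lt_min d10 divr_gt0.
  move=> s se std [M [oM Mq0 MN CM]].
  exists (M `&` Phi s @^-1` Nt); split.
  - exact: open_preimage_class_C CM.
  - split=> //; apply: rP; apply: le_lt_trans (d1P s _) _; last by lra.
    by apply: lt_le_trans std _; rewrite ge_min lexx.
  - by move=> q [/MN].
  have st : `|s - t| < et / 2 by apply: lt_le_trans std _; rewrite ge_min lexx orbT.
  set D := [set z : (R * E)%type | _].
  have oM' := open_preimage_class_C oM oNt CM.
  have oD : open D.
    rewrite openE => -[u q] [/= ue ut Mq].
    have [rho rho0 rhoP] := open_normP oM' Mq.
    set d := Num.min d1 (et / 2) in ut *.
    apply/nbhs_distP; exists (Num.min rho (Num.min (e - `|u|) (d - `|u - t|))).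
      by rewrite !lt_min rho0 !subr_gt0 ue.
    move=> [u' q']; rewrite norm_pair_lt !lt_min /= => /andP[/and3P[_ h1 h2] /and3P[h3 _ _]].
    split => /=; last exact: rhoP.
      have -> : u' = (u' - u) + u by rewrite subrK.
      by apply: le_lt_trans (ler_normD _ _) _; rewrite -ltrBrDr.
    have -> : u' - t = (u' - u) + (u - t) by ring.
    by apply: le_lt_trans (ler_normD _ _) _; rewrite -ltrBrDr.
  have us u : `|u - t| < Num.min d1 (et / 2) -> `|u - s| < et.
    rewrite lt_min => /andP[_ ut].
    have -> : u - s = (u - t) - (s - t) by ring.
    by apply: le_lt_trans (ler_normB _ _) _; lra.
  have Cc : class_C k D (fun z => phi (z.1 - s) (Phi s z.2)).
    apply: (@class_C_comp _ _ _ _ k D (flow_domain et Nt)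
      (fun z : (R * E)%type => (z.1 - s, Phi s z.2)) (fun z => phi z.1 z.2)) => //.
    - by apply: finite_dim_pair => //; exact: finite_dim_R.
    - by move=> [u q] [/= ue /us ut [Mq Nq]].
    - apply: class_C_pair => //.
        by apply: class_C_add => //; [exact: class_C_fst|exact: class_C_cst].
      apply: (@class_C_comp _ _ _ _ k D M snd (Phi s)) => //; last exact: class_C_snd.
      by move=> [u q] [/= _ _ []].
  apply: (class_C_ext oD _ Cc) => -[u q] [/= ue /us ut [Mq Nq]].
  (* The common time interval of the two trajectories through [Phi s q]: the local flow [phi],
     defined up to [et], and the shifted curve [Phi (s + x) q], defined for [|s + x| < e]. *)
  pose a := Num.max (- et) (- e - s); pose b := Num.min et (e - s).
  have abP x : (a < x < b) = (`|x| < et) && (`|s + x| < e).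
    rewrite /a /b gt_max lt_min !ltr_norml.
    have -> : (- e - s < x) = (- e < s + x) by apply/idP/idP; lra.
    have -> : (x < e - s) = (s + x < e) by apply/idP/idP; lra.
    by rewrite -!andbA; congr (_ && _); rewrite andbCA.
  rewrite (_ : u = s + (u - s)) in ue *; last by ring.
  rewrite [s + (u - s)]addrC addrK in ue *.
  have -> : phi (u - s) (Phi s q) = Phi (s + (u - s)) q.
    apply: (@ode_unique _ E U f (phi ^~ (Phi s q)) (fun x => Phi (s + x) q) a b 0 fE oU (sf 1%N)).
    - by rewrite abP normr0 et0 addr0.
    - by rewrite addr0 phi0.
    - by move=> x; rewrite abP => /andP[xe _]; exact: dphi.
    - move=> x; rewrite abP => /andP[_ xe]; have [Ux dx] := dPhi _ q xe (MN _ Mq).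
      by split=> //; exact: is_derive_shift_arg.
    - by rewrite abP ut [s + _]addrC.
  by congr Phi; ring.
have slice (t d : R) (M : set E) s : open M -> `|s| < e -> `|s - t| < d ->
    class_C k [set z : (R * E)%type | [/\ `|z.1| < e, `|z.1 - t| < d & M z.2]] (fun z => Phi z.1 z.2) ->
    class_C k M (Phi s).
  move=> oM se st CD.
  apply: (@class_C_comp _ _ _ _ k M _ (fun q => (s, q)) (fun z => Phi z.1 z.2) _ oM _ _ CD) => //.
  - by apply: finite_dim_pair => //; exact: finite_dim_R.
  - by apply: class_C_pair => //; [exact: class_C_cst|exact: class_C_id].
have allP t : - e < t < e -> P t.
  apply: (@interval_propagation _ P (- e) e 0).
  - by rewrite nE normr0.
  - exists N; split=> //; apply: (class_C_ext oN _ (class_C_id k N)) => q Nq.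
    by rewrite Phi0.
  - move=> u; rewrite nE => /step[d d0 dP]; exists d => // s s'; rewrite !nE => se s'e su s'u Ps.
    have [M [oM Mq0 MN CM]] := dP s se su Ps.
    by exists M; split=> //; exact: slice CM.
have [d d0 dP] := step t0 t0e.
have Pt0 : P t0 by apply: allP; rewrite nE.
have [|M [oM Mq0 MN CM]] := dP t0 t0e _ Pt0; first by rewrite subrr normr0.
by eexists; last exact: CM; split=> //=; rewrite subrr normr0.
Qed.

End SmoothFlows.

(** * Smooth maps in adapted coordinates *)

Section SmoothCalculus.
Context {R : realType}.

(** Openness keeps the line through [p] in [N] for small [h], so [f] and [g] have the same
    increments. One direction reads a derivative off a formula on a line, the other transports a
    known derivative to that line. *)
Lemma is_derive_slice (V F : normedModType R) (f : V -> F) (g : R -> F) (N : set V) (p w : V) D :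
  open N -> N p -> (forall h, N (p + h *: w) -> f (p + h *: w) = g h) ->
  is_derive p w f D <-> is_derive (0 : R) 1 g D.
Proof.
move=> oN Np fg; have [r r0 rN] := open_normP oN Np.
have w0 : 0 < `|w| + 1 by rewrite ltr_wpDl.
have Nh (h : R) : `|h| < r / (`|w| + 1) -> N (p + h *: w).
  rewrite ltr_pdivlMr // => hr; apply: rN; rewrite addrC addKr normrZ.
  by apply: le_lt_trans hr; rewrite ler_wpM2l // lerDl.
have g0 : f p = g 0 by rewrite -fg scale0r addr0.
split=> /is_deriveP fD; apply/is_deriveP => e /fD[d d0 dP];
  exists (Num.min d (r / (`|w| + 1))); rewrite ?lt_min ?d0 ?divr_gt0 //;
  move=> h; rewrite lt_min => /andP[hd hr]; have := dP h hd.
  by rewrite add0r [h *: 1]mulr1 fg ?g0 //; exact: Nh.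
by rewrite add0r [h *: 1]mulr1 fg ?g0 //; exact: Nh.
Qed.

Lemma constant_along (V F : normedModType R) (f : V -> F) (p w : V) :
  (forall s : R, 0 <= s <= 1 -> is_derive (p + s *: w) w f 0) -> f (p + w) = f p.
Proof.
move=> fD; apply/eqP; rewrite -subr_eq0 -normr_le0.
by apply: (@mean_value_segment _ _ _ f (fun=> 0)) => // s _; rewrite normr0.
Qed.

Lemma constant_between (V F : normedModType R) (f : V -> F) (x y : V) :
  (forall s : R, 0 <= s <= 1 -> is_derive (x + s *: (y - x)) (y - x) f 0) -> f y = f x.
Proof. by move=> /constant_along; rewrite addrC subrK. Qed.

Lemma smooth_differentiable (V F : normedModType R) (f : V -> F) (N : set V) (p : V) :
  smooth_on N f -> N p -> differentiable f p.
Proof. by move=> /(_ 1%N)[df _]; exact: df. Qed.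

Lemma smooth_derive (V F : normedModType R) (f : V -> F) (N : set V) w :
  smooth_on N f -> smooth_on N ('D_w f).
Proof. by move=> sf k; exact: (sf k.+1).2. Qed.

Lemma smooth_sub (V F : normedModType R) (f : V -> F) (N M : set V) :
  M `<=` N -> smooth_on N f -> smooth_on M f.
Proof. by move=> MN sf k; exact: class_C_sub (sf k). Qed.

Lemma smooth_comp (V F G : normedModType R) (f : V -> F) (g : F -> G) (N : set V) (M : set F) :
  finite_dim F -> open N -> (forall p, N p -> M (f p)) ->
  smooth_on N f -> smooth_on M g -> smooth_on N (fun p => g (f p)).
Proof. by move=> fF oN NM sf sg k; exact: (class_C_comp fF oN NM (sf k) (sg k)). Qed.

Lemma smooth_linear_comp (V F G : normedModType R) (f : V -> F) (l : {linear F -> G}) (N : set V) :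
  open N -> continuous l -> smooth_on N f -> smooth_on N (fun p => l (f p)).
Proof. by move=> oN lc sf k; exact: class_C_linear_comp (sf k). Qed.

Lemma derive_comp (V F G : normedModType R) (f : V -> F) (g : F -> G) (p w : V) :
  differentiable f p -> differentiable g (f p) ->
  'D_w (g \o f) p = 'D_('D_w f p) g (f p).
Proof.
move=> df dg; have dc := differentiable_comp df dg.
by rewrite (deriveE _ dc) (deriveE _ dg) (deriveE _ df) (diff_comp df dg).
Qed.

Lemma is_derive_component (V F : normedModType R) (f : V -> F) (l : {linear F -> R}) (p w : V) :
  continuous l -> differentiable f p -> is_derive p w (fun q => l (f q)) (l ('d f p w)).
Proof. by move=> lc df; apply: is_derive_linear_comp => //; exact: is_derive_diff. Qed.

Lemma derive_local_id (V : normedModType R) (f : V -> V) (U : set V) (p w : V) :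
  open U -> U p -> (forall q, U q -> f q = q) -> 'D_w f p = w.
Proof. by move=> oU Up fE; rewrite (derive_ext _ oU Up fE) derive_id. Qed.

Lemma differential_injective (V F : normedModType R) (f : V -> F) (g : F -> V)
    (U : set V) (p X : V) : open U -> U p -> differentiable f p -> differentiable g (f p) ->
  (forall q, U q -> g (f q) = q) -> 'd f p X = 0 -> X = 0.
Proof.
move=> oU Up df dg gK X0; rewrite -(derive_local_id (f := g \o f) X oU Up gK).
by rewrite derive_comp // (deriveE _ df) X0 derive0.
Qed.

Lemma smooth_mx (V : normedModType R) a b (f : V -> 'M[R]_(a, b)) (N : set V) :
  open N -> (forall i j, smooth_on N (fun p => f p i j)) -> smooth_on N f.
Proof.
move=> oN sf k; apply: (class_C_coord oN (coordinate_system_mx a b)) => i.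
exact: sf.
Qed.

Lemma smooth_ext (V F : normedModType R) (f g : V -> F) (N : set V) : open N ->
  (forall p, N p -> f p = g p) -> smooth_on N f -> smooth_on N g.
Proof. by move=> oN fg sf k; exact: class_C_ext (sf k). Qed.

Lemma smooth_cst (V F : normedModType R) (c : F) (N : set V) : smooth_on N (fun=> c).
Proof. by move=> k; exact: class_C_cst. Qed.

Lemma smooth_id (V : normedModType R) (N : set V) : smooth_on N (fun x => x).
Proof. by move=> k; exact: class_C_id. Qed.

Lemma smooth_add (V F : normedModType R) (f g : V -> F) (N : set V) : open N ->
  smooth_on N f -> smooth_on N g -> smooth_on N (fun x => f x + g x).
Proof. by move=> oN sf sg k; exact: class_C_add. Qed.

Lemma smooth_scale (V F : normedModType R) (f : V -> R) (g : V -> F) (N : set V) : open N ->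
  smooth_on N f -> smooth_on N g -> smooth_on N (fun x => f x *: g x).
Proof. by move=> oN sf sg k; exact: class_C_scale. Qed.

Lemma smooth_mul (V : normedModType R) (f g : V -> R) (N : set V) : open N ->
  smooth_on N f -> smooth_on N g -> smooth_on N (fun x => f x * g x).
Proof. by move=> oN sf sg k; exact: class_C_mul. Qed.

Lemma smooth_inv (V : normedModType R) (f : V -> R) (N : set V) : open N ->
  (forall p, N p -> f p != 0) -> smooth_on N f -> smooth_on N (fun x => (f x)^-1).
Proof. by move=> oN f0 sf k; exact: class_C_inv. Qed.

Lemma smooth_sum (V F : normedModType R) n (f : 'I_n -> V -> F) (N : set V) : open N ->
  (forall i, smooth_on N (f i)) -> smooth_on N (fun x => \sum_i f i x).
Proof. by move=> oN sf k; apply: class_C_sum => // i; exact: sf. Qed.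

Lemma smooth_pair (V F G : normedModType R) (f : V -> F) (g : V -> G) (N : set V) :
  open N -> smooth_on N f -> smooth_on N g -> smooth_on N (fun x => (f x, g x)).
Proof. by move=> oN sf sg k; exact: class_C_pair. Qed.

Lemma smooth_local (V F : normedModType R) (f : V -> F) (U : set V) :
  (forall p, U p -> exists2 N : set V, N p & smooth_on N f) -> smooth_on U f.
Proof.
by move=> Uf k; apply: class_C_local => p /Uf[N Np sf]; exists N => //; exact: sf.
Qed.

Lemma open_preimage_smooth (V F : normedModType R) (U : set V) (W : set F) (f : V -> F) :
  open U -> open W -> smooth_on U f -> open (U `&` f @^-1` W).
Proof. by move=> oU oW /(_ 0%N) Cf; exact: open_preimage_class_C Cf. Qed.

End SmoothCalculus.

(** * The coordinate space and its frame *)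

Section Coordinates.
Context {R : realType} {m : nat}.
Local Notation E := (coordinates R m : normedModType R).
Implicit Types (p q X Y w x y : E) (phi : E -> E) (U N : set E).

Lemma finite_dim_ux : finite_dim (R * 'rV[R]_m)%type.
Proof. by apply: finite_dim_pair; [exact: finite_dim_R|exact: finite_dim_mx]. Qed.

Lemma finite_dim_coordinates : finite_dim E.
Proof. by apply: finite_dim_pair; [exact: finite_dim_ux|exact: finite_dim_R]. Qed.

Definition du_lin : {linear E -> R} := fst \o fst.
Definition dv_lin : {linear E -> R} := snd.
Definition x_lin : {linear E -> 'rV[R]_m} := snd \o fst.
Definition ux_lin : {linear E -> (R * 'rV[R]_m)%type} := fst.
Definition dx_lin (i : 'I_m) : {linear E -> R} := mx_entry (0 : 'I_1) i \o x_lin.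

Lemma ux_lin_continuous : continuous ux_lin.
Proof. by move=> p; exact: cvg_fst. Qed.

Lemma du_lin_continuous : continuous du_lin.
Proof. by move=> p; apply: continuous_comp; exact: cvg_fst. Qed.

Lemma dv_lin_continuous : continuous dv_lin.
Proof. by move=> p; exact: cvg_snd. Qed.

Lemma x_lin_continuous : continuous x_lin.
Proof. by move=> p; apply: continuous_comp; [exact: cvg_fst|exact: cvg_snd]. Qed.

Lemma dx_lin_continuous i : continuous (dx_lin i).
Proof.
move=> p; apply: continuous_comp; first exact: x_lin_continuous.
exact: coord_continuous.
Qed.

Lemma coordinates_eq X Y : du X = du Y -> (forall i, dx i X = dx i Y) -> dv X = dv Y -> X = Y.
Proof.
case: X Y => [[a x] b] [[a' x'] b']; rewrite /du /dv /dx /= => -> xx' ->.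
by congr (_, _, _); apply/rowP => i; exact: xx'.
Qed.

Lemma duD X Y : du (X + Y) = du X + du Y. Proof. by []. Qed.
Lemma duZ (a : R) X : du (a *: X) = a * du X. Proof. by []. Qed.
Lemma du_sum n (f : 'I_n -> E) : du (\sum_i f i) = \sum_i du (f i).
Proof. exact: (linear_sum du_lin). Qed.
Lemma dvD X Y : dv (X + Y) = dv X + dv Y. Proof. by []. Qed.
Lemma dvZ (a : R) X : dv (a *: X) = a * dv X. Proof. by []. Qed.
Lemma dv_sum n (f : 'I_n -> E) : dv (\sum_i f i) = \sum_i dv (f i).
Proof. exact: (linear_sum dv_lin). Qed.
Lemma dxD i X Y : dx i (X + Y) = dx i X + dx i Y. Proof. exact: mxE. Qed.
Lemma dxZ i (a : R) X : dx i (a *: X) = a * dx i X. Proof. exact: mxE. Qed.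
Lemma dx_sum i n (f : 'I_n -> E) : dx i (\sum_j f j) = \sum_j dx i (f j).
Proof. exact: (linear_sum (dx_lin i)). Qed.
Lemma duDZ X (a : R) Y : du (X + a *: Y) = du X + a * du Y. Proof. by []. Qed.
Lemma dvDZ X (a : R) Y : dv (X + a *: Y) = dv X + a * dv Y. Proof. by []. Qed.
Lemma dxDZ i X (a : R) Y : dx i (X + a *: Y) = dx i X + a * dx i Y.
Proof. by rewrite dxD dxZ. Qed.
Lemma du_d_x (i : 'I_m) : du (d_x R i) = 0. Proof. by []. Qed.
Lemma dv_d_x (i : 'I_m) : dv (d_x R i) = 0. Proof. by []. Qed.
Lemma dx_d_u (i : 'I_m) : dx i (d_u R m) = 0. Proof. exact: mxE. Qed.
Lemma dx_d_v (i : 'I_m) : dx i (d_v R m) = 0. Proof. exact: mxE. Qed.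
Lemma du_d_u : du (d_u R m) = 1. Proof. by []. Qed.
Lemma du_d_v : du (d_v R m) = 0. Proof. by []. Qed.
Lemma dv_d_u : dv (d_u R m) = 0. Proof. by []. Qed.
Lemma dv_d_v : dv (d_v R m) = 1. Proof. by []. Qed.
Lemma dx0 (i : 'I_m) : dx i (0 : E) = 0. Proof. exact: mxE. Qed.

Lemma dx_d_x (i j : 'I_m) : dx i (d_x R j) = (i == j)%:R.
Proof. by rewrite /dx /= mxE eqxx. Qed.

Lemma coordinates_sum X : X = du X *: d_u R m + \sum_i dx i X *: d_x R i + dv X *: d_v R m.
Proof.
apply: coordinates_eq => [|i|].
- rewrite !duD !duZ du_d_u du_d_v du_sum big1 => [|j _]; last by rewrite duZ du_d_x mulr0.
  by rewrite mulr1 mulr0 !addr0.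
- rewrite !dxD !dxZ dx_d_u dx_d_v dx_sum !mulr0 add0r addr0.
  rewrite (bigD1 i) //= dxZ dx_d_x eqxx mulr1 big1 ?addr0 // => j ji.
  by rewrite dxZ dx_d_x eq_sym (negPf ji) mulr0.
- rewrite !dvD !dvZ dv_d_u dv_d_v dv_sum big1 => [|j _]; last by rewrite dvZ dv_d_x mulr0.
  by rewrite mulr1 mulr0 !add0r.
Qed.

Lemma is_derive_du phi p w : differentiable phi p ->
  is_derive p w (fun q => du (phi q)) (du ('d phi p w)).
Proof. exact: (@is_derive_component R E E phi du_lin p w du_lin_continuous). Qed.

Lemma is_derive_dv phi p w : differentiable phi p ->
  is_derive p w (fun q => dv (phi q)) (dv ('d phi p w)).
Proof. exact: (@is_derive_component R E E phi dv_lin p w dv_lin_continuous). Qed.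

Lemma is_derive_dx phi p w i : differentiable phi p ->
  is_derive p w (fun q => dx i (phi q)) (dx i ('d phi p w)).
Proof. exact: (@is_derive_component R E E phi (dx_lin i) p w (@dx_lin_continuous i)). Qed.

(** The norm of a product is a maximum, so this ball is a product: its coordinates can be replaced
    one at a time by those of [p]. It is also convex. *)
Definition box p (r : R) : set E := [set q | `|q - p| < r].

Lemma open_box p r : open (box p r).
Proof.
rewrite openE => q bq; apply/nbhs_distP; exists (r - `|q - p|); first by rewrite subr_gt0.
move=> x xq; rewrite /box /= (_ : x - p = (x - q) + (q - p)); last by lmod R.
by apply: le_lt_trans (ler_normD _ _) _; rewrite -ltrBrDr.
Qed.

Lemma boxE p (r : R) q : box p r q <->
  [/\ `|ucoord q - ucoord p| < r, `|q.1.2 - p.1.2| < r & `|vcoord q - vcoord p| < r].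
Proof.
case: p q => [[a x] b] [[a' x'] b']; rewrite /box /= !norm_pair_lt /=.
by split=> [/andP[/andP[]]|[-> -> ->]].
Qed.

Lemma box_center p (r : R) : 0 < r -> box p r p.
Proof. by rewrite /box /= subrr normr0. Qed.

Lemma box_segment p (r s : R) q w : 0 <= s <= 1 -> box p r q -> box p r (q + w) ->
  box p r (q + s *: w).
Proof. exact: norm_segment_lt. Qed.

Lemma box_between p (r s : R) x y : 0 <= s <= 1 -> box p r x -> box p r y ->
  box p r (x + s *: (y - x)).
Proof.
by move=> s01 bx bY; apply: norm_segment_lt => //; rewrite [x + _]addrC subrK.
Qed.

Lemma open_box_sub U p : open U -> U p -> exists2 r : R, 0 < r & box p r `<=` U.
Proof. by move=> oU Up; have [r r0 rU] := open_normP oU Up; exists r. Qed.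

End Coordinates.

(** * Linear maps adapted to the flag of a Kundt metric *)

Section AdaptedMaps.
Context {R : realType} {m : nat}.
Local Notation E := (coordinates R m : normedModType R).
Local Notation d_u := (d_u R m : E).
Local Notation d_v := (d_v R m : E).
Local Notation d_x i := (d_x R i : E).
Implicit Types (p q X Y w x y : E) (phi : E -> E) (U N : set E).

(** [L] preserves the flag formed by the line spanned by [d_v] and the hyperplane where [du]
    vanishes, which is its orthogonal for every Kundt metric. *)
Definition triangular (L : E -> E) : Prop :=
  [/\ du (L d_v) = 0, forall i, dx i (L d_v) = 0 & forall j : 'I_m, du (L (d_x j)) = 0].

(** The product is the factor by which the coefficient of [du dv] is multiplied under pullback; that
    coefficient is normalized to 1. *)
Definition adapted (L : E -> E) : Prop := triangular L /\ du (L d_u) * dv (L d_v) = 1.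

Lemma linear_coordinates (L : {linear E -> E}) X :
  L X = du X *: L d_u + \sum_i dx i X *: L (d_x i) + dv X *: L d_v.
Proof.
rewrite {1}(coordinates_sum X) !linearD !linearZ linear_sum.
by congr (_ + _ + _); apply: eq_bigr => i _; rewrite linearZ.
Qed.

Lemma triangular_du (L : {linear E -> E}) X : triangular L -> du (L X) = du X * du (L d_u).
Proof.
have gen (a b : E) (f : 'I_m -> E) : du b = 0 -> (forall i, du (f i) = 0) ->
    du (du X *: a + \sum_i dx i X *: f i + dv X *: b) = du X * du a.
  move=> b0 f0; rewrite !duD !duZ b0 du_sum big1 => [|i _]; first by rewrite mulr0 !addr0.
  by rewrite duZ f0 mulr0.
by move=> [v0 _ x0]; rewrite linear_coordinates; exact: gen.
Qed.

Lemma triangular_dx (L : {linear E -> E}) X i : triangular L -> du X = 0 ->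
  dx i (L X) = \sum_j dx j X * dx i (L (d_x j)).
Proof.
have gen (a b : E) (f : 'I_m -> E) : dx i b = 0 ->
    dx i (0 *: a + \sum_j dx j X *: f j + dv X *: b) = \sum_j dx j X * dx i (f j).
  move=> b0; rewrite !dxD !dxZ b0 mul0r mulr0 addr0 add0r dx_sum.
  by apply: eq_bigr => j _; rewrite dxZ.
by move=> [_ v0 _] X0; rewrite linear_coordinates X0; exact: gen.
Qed.

Lemma flat_metricE (c : R) p X Y :
  kundt_metric (fun=> c) (fun=> 0) (fun=> 1%:M) p X Y =
  (du X * (dv Y + c * du Y) + (dv X + c * du X) * du Y) / 2 + \sum_i dx i X * dx i Y.
Proof.
have W0 (Z : E) : \sum_(i < m) (0 : 'rV[R]_m) 0 i * dx i Z = 0.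
  by rewrite big1 // => i _; rewrite mxE mul0r.
rewrite /kundt_metric /sprod !W0 !addr0.
congr (_ + _); apply: eq_bigr => i _.
rewrite (bigD1 i) //= big1 ?addr0 => [|j ji]; last by rewrite mxE eq_sym (negPf ji) mul0r.
by rewrite mxE eqxx mul1r; field.
Qed.

Lemma positive_definite1 : positive_definite (1%:M : 'M[R]_m).
Proof.
split=> [|y /rV0Pn[i yi]]; first exact: trmx1.
rewrite mulmx1 mxE (bigD1 i) //= mxE -expr2 ltr_pwDl //.
  by rewrite lt_neqAle eq_sym sqrf_eq0 yi sqr_ge0.
by apply: sumr_ge0 => j _; rewrite mxE -expr2 sqr_ge0.
Qed.

(** The value involves none of [H], [W], [h], so it is what any pullback of Kundt shape has to
    reproduce. *)
Lemma kundt_metric_d_v (H : E -> R) (W : E -> 'rV[R]_m) (h : R * 'rV[R]_m -> 'M[R]_m) p X :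
  kundt_metric H W h p d_v X = du X / 2.
Proof.
rewrite /kundt_metric /sprod [X in _ + X]big1 => [|i _]; last first.
  by rewrite big1 // => j _; rewrite !dx_d_v !(mul0r, mulr0, addr0).
rewrite [X in (_ * _ + (_ + X) * _) / 2]big1 => [|i _]; last by rewrite dx_d_v mulr0.
rewrite du_d_v dv_d_v; ring.
Qed.

(* The metrics with [c = 0] and [c = 1] differ by [du ^ 2], which gives
   [du (L d_v) = 0]; then [c = 0] alone gives the rest. *)
Lemma adapted_of_flat_metrics (L : E -> E) p :
  (forall c : R, exists (H : E -> R) (W : E -> 'rV[R]_m) (h : R * 'rV[R]_m -> 'M[R]_m),
    forall X Y, kundt_metric (fun=> c) (fun=> 0) (fun=> 1%:M) (L p) (L X) (L Y)
      = kundt_metric H W h p X Y) -> adapted L.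
Proof.
move=> test.
have [H0 [W0 [h0 g0]]] := test 0; have [H1 [W1 [h1 g1]]] := test 1.
have vv0 := g0 d_v d_v; have vv1 := g1 d_v d_v.
rewrite flat_metricE kundt_metric_d_v du_d_v mul0r in vv0.
rewrite flat_metricE kundt_metric_d_v du_d_v mul0r in vv1.
set S := \sum_i _ in vv0 vv1.
have u0 : du (L d_v) = 0.
  have : du (L d_v) ^+ 2 = 0.
    by rewrite expr2; move: vv0 vv1; rewrite !mul0r !addr0 !mul1r; lra.
  by move/eqP; rewrite sqrf_eq0 => /eqP.
have x0 i : dx i (L d_v) = 0.
  have S0 : S = 0 by move: vv0; rewrite u0 !mulr0 !mul0r !addr0 mul0r add0r.
  have F0 j : true -> 0 <= dx j (L d_v) * dx j (L d_v) by move=> _; rewrite -expr2 sqr_ge0.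
  have : dx i (L d_v) * dx i (L d_v) = 0 by exact: (psumr_eq0P F0 S0).
  by move/eqP; rewrite mulf_eq0 orbb => /eqP.
(* Once [L d_v] is a multiple of [d_v], this identity contains both remaining conditions: [X = d_u]
   gives the normalization and [X = d_x j] the vanishing of [du (L (d_x j))]. *)
have vX X : du (L X) * dv (L d_v) = du X.
  have := g0 d_v X; rewrite kundt_metric_d_v flat_metricE u0.
  rewrite [X in _ + X]big1 => [|i _]; last by rewrite x0 mul0r.
  by move=> h; lra.
split; last by rewrite vX du_d_u.
split; [exact: u0|exact: x0|].
move=> j; have v1 := vX d_u; rewrite du_d_u in v1.
have := vX (d_x j); rewrite du_d_x => /eqP; rewrite mulf_eq0.
case/orP => /eqP // v00; move: v1; rewrite v00 mulr0 => /eqP.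
by rewrite eq_sym oner_eq0.
Qed.

Lemma pseudogroup_adapted U phi p : kundt_pseudogroup U phi -> U p -> adapted ('d phi p).
Proof.
move=> [[oU oV sphi _] pres] Up.
apply: (@adapted_of_flat_metrics _ p) => c.
have [] := pres (kundt_metric (fun=> c) (fun=> 0) (fun=> 1%:M)) _ p Up.
  move=> q Vq; exists (phi @` U), (fun=> c), (fun=> 0), (fun=> 1%:M); split=> //.
  - by split=> //; exists q.
  - by split; exact: smooth_cst.
  - by move=> ? _; exact: positive_definite1.
move=> N [H [W [h [[_ Np _] _ _ gE]]]]; exists H, W, h => X Y.
by rewrite -gE.
Qed.

Lemma diffeomorphism_injective U phi p X :
  local_diffeomorphism U phi -> U p -> 'd phi p X = 0 -> X = 0.
Proof.
move=> [oU oV sphi [psi spsi psiK]] Up.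
apply: (@differential_injective _ _ _ phi psi U p X oU Up _ _ psiK).
  exact: smooth_differentiable sphi Up.
by apply: (smooth_differentiable spsi); exists p.
Qed.

(** The image of [(0, y, 0)] is a multiple of [d_v], and [L d_v] is a nonzero multiple of [d_v];
    subtracting a multiple of [d_v] from the vector gives an element of the kernel of [L]. *)
Lemma adapted_x_injective (L : {linear E -> E}) (y : 'rV[R]_m) :
  (forall X, L X = 0 -> X = 0) -> adapted L ->
  (forall i, dx i (L ((0, y, 0) : E)) = 0) -> y = 0.
Proof.
move=> Linj ad y0; have [[v0 vx0 x0] JK] := ad.
have K0 : dv (L d_v) != 0.
  by apply/eqP => K0; move/eqP: JK; rewrite K0 mulr0 eq_sym oner_eq0.
pose s := - dv (L ((0, y, 0) : E)) / dv (L d_v).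
pose X : E := (0, y, 0) + s *: d_v.
have X0 : X = 0.
  apply: Linj; rewrite linearD linearZ; apply: coordinates_eq => [|i|].
  - by rewrite duDZ v0 (triangular_du _ ad.1) mulr0 addr0 mul0r.
  - by rewrite dxDZ vx0 y0 mulr0 addr0 dx0.
  - by rewrite dvDZ /s divfK // subrr.
have := congr1 (fun Z : E => Z.1.2) X0.
by rewrite /X /= scaler0 addr0.
Qed.

(** A box is convex, so the segment between the points stays in [U]; its direction is killed by
    [du], hence so is its image under the differential. *)
Lemma triangular_const_u U phi p (r : R) x y : (forall q, U q -> differentiable phi q) ->
  (forall q, U q -> triangular ('d phi q)) -> box p r `<=` U ->
  box p r x -> box p r y -> ucoord y = ucoord x -> du (phi y) = du (phi x).
Proof.
move=> df tr bU bx bY yx; apply: (constant_between (f := fun q => du (phi q))) => s s01.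
have Us := bU _ (box_between s01 bx bY).
have w0 : du (y - x) = 0 by rewrite -[LHS]/(ucoord y - ucoord x) yx subrr.
rewrite -(mul0r (du ('d phi (x + s *: (y - x)) d_u))) -w0 -(triangular_du _ (tr _ Us)).
exact: (is_derive_du _ (df _ Us)).
Qed.

Lemma triangular_const_ux U phi p (r : R) x y : (forall q, U q -> differentiable phi q) ->
  (forall q, U q -> triangular ('d phi q)) -> box p r `<=` U ->
  box p r x -> box p r y -> ux y = ux x -> ux (phi y) = ux (phi x).
Proof.
move=> df tr bU bx bY yx; apply: injective_projections.
  by apply: (triangular_const_u df tr bU bx bY); rewrite /ucoord -/(ux y) yx.
apply/rowP => i.
apply: (constant_between (f := fun q => dx i (phi q))) => s s01.
have Us := bU _ (box_between s01 bx bY).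
have ux0 : ux (y - x) = 0 by rewrite -[LHS]/(ux y - ux x) yx subrr.
have w0 : du (y - x) = 0 by rewrite /du -/(ux (y - x)) ux0.
have <- : dx i ('d phi (x + s *: (y - x)) (y - x)) = 0.
  rewrite (triangular_dx i (tr _ Us) w0) big1 // => j _.
  by rewrite {1}/dx -/(ux (y - x)) ux0 mxE mul0r.
exact: (is_derive_dx _ i (df _ Us)).
Qed.

Lemma open_ucoord_box p (r : R) : 0 < r -> (@ucoord R m) @` box p r = [set u : R | `|u - ucoord p| < r].
Proof.
move=> r0; apply/seteqP; split=> [_ [q bq <-]|u /= ur]; first by have /boxE[] := bq.
by exists (u, p.1.2, p.2) => //; apply/boxE; rewrite /= !subrr !normr0.
Qed.

(** [smooth_on] is meaningful on open sets; the projections of a box are again balls. *)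
Lemma open_ux_box p (r : R) : 0 < r -> (@ux R m) @` box p r = [set y | `|y - ux p| < r].
Proof.
move=> r0; apply/seteqP; split=> [_ [q bq <-]|y /= yr].
  have /boxE[h1 h2 _] := bq; rewrite /= [ux q]surjective_pairing [ux p]surjective_pairing.
  by rewrite norm_pair_lt h1.
exists (y, p.2) => //; rewrite /box /=.
by rewrite [p]surjective_pairing norm_pair_lt subrr normr0 r0 andbT.
Qed.

Lemma open_norm_ball (V : normedModType R) (c : V) (r : R) : open [set y | `|y - c| < r].
Proof.
rewrite openE => q bq; apply/nbhs_distP; exists (r - `|q - c|); first by rewrite subr_gt0.
move=> x xq; rewrite /= (_ : x - c = (x - q) + (q - c)); last by lmod R.
by apply: le_lt_trans (ler_normD _ _) _; rewrite -ltrBrDr.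
Qed.

End AdaptedMaps.

(** * Integration of the adapted condition to explicit forms *)

Section KundtForm.
Context {R : realType} {m : nat}.
Local Notation E := (coordinates R m : normedModType R).
Local Notation d_u := (d_u R m : E).
Local Notation d_v := (d_v R m : E).
Local Notation d_x i := (d_x R i : E).
Implicit Types (p q X Y w : E) (phi : E -> E) (U N : set E).

Lemma is_derive_shift0 (F : normedModType R) (f : R -> F) (u : R) D :
  is_derive (0 : R) 1 (fun h => f (u + h)) D -> is_derive u 1 f D.
Proof.
move=> /is_deriveP fD; apply/is_deriveP => e /fD[d d0 dP]; exists d => // h /dP.
by rewrite add0r addr0.
Qed.

Lemma slice_value (V F : normedModType R) (f : V -> F) (g : R -> F) (N : set V) (q w : V) D D' :
  open N -> N q -> (forall h : R, N (q + h *: w) -> f (q + h *: w) = g h) ->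
  is_derive q w f D -> is_derive (0 : R) 1 g D' -> D = D'.
Proof.
move=> oN Nq fg fD gD; apply: is_derive_unique fD _.
exact: (is_derive_slice _ oN Nq fg).2.
Qed.

Lemma is_derive_affine (a b c : R) : is_derive (0 : R) 1 (fun h => (a + h) * b + c) b.
Proof.
apply/is_deriveP => e e0; exists 1 => // h _.
rewrite add0r [h *: 1]mulr1 -[h *: b]/(h * b).
have -> : (a + h) * b + c - ((a + 0) * b + c) - h * b = 0 by ring.
by rewrite normr0 mulr_ge0 // ltW.
Qed.

(** [u_line] and [ux_slice] are sections of the projections [ucoord] and [ux], the missing
    coordinates being those of [p]. *)
Definition u_line p (u : R) : E := (u, p.1.2, p.2).
Definition ux_slice p (y : (R * 'rV[R]_m)%type) : E := (y, p.2).

Lemma u_line_box p (r : R) q : 0 < r -> box p r q -> box p r (u_line p (ucoord q)).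
Proof. by move=> r0 /boxE[uq _ _]; apply/boxE; rewrite /= !subrr !normr0. Qed.

Lemma ux_slice_box p (r : R) q : 0 < r -> box p r q -> box p r (ux_slice p (ux q)).
Proof. by move=> r0 /boxE[uq xq _]; apply/boxE; rewrite /= subrr normr0. Qed.

Lemma smooth_u_line p (D : set R) : open D -> smooth_on D (u_line p).
Proof.
move=> oD; apply: (smooth_pair oD _ (smooth_cst _ _)).
exact: (smooth_pair oD (@smooth_id _ _ _) (smooth_cst _ _)).
Qed.

Lemma smooth_ux_slice p (D : set (R * 'rV[R]_m)%type) : open D -> smooth_on D (ux_slice p).
Proof. by move=> oD; exact: (smooth_pair oD (@smooth_id _ _ _) (smooth_cst _ _)). Qed.

Lemma ucoord_image_box p (r : R) u : 0 < r -> `|u - ucoord p| < r -> box p r (u_line p u).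
Proof. by move=> r0 ur; apply/boxE; rewrite /= !subrr !normr0. Qed.

Lemma ux_image_box p (r : R) y : 0 < r -> `|y - ux p| < r -> box p r (ux_slice p y).
Proof.
move=> r0 yr; rewrite /box /= [p]surjective_pairing.
by rewrite norm_pair_lt /= subrr normr0 r0 andbT.
Qed.

Lemma smooth_derive1 (F : normedModType R) (f : R -> F) (D : set R) :
  smooth_on D f -> smooth_on D (derive1 f).
Proof.
move=> sf; rewrite (_ : derive1 f = 'D_1 f); first exact: smooth_derive.
by apply/funext => u; rewrite derive1E.
Qed.

(** The three profiles yield [C], [A] and, after a correction, [B] when [phi] is a local
    diffeomorphism, and [c], [a], [b] when it is a vector field. *)
Definition u_profile phi p (u : R) : R := du (phi (u_line p u)).
Definition x_profile phi p (y : (R * 'rV[R]_m)%type) : 'rV[R]_m := x_lin (phi (ux_slice p y)).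
Definition v_profile phi p (y : (R * 'rV[R]_m)%type) : R := dv (phi (ux_slice p y)).

Section Profiles.
Variables (U : set E) (phi : E -> E) (p : E) (r : R).
Hypothesis df : forall q, U q -> differentiable phi q.
Hypothesis tr : forall q, U q -> triangular ('d phi q).
Hypothesis r0 : 0 < r.
Hypothesis bU : box p r `<=` U.

Lemma u_profileE q : box p r q -> du (phi q) = u_profile phi p (ucoord q).
Proof. by move=> bq; exact: (triangular_const_u df tr bU (u_line_box r0 bq) bq erefl). Qed.

Lemma ux_ux_slice q : box p r q -> ux (phi q) = ux (phi (ux_slice p (ux q))).
Proof. by move=> bq; exact: (triangular_const_ux df tr bU (ux_slice_box r0 bq) bq erefl). Qed.

Lemma x_profileE q i : box p r q -> dx i (phi q) = x_profile phi p (ux q) 0 i.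
Proof. by move=> bq; rewrite /dx -/(ux (phi q)) ux_ux_slice. Qed.

Lemma is_derive_u_profile q : box p r q ->
  is_derive (ucoord q) 1 (u_profile phi p) (du ('d phi q d_u)).
Proof.
move=> bq; apply: is_derive_shift0.
have fg (h : R) : box p r (q + h *: d_u) -> du (phi (q + h *: d_u)) = u_profile phi p (ucoord q + h).
  move=> bh; rewrite (u_profileE bh).
  by have -> : ucoord (q + h *: d_u) = ucoord q + h by rewrite /ucoord /= [h *: 1]mulr1.
have dphi := is_derive_du d_u (df (bU bq)).
exact: (@is_derive_slice R E R (fun x => du (phi x)) _ _ q d_u _ (@open_box R m p r) bq fg).1 dphi.
Qed.

Lemma derive1_u_profile q : box p r q ->
  derive1 (u_profile phi p) (ucoord q) = du ('d phi q d_u).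
Proof. by move=> /is_derive_u_profile[_ <-]; rewrite derive1E. Qed.

Lemma is_derive_x_profile q i j : box p r q ->
  is_derive (ux q) (ux (d_x j)) (fun y => x_profile phi p y 0 i) (dx i ('d phi q (d_x j))).
Proof.
move=> bq; pose g h := x_profile phi p (ux q + h *: ux (d_x j)) 0 i.
have fg (h : R) : box p r (q + h *: d_x j) -> dx i (phi (q + h *: d_x j)) = g h.
  by move=> bh; rewrite (x_profileE i bh).
have dg : is_derive (0 : R) 1 g (dx i ('d phi q (d_x j))).
  have dphi := is_derive_dx (d_x j) i (df (bU bq)).
  exact: (@is_derive_slice R E R (fun x => dx i (phi x)) _ _ q (d_x j) _ (@open_box R m p r) bq fg).1 dphi.
exact: (@is_derive_slice R (R * 'rV[R]_m)%type R (fun y => x_profile phi p y 0 i) g setT (ux q)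
  (ux (d_x j)) _ openT I (fun _ _ => erefl)).2 dg.
Qed.

Lemma x_profile_jacobian q : box p r q ->
  x_jacobian (x_profile phi p) (ux q) = \matrix_(i, j) dx i ('d phi q (d_x j)).
Proof.
move=> bq; apply/matrixP => i j; rewrite !mxE.
by have [_ <-] := is_derive_x_profile i j bq.
Qed.

(** On a [v]-line the component [dv (phi q)] is affine with slope [K (ucoord q)]; [K] will be
    [1 / C'] for maps and [- c'] for vector fields. *)
Lemma v_profileE (K : R -> R) q :
  (forall z, box p r z -> dv ('d phi z d_v) = K (ucoord z)) -> box p r q ->
  dv (phi q) = K (ucoord q) * vcoord q + (v_profile phi p (ux q) - K (ucoord q) * vcoord p).
Proof.
move=> KE bq; set q0 := ux_slice p (ux q); set J := K (ucoord q).
have bq0 : box p r q0 by exact: ux_slice_box.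
pose t := vcoord q - vcoord p.
have qE : q = q0 + t *: d_v.
  apply: coordinates_eq => [|i|].
  - by rewrite duDZ du_d_v mulr0 addr0.
  - by rewrite dxDZ dx_d_v mulr0 addr0.
  - by rewrite dvDZ dv_d_v mulr1 /t -[dv q0]/(vcoord p) -[dv q]/(vcoord q); ring.
have bqE : box p r (q0 + t *: d_v) by rewrite -qE.
suff E0 : dv (phi q) - J * dv q = dv (phi q0) - J * dv q0.
  by move: E0; rewrite -[dv (phi q0)]/(v_profile phi p (ux q)) -[dv q0]/(vcoord p) -[dv q]/(vcoord q); lra.
rewrite [in LHS]qE.
apply: (@constant_along R E R (fun x => dv (phi x) - J * dv x) q0 (t *: d_v)) => s s01.
set z := q0 + s *: (t *: d_v).
have bz : box p r z by exact: box_segment.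
have uz : ucoord z = ucoord q.
  by rewrite -[LHS]/(du z) /z duDZ duZ du_d_v !mulr0 addr0.
have := KE z bz; rewrite uz -/J => Jz.
have -> : 0 = dv ('d phi z (t *: d_v)) - J * t by rewrite linearZ dvZ Jz mulrC subrr.
apply: is_derive_sub; first exact: is_derive_dv (df (bU bz)).
apply/is_deriveP => e e0; exists 1 => // h _.
rewrite dvDZ dvZ dv_d_v -[h *: _]/(h * _).
have -> : J * (dv z + h * (t * 1)) - J * dv z - h * (J * t) = 0 by ring.
by rewrite normr0 mulr_ge0 // ltW.
Qed.

Hypothesis sphi : smooth_on U phi.

Lemma smooth_u_profile : smooth_on (@ucoord R m @` box p r) (u_profile phi p).
Proof.
rewrite open_ucoord_box //; have oD := @open_norm_ball R R (ucoord p) r.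
apply: (smooth_linear_comp oD (@du_lin_continuous R m)).
apply: (smooth_comp finite_dim_coordinates oD _ (smooth_u_line p oD) sphi) => u ur.
by apply: bU; exact: ucoord_image_box.
Qed.

Lemma smooth_ux_sliced (F : normedModType R) (l : {linear E -> F}) : continuous l ->
  smooth_on (@ux R m @` box p r) (fun y => l (phi (ux_slice p y))).
Proof.
move=> lc; rewrite open_ux_box //.
have oD := @open_norm_ball R (R * 'rV[R]_m)%type (ux p) r.
apply: (smooth_linear_comp oD lc).
apply: (smooth_comp finite_dim_coordinates oD _ (smooth_ux_slice p oD) sphi) => u ur.
by apply: bU; exact: ux_image_box.
Qed.

Lemma smooth_x_profile : smooth_on (@ux R m @` box p r) (x_profile phi p).
Proof. exact: smooth_ux_sliced (@x_lin_continuous R m). Qed.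

Lemma smooth_v_profile : smooth_on (@ux R m @` box p r) (v_profile phi p).
Proof. exact: smooth_ux_sliced (@dv_lin_continuous R m). Qed.

Lemma smooth_u_profile_derive :
  smooth_on (@ux R m @` box p r) (fun y => derive1 (u_profile phi p) y.1).
Proof.
have oD : open (@ux R m @` box p r).
  by rewrite open_ux_box //; exact: (@open_norm_ball R (R * 'rV[R]_m)%type).
have sfst : smooth_on (@ux R m @` box p r) (fun y : (R * 'rV[R]_m)%type => y.1).
  by move=> k; exact: class_C_fst.
apply: (smooth_comp finite_dim_R oD _ sfst (smooth_derive1 smooth_u_profile)).
by move=> _ [q bq <-]; exists q.
Qed.

End Profiles.

Lemma adapted_kundt_form U phi : local_diffeomorphism U phi ->
  (forall q, U q -> adapted ('d phi q)) -> locally_has_kundt_form U phi.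
Proof.
move=> diffeo ad p Up; have [oU oV sphi _] := diffeo.
have df q : U q -> differentiable phi q by exact: smooth_differentiable.
have tr q : U q -> triangular ('d phi q) by move=> /ad[].
have [r r0 bU] := open_box_sub oU Up.
set C := u_profile phi p; set A := x_profile phi p.
(* The profile is the value at the height [vcoord p] rather than at [v = 0], hence the
   correction. *)
pose B y := v_profile phi p y - (derive1 C y.1)^-1 * vcoord p.
have oD : open (@ux R m @` box p r).
  by rewrite open_ux_box //; exact: (@open_norm_ball R (R * 'rV[R]_m)%type).
have C'E q : box p r q -> derive1 C (ucoord q) != 0 /\
    dv ('d phi q d_v) = (derive1 C (ucoord q))^-1.
  move=> bq; rewrite (derive1_u_profile df tr r0 bU bq).
  have [_ JK] := ad _ (bU _ bq).
  have J0 : du ('d phi q d_u) != 0.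
    by apply/eqP => J0; move/eqP: JK; rewrite J0 mul0r eq_sym oner_eq0.
  by split=> //; apply: (mulfI J0); rewrite divff.
exists (box p r); split; [exact: open_box|exact: box_center|exact: bU|].
exists C, A, B; split.
  have sC' := smooth_u_profile_derive r0 bU sphi.
  split; [exact: smooth_u_profile bU sphi|exact: smooth_x_profile bU sphi|].
  have BE : B = fun y => v_profile phi p y + (derive1 C y.1)^-1 * (- vcoord p).
    by apply/funext => y; rewrite /B mulrN.
  rewrite BE; apply: (smooth_add oD); first exact: smooth_v_profile bU sphi.
  apply: (smooth_mul oD _ (smooth_cst _ _)); apply: (smooth_inv oD _ sC').
  by move=> _ [q bq <-]; have [] := C'E q bq.
move=> q bq; have [C'q _] := C'E q bq; split=> //.
- apply: coordinates_eq => [|i|].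
  + exact: (u_profileE df tr r0 bU bq).
  + exact: (x_profileE df tr r0 bU i bq).
  + rewrite (v_profileE (K := fun u => (derive1 C u)^-1) df r0 bU _ bq).
      by rewrite mulrC.
    by move=> z bz; have [] := C'E z bz.
(* [det0P] gives a left kernel vector; after transposition it is a [y] with all
   [dx i ('d phi q (0, y, 0))] equal to zero, which [adapted_x_injective] excludes. *)
rewrite (x_profile_jacobian df tr r0 bU bq) -det_tr.
apply/det0P => -[y y0 yM]; move: y0; apply/negP; rewrite negbK; apply/eqP.
have inj X : 'd phi q X = 0 -> X = 0 by exact: diffeomorphism_injective diffeo (bU _ bq).
apply: (adapted_x_injective inj (ad _ (bU _ bq))) => i.
rewrite (triangular_dx i (tr _ (bU _ bq))) //.
have := congr1 (fun M : 'rV[R]_m => M 0 i) yM; rewrite !mxE => yi.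
by rewrite -[RHS]yi; apply: eq_bigr => j _; rewrite !mxE.
Qed.

Section Forms.
Variables (N : set E) (phi : E -> E) (q : E).
Variables (C : R -> R) (A : R * 'rV[R]_m -> 'rV[R]_m) (B : R * 'rV[R]_m -> R) (K : R -> R).
Hypotheses (oN : open N) (Nq : N q) (df : differentiable phi q).
Hypothesis duE : forall z, N z -> du (phi z) = C (ucoord z).
Hypothesis dxE : forall z i, N z -> dx i (phi z) = A (ux z) 0 i.
Hypothesis dvE : forall z, N z -> dv (phi z) = K (ucoord z) * vcoord z + B (ux z).

Let uE w (h : R) : du w = 0 -> ucoord (q + h *: w) = ucoord q.
Proof. by move=> w0; rewrite -[LHS]/(du _) duDZ w0 mulr0 addr0. Qed.

Let uxE w (h : R) : ux w = 0 -> ux (q + h *: w) = ux q.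
Proof. by move=> w0; rewrite -[LHS]/(ux q + h *: ux w) w0 scaler0 addr0. Qed.

(** The converse computation, shared by maps and vector fields: along a frame line each component is
    an explicit function of one variable, here a constant. *)
Lemma form_triangular : triangular ('d phi q).
Proof.
split.
- apply: (@slice_value E R (fun x => du (phi x)) (fun=> C (ucoord q)) N q d_v _ _ oN Nq).
  + by move=> h Nh; rewrite duE // uE.
  + exact: is_derive_du.
- move=> i.
  apply: (@slice_value E R (fun x => dx i (phi x)) (fun=> A (ux q) 0 i) N q d_v _ _ oN Nq).
  + by move=> h Nh; rewrite dxE // uxE.
  + exact: is_derive_dx.
- move=> j.
  apply: (@slice_value E R (fun x => du (phi x)) (fun=> C (ucoord q)) N q (d_x j) _ _ oN Nq).
  + by move=> h Nh; rewrite duE // uE.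
  + exact: is_derive_du.
Qed.

Lemma form_du : differentiable C (ucoord q) -> du ('d phi q d_u) = derive1 C (ucoord q).
Proof.
move=> dCq; have dC : is_derive (ucoord q) 1 C (derive1 C (ucoord q)).
  by split; [exact: diff_derivable|rewrite derive1E].
apply: (@slice_value E R (fun x => du (phi x)) (fun h => C (ucoord q + h)) N q d_u _ _ oN Nq).
- by move=> h Nh; rewrite duE //; congr C; rewrite -[LHS]/(du _) duDZ du_d_u mulr1.
- exact: is_derive_du.
- by apply: is_derive_shift_arg; rewrite addr0.
Qed.

Lemma form_dv : dv ('d phi q d_v) = K (ucoord q).
Proof.
apply: (@slice_value E R (fun x => dv (phi x))
  (fun h => (vcoord q + h) * K (ucoord q) + B (ux q)) N q d_v _ _ oN Nq).
- move=> h Nh; rewrite dvE // uE // uxE // mulrC.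
  by rewrite -[vcoord (_ + _)]/(dv _) dvDZ dv_d_v mulr1.
- exact: is_derive_dv.
- exact: is_derive_affine.
Qed.

End Forms.

Lemma kundt_form_adapted N phi q : open N -> N q -> differentiable phi q ->
  has_kundt_form_on N phi -> adapted ('d phi q).
Proof.
move=> oN Nq df [C [A [B [[sC sA sB] phiE]]]].
have duE z : N z -> du (phi z) = C (ucoord z) by move=> /phiE[->].
have dxE z i : N z -> dx i (phi z) = A (ux z) 0 i by move=> /phiE[->].
have dvE z : N z -> dv (phi z) = (derive1 C (ucoord z))^-1 * vcoord z + B (ux z).
  by move=> /phiE[-> _ _]; rewrite [_^-1 * _]mulrC.
have [_ _ C'q] := phiE q Nq.
split; first exact: (form_triangular oN Nq df duE dxE).
have dCq : differentiable C (ucoord q) by apply: (smooth_differentiable sC); exists q.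
rewrite (form_du oN Nq df duE dCq) (form_dv (K := fun u => (derive1 C u)^-1) oN Nq df dvE).
by rewrite divff.
Qed.

Definition infinitesimally_adapted (L : E -> E) : Prop :=
  triangular L /\ du (L d_u) + dv (L d_v) = 0.

Lemma generator_form_of_adapted U (xi : E -> E) : open U -> smooth_on U xi ->
  (forall q, U q -> infinitesimally_adapted ('d xi q)) -> locally_has_kundt_generator_form U xi.
Proof.
move=> oU sxi ad p Up.
have df q : U q -> differentiable xi q by exact: smooth_differentiable.
have tr q : U q -> triangular ('d xi q) by move=> /ad[].
have [r r0 bU] := open_box_sub oU Up.
set c := u_profile xi p; set a := x_profile xi p.
pose b y := v_profile xi p y + derive1 c y.1 * vcoord p.
have oD : open (@ux R m @` box p r).
  by rewrite open_ux_box //; exact: (@open_norm_ball R (R * 'rV[R]_m)%type).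
have c'E q : box p r q -> dv ('d xi q d_v) = - derive1 c (ucoord q).
  move=> bq; rewrite (derive1_u_profile df tr r0 bU bq).
  by have [_ /eqP] := ad _ (bU _ bq); rewrite addrC addr_eq0 => /eqP.
exists (box p r); split; [exact: open_box|exact: box_center|exact: bU|].
exists c, a, b; split.
  split; [exact: smooth_u_profile bU sxi|exact: smooth_x_profile bU sxi|].
  apply: (smooth_add oD); first exact: smooth_v_profile bU sxi.
  exact: (smooth_mul oD (smooth_u_profile_derive r0 bU sxi) (smooth_cst _ _)).
move=> q bq; rewrite [LHS]coordinates_sum.
congr (_ + _ + _); [congr (_ *: _)|apply: eq_bigr => i _; congr (_ *: _)|congr (_ *: _)].
- exact: (u_profileE df tr r0 bU bq).
- exact: (x_profileE df tr r0 bU i bq).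
- rewrite (v_profileE (K := fun u => - derive1 c u) df r0 bU c'E bq) /b.
  by rewrite -[(ux q).1]/(ucoord q); ring.
Qed.

Lemma generator_coordinates (c b : R) (a : 'I_m -> R) :
  let X : E := c *: d_u + \sum_(i < m) a i *: d_x i + b *: d_v in
  [/\ du X = c, forall i, dx i X = a i & dv X = b].
Proof.
split=> [|i|].
- rewrite !duD !duZ du_d_u du_d_v du_sum big1 => [|j _]; last by rewrite duZ du_d_x mulr0.
  by rewrite mulr1 mulr0 !addr0.
- rewrite !dxD !dxZ dx_d_u dx_d_v dx_sum !mulr0 add0r addr0.
  rewrite (bigD1 i) //= dxZ dx_d_x eqxx mulr1 big1 ?addr0 // => j ji.
  by rewrite dxZ dx_d_x eq_sym (negPf ji) mulr0.
- rewrite !dvD !dvZ dv_d_u dv_d_v dv_sum big1 => [|j _]; last by rewrite dvZ dv_d_x mulr0.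
  by rewrite mulr1 mulr0 !add0r.
Qed.

(** The generator form states smoothness only of [c], [a], [b], while the Lie algebra asks for it of
    the field. *)
Lemma smooth_generator_form N (xi : E -> E) : open N -> has_kundt_generator_form_on N xi ->
  smooth_on N xi.
Proof.
move=> oN [c [a [b [[sc sa sb] xiE]]]].
have su : smooth_on N (fun q : E => ucoord q).
  exact: (smooth_linear_comp oN (@du_lin_continuous R m) (@smooth_id _ _ _)).
have sux : smooth_on N (fun q : E => ux q).
  exact: (smooth_linear_comp oN (@ux_lin_continuous R m) (@smooth_id _ _ _)).
have sv : smooth_on N (fun q : E => vcoord q).
  exact: (smooth_linear_comp oN (@dv_lin_continuous R m) (@smooth_id _ _ _)).
have Nu q : N q -> (@ucoord R m @` N) (ucoord q) by exists q.
have Nux q : N q -> (@ux R m @` N) (ux q) by exists q.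
have scu := smooth_comp finite_dim_R oN Nu su sc.
have sc'u := smooth_comp finite_dim_R oN Nu su (smooth_derive1 sc).
have saux := smooth_comp finite_dim_ux oN Nux sux sa.
have sbux := smooth_comp finite_dim_ux oN Nux sux sb.
apply: (smooth_ext oN (fun q Nq => esym (xiE q Nq))).
apply: (smooth_add oN); first apply: (smooth_add oN).
- exact: (smooth_scale oN scu (smooth_cst _ _)).
- apply: (smooth_sum oN) => i; apply: (smooth_scale oN _ (smooth_cst _ _)).
  by apply: (smooth_linear_comp (l := mx_entry (0 : 'I_1) i) oN _ saux); exact: coord_continuous.
- apply: (smooth_scale oN _ (smooth_cst _ _)).
  have E0 : (fun q : E => b (ux q) - derive1 c (ucoord q) * vcoord q) =
      (fun q => b (ux q) + (-1) * (derive1 c (ucoord q) * vcoord q)).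
    by apply/funext => q; rewrite mulN1r.
  rewrite E0; apply: (smooth_add oN sbux); apply: (smooth_mul oN (smooth_cst _ _)).
  exact: (smooth_mul oN sc'u sv).
Qed.

Lemma generator_form_adapted N (xi : E -> E) q : open N -> N q ->
  has_kundt_generator_form_on N xi -> infinitesimally_adapted ('d xi q).
Proof.
move=> oN Nq form; have df := smooth_differentiable (smooth_generator_form oN form) Nq.
have [c [a [b [[sc sa sb] xiE]]]] := form.
have duE z : N z -> du (xi z) = c (ucoord z).
  by move=> /xiE ->; have [] := generator_coordinates (c (ucoord z))
    (b (ux z) - derive1 c (ucoord z) * vcoord z) (fun i => a (ux z) 0 i).
have dxE z i : N z -> dx i (xi z) = a (ux z) 0 i.
  by move=> /xiE ->; have [] := generator_coordinates (c (ucoord z))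
    (b (ux z) - derive1 c (ucoord z) * vcoord z) (fun i => a (ux z) 0 i).
have dvE z : N z -> dv (xi z) = - derive1 c (ucoord z) * vcoord z + b (ux z).
  move=> /xiE ->; have [_ _ ->] := generator_coordinates (c (ucoord z))
    (b (ux z) - derive1 c (ucoord z) * vcoord z) (fun i => a (ux z) 0 i).
  by rewrite mulNr addrC.
split; first exact: (form_triangular oN Nq df duE dxE).
have dcq : differentiable c (ucoord q) by apply: (smooth_differentiable sc); exists q.
rewrite (form_du oN Nq df duE dcq) (form_dv (K := fun u => - derive1 c u) oN Nq df dvE).
by rewrite subrr.
Qed.

End KundtForm.

(** * Pullbacks of Kundt metrics *)

Section KundtMetrics.
Context {R : realType} {m : nat}.
Local Notation E := (coordinates R m : normedModType R).
Local Notation d_u := (d_u R m : E).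
Local Notation d_v := (d_v R m : E).
Local Notation d_x i := (d_x R i : E).
Implicit Types (p q X Y Z w : E) (phi : E -> E) (U N : set E).
Implicit Types (H : E -> R) (W : E -> 'rV[R]_m) (h : R * 'rV[R]_m -> 'M[R]_m).

Lemma linear_basis_ext (f g : E -> R) :
  (forall X (a : R) Y, f (X + a *: Y) = f X + a * f Y) ->
  (forall X (a : R) Y, g (X + a *: Y) = g X + a * g Y) ->
  f d_u = g d_u -> (forall i, f (d_x i) = g (d_x i)) -> f d_v = g d_v ->
  forall X, f X = g X.
Proof.
move=> fl gl fgu fgx fgv X.
have fg0 : f 0 = g 0.
  (* With [a = -1] the hypothesis reads [f 0 = f 0 - f 0]. *)
  have f0 := fl 0 (-1) 0; have g0 := gl 0 (-1) 0.
  by rewrite scaler0 addr0 in f0 g0; lra.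
have fgZ (a : R) Y : f Y = g Y -> f (a *: Y) = g (a *: Y).
  by move=> fgY; rewrite -[a *: Y]add0r fl gl fg0 fgY.
have fgD Y Z : f Y = g Y -> f Z = g Z -> f (Y + Z) = g (Y + Z).
  by move=> fgY fgZ'; rewrite -[Z]scale1r fl gl fgY fgZ'.
rewrite (coordinates_sum X).
apply: (fgD _ _ _ (fgZ _ _ fgv)); apply: (fgD _ _ (fgZ _ _ fgu)).
by elim/big_ind: _ => [|Y Z|i _]; [exact: fg0|exact: fgD|exact: fgZ].
Qed.

Lemma sprodC (a b : E -> R) X Y : sprod a b X Y = sprod a b Y X.
Proof. by rewrite /sprod; ring. Qed.

Lemma sprod_linear (a b : E -> R) Z X (c : R) Y :
  a (X + c *: Y) = a X + c * a Y -> b (X + c *: Y) = b X + c * b Y ->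
  sprod a b (X + c *: Y) Z = sprod a b X Z + c * sprod a b Y Z.
Proof. by move=> al bl; rewrite /sprod al bl; ring. Qed.

Lemma kundt_metricC H W h p X Y : kundt_metric H W h p X Y = kundt_metric H W h p Y X.
Proof.
rewrite /kundt_metric sprodC; congr (_ + _).
by apply: eq_bigr => i _; apply: eq_bigr => j _; rewrite sprodC.
Qed.

Lemma kundt_metric_linear H W h p Z X (c : R) Y :
  kundt_metric H W h p (X + c *: Y) Z =
  kundt_metric H W h p X Z + c * kundt_metric H W h p Y Z.
Proof.
rewrite /kundt_metric sprod_linear; last 2 first.
- exact: duDZ.
- rewrite duDZ dvDZ (eq_bigr (fun i => W p 0 i * dx i X + c * (W p 0 i * dx i Y))).
    by rewrite big_split /= -mulr_sumr; ring.
  by move=> i _; rewrite dxDZ; ring.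
rewrite mulrDr addrACA; congr (_ + _); rewrite mulr_sumr -big_split; apply: eq_bigr => i _ /=.
rewrite mulr_sumr -big_split; apply: eq_bigr => j _ /=.
by rewrite sprod_linear ?dxDZ //; ring.
Qed.

Lemma kundt_metricZ H W h p Z (c : R) Y :
  kundt_metric H W h p (c *: Y) Z = c * kundt_metric H W h p Y Z.
Proof.
have K0 := kundt_metric_linear H W h p Z 0 (-1) 0; rewrite scaler0 addr0 in K0.
by rewrite -[c *: Y]add0r kundt_metric_linear; lra.
Qed.

Lemma kundt_metric_horizontal H W h p X Y : du X = 0 -> du Y = 0 ->
  kundt_metric H W h p X Y = \sum_i \sum_j h (ux p) i j * sprod (dx i) (dx j) X Y.
Proof. by move=> X0 Y0; rewrite /kundt_metric {1}/sprod X0 Y0; ring. Qed.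

(** On the kernel of [du] only [h] and the [x]-components are seen. This is why the [x]-block of a
    pulled back metric is again independent of [v]. *)
Lemma kundt_metric_horizontal_ext H W h p p' X X' Y Y' : ux p = ux p' ->
  [/\ du X = 0, du X' = 0, du Y = 0 & du Y' = 0] ->
  (forall i, dx i X = dx i X') -> (forall i, dx i Y = dx i Y') ->
  kundt_metric H W h p X Y = kundt_metric H W h p' X' Y'.
Proof.
move=> pE [X0 X'0 Y0 Y'0] XE YE; rewrite !kundt_metric_horizontal // pE.
by apply: eq_bigr => i _; apply: eq_bigr => j _; rewrite /sprod !XE !YE.
Qed.

Lemma kundt_metric_quadratic H W h p X : du X = 0 ->
  kundt_metric H W h p X X = (x_lin X *m h (ux p) *m (x_lin X)^T) 0 0.
Proof.
move=> X0; rewrite kundt_metric_horizontal // exchange_big mxE; apply: eq_bigr => j _ /=.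
rewrite !mxE mulr_suml; apply: eq_bigr => i _.
by rewrite /sprod /dx /=; field.
Qed.

Lemma sum_dx_d_x (f : 'I_m -> R) i : \sum_j f j * dx j (d_x i) = f i.
Proof.
rewrite (bigD1 i) //= dx_d_x eqxx mulr1 big1 ?addr0 // => j ji.
by rewrite dx_d_x (negPf ji) mulr0.
Qed.

Lemma sum_dx_d_u (f : 'I_m -> R) : \sum_j f j * dx j d_u = 0.
Proof. by rewrite big1 // => j _; rewrite dx_d_u mulr0. Qed.

(** Thus [H] is the value on [d_u, d_u], and each component of [W] is twice the value on
    [d_u, d_x j]. *)
Lemma kundt_metric_d_u H W h p Y : kundt_metric H W h p d_u Y =
  (dv Y + 2 * H p * du Y + \sum_i W p 0 i * dx i Y) / 2.
Proof.
rewrite /kundt_metric /sprod sum_dx_d_u du_d_u dv_d_u [X in _ + X]big1 => [|i _].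
  by field.
by rewrite big1 // => j _; rewrite !dx_d_u; ring.
Qed.

Lemma kundt_metric_d_x H W h p i j : (h (ux p))^T = h (ux p) ->
  kundt_metric H W h p (d_x i) (d_x j) = h (ux p) i j.
Proof.
move=> hT; rewrite kundt_metric_horizontal ?du_d_x //.
set M := h (ux p) in hT *.
transitivity (\sum_k (M k j / 2 * dx k (d_x i) + M k i / 2 * dx k (d_x j))).
  apply: eq_bigr => k _.
  transitivity (\sum_l (M k l * dx k (d_x i) / 2 * dx l (d_x j)
    + (M k l * dx k (d_x j) / 2 * dx l (d_x i)))).
    by apply: eq_bigr => l _; rewrite /sprod; ring.
  by rewrite big_split /= !sum_dx_d_x; ring.
by rewrite big_split /= !sum_dx_d_x -[in M j i]hT mxE; field.
Qed.

(** Both sides are symmetric and bilinear, so they are compared on the frame. Adaptedness settles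
    the row of [d_v]; the other entries hold by the choice of [H'], [W'], [h']. *)
Lemma adapted_pullback (L : {linear E -> E}) H W h H' W' h' p q :
  adapted L -> (h' (ux q))^T = h' (ux q) ->
  H' q = kundt_metric H W h p (L d_u) (L d_u) ->
  (forall j, W' q 0 j = 2 * kundt_metric H W h p (L d_u) (L (d_x j))) ->
  (forall i j, h' (ux q) i j = kundt_metric H W h p (L (d_x i)) (L (d_x j))) ->
  forall X Y, kundt_metric H W h p (L X) (L Y) = kundt_metric H' W' h' q X Y.
Proof.
move=> ad hT H'E W'E h'E; have [[u0 x0 xu] JK] := ad.
pose K X Y := kundt_metric H W h p (L X) (L Y).
pose K' X Y := kundt_metric H' W' h' q X Y.
have KC X Y : K X Y = K Y X by exact: kundt_metricC.
have K'C X Y : K' X Y = K' Y X by exact: kundt_metricC.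
have Kl Z X c Y : K (X + c *: Y) Z = K X Z + c * K Y Z.
  by rewrite /K linearD linearZ kundt_metric_linear.
have K'l Z X c Y : K' (X + c *: Y) Z = K' X Z + c * K' Y Z by exact: kundt_metric_linear.
have Kv X : K d_v X = K' d_v X.
  have Lv : L d_v = dv (L d_v) *: d_v.
    apply: coordinates_eq => [|i|].
    - by rewrite duZ u0 du_d_v mulr0.
    - by rewrite dxZ x0 dx_d_v mulr0.
    - by rewrite dvZ dv_d_v mulr1.
  rewrite /K' kundt_metric_d_v /K Lv kundt_metricZ kundt_metric_d_v (triangular_du _ ad.1).
  rewrite -[in RHS](mulr1 (du X)) -JK; ring.
have Ku : K d_u d_u = K' d_u d_u.
  by rewrite /K' kundt_metric_d_u sum_dx_d_u du_d_u dv_d_u H'E /K; field.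
have Kux j : K d_u (d_x j) = K' d_u (d_x j).
  by rewrite /K' kundt_metric_d_u sum_dx_d_x du_d_x dv_d_x W'E /K; field.
have Kx i j : K (d_x i) (d_x j) = K' (d_x i) (d_x j).
  by rewrite /K' kundt_metric_d_x // h'E.
have KuY Y : K d_u Y = K' d_u Y.
  rewrite KC K'C; move: Y; apply: linear_basis_ext => [X a Y|X a Y||i|].
  - exact: Kl.
  - exact: K'l.
  - exact: Ku.
  - by rewrite KC K'C.
  - exact: Kv.
have KxY i Y : K (d_x i) Y = K' (d_x i) Y.
  rewrite KC K'C; move: Y; apply: linear_basis_ext => [X a Y|X a Y||j|].
  - exact: Kl.
  - exact: K'l.
  - exact: KuY.
  - exact: Kx.
  - exact: Kv.
move=> X Y; rewrite -/(K X Y) -/(K' X Y); move: X.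
apply: linear_basis_ext => [X a Z|X a Z||i|].
- exact: Kl.
- exact: K'l.
- exact: KuY.
- exact: KxY.
- exact: Kv.
Qed.

Lemma adapted_positive (L : {linear E -> E}) H W h H' W' h' p q :
  (forall X, L X = 0 -> X = 0) -> adapted L ->
  (forall y : 'rV[R]_m, y != 0 -> 0 < (y *m h (ux p) *m y^T) 0 0) ->
  (forall X Y, kundt_metric H W h p (L X) (L Y) = kundt_metric H' W' h' q X Y) ->
  forall y : 'rV[R]_m, y != 0 -> 0 < (y *m h' (ux q) *m y^T) 0 0.
Proof.
move=> inj ad hpos LE y y0; pose X : E := (0, y, 0).
have -> : (y *m h' (ux q) *m y^T) 0 0 = kundt_metric H' W' h' q X X.
  by rewrite kundt_metric_quadratic.
rewrite -LE kundt_metric_quadratic; last by rewrite (triangular_du _ ad.1) mul0r.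
apply: hpos; apply: contra_neq y0 => L0; apply: (adapted_x_injective inj ad) => i.
by rewrite -[LHS]/(x_lin _ 0 i) L0 mxE.
Qed.

Lemma smooth_kundt_metric (V : normedModType R) (D : set V) N H W h (f A B : V -> E) :
  open D -> (forall y, D y -> N (f y)) ->
  smooth_on D f -> smooth_on D A -> smooth_on D B ->
  smooth_on N H -> smooth_on N W -> smooth_on (@ux R m @` N) h ->
  smooth_on D (fun y => kundt_metric H W h (f y) (A y) (B y)).
Proof.
move=> oD Df sf sA sB sH sW sh.
have sdu (C : V -> E) : smooth_on D C -> smooth_on D (fun y => du (C y)).
  exact: (smooth_linear_comp oD (@du_lin_continuous R m)).
have sdv (C : V -> E) : smooth_on D C -> smooth_on D (fun y => dv (C y)).
  exact: (smooth_linear_comp oD (@dv_lin_continuous R m)).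
have sdx i (C : V -> E) : smooth_on D C -> smooth_on D (fun y => dx i (C y)).
  exact: (smooth_linear_comp oD (@dx_lin_continuous R m i)).
have sHf : smooth_on D (fun y => H (f y)) by exact: (smooth_comp finite_dim_coordinates oD Df sf sH).
have sWf i : smooth_on D (fun y => W (f y) 0 i).
  apply: (smooth_linear_comp (l := mx_entry (0 : 'I_1) i) oD); first exact: coord_continuous.
  exact: (smooth_comp finite_dim_coordinates oD Df sf sW).
have shf i j : smooth_on D (fun y => h (ux (f y)) i j).
  apply: (smooth_linear_comp (l := mx_entry i j) oD); first exact: coord_continuous.
  have sux : smooth_on D (fun y => ux (f y)).
    exact: (smooth_linear_comp oD (@ux_lin_continuous R m)).
  by apply: (smooth_comp finite_dim_ux oD _ sux sh) => y Dy; exists (f y) => //; exact: Df.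
have sprod_smooth (a b a' b' : V -> R) : smooth_on D a -> smooth_on D b -> smooth_on D a' ->
    smooth_on D b' -> smooth_on D (fun y => (a y * b' y + b y * a' y) / 2).
  move=> sa sb sa' sb'; apply: (smooth_mul oD _ (smooth_cst _ _)).
  by apply: (smooth_add oD); exact: (smooth_mul oD).
have ssum (C : V -> E) : smooth_on D C -> smooth_on D (fun y =>
    dv (C y) + H (f y) * du (C y) + \sum_i W (f y) 0 i * dx i (C y)).
  move=> sC; apply: (smooth_add oD); first apply: (smooth_add oD (sdv _ sC)).
    exact: (smooth_mul oD sHf (sdu _ sC)).
  by apply: (smooth_sum oD) => i; exact: (smooth_mul oD (sWf i) (sdx i _ sC)).
apply: (smooth_add oD).
  exact: (sprod_smooth _ _ _ _ (sdu _ sA) (ssum _ sA) (sdu _ sB) (ssum _ sB)).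
apply: (smooth_sum oD) => i; apply: (smooth_sum oD) => j.
apply: (smooth_mul oD (shf i j)).
exact: (sprod_smooth _ _ _ _ (sdx i _ sA) (sdx j _ sA) (sdx i _ sB) (sdx j _ sB)).
Qed.

Lemma smooth_differential (D : set E) phi X : open D -> smooth_on D phi ->
  smooth_on D (fun q => 'd phi q X).
Proof.
move=> oD sphi; apply: (smooth_ext oD _ (smooth_derive X sphi)) => q Dq.
exact: deriveE (smooth_differentiable sphi Dq).
Qed.

Lemma adapted_preserves U phi : local_diffeomorphism U phi ->
  (forall q, U q -> adapted ('d phi q)) -> preserves_kundt_shape U phi.
Proof.
move=> diffeo ad g kg p Up; have [oU oV sphi _] := diffeo.
have df q : U q -> differentiable phi q by exact: smooth_differentiable.
have tr q : U q -> triangular ('d phi q) by move=> /ad[].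
have Vp : (phi @` U) (phi p) by exists p.
have [N1 [H [W [h [[oN1 N1p N1U] [sH sW sh] pos gE]]]]] := kg _ Vp.
have [r r0 bUN] := open_box_sub (open_preimage_smooth oU oN1 sphi) (conj Up N1p).
have bU : box p r `<=` U by move=> q /bUN[].
have bN1 q : box p r q -> N1 (phi q) by move=> /bUN[].
pose K q X Y := kundt_metric H W h (phi q) ('d phi q X) ('d phi q Y).
have KC q X Y : K q X Y = K q Y X by exact: kundt_metricC.
(* The coefficients are read off in the frame. Only [h'] is taken on the slice [v = vcoord p], since
   it must be a function of [(u, x)]; [h'E] shows that it has the right value elsewhere. *)
pose H' q := K q d_u d_u.
pose W' q : 'rV[R]_m := \row_j (2 * K q d_u (d_x j)).
pose h' y : 'M[R]_m := \matrix_(i, j) K (ux_slice p y) (d_x i) (d_x j).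
have sb : smooth_on (box p r) phi by exact: smooth_sub bU sphi.
have ob : open (box p r) by exact: open_box.
have sK X Y : smooth_on (box p r) (fun q => K q X Y).
  by apply: (smooth_kundt_metric ob bN1) => //; exact: smooth_differential.
have h'E q i j : box p r q -> h' (ux q) i j = K q (d_x i) (d_x j).
  move=> bq; rewrite mxE; set q0 := ux_slice p (ux q).
  have bq0 : box p r q0 by exact: ux_slice_box.
  (* Both are derivatives of the same [x_profile] at the same point [ux q]. *)
  have dxE a k : dx a ('d phi q0 (d_x k)) = dx a ('d phi q (d_x k)).
    have D0 := is_derive_x_profile df tr r0 bU a k bq0.
    exact: is_derive_unique D0 (is_derive_x_profile df tr r0 bU a k bq).
  have xu z : box p r z -> forall k, du ('d phi z (d_x k)) = 0.
    by move=> bz k; have [_ _ ->] := tr _ (bU _ bz).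
  apply: kundt_metric_horizontal_ext => [||a|a].
  - by rewrite [RHS](ux_ux_slice df tr r0 bU bq).
  - by split; exact: xu.
  - exact: dxE.
  - exact: dxE.
have h'T q : box p r q -> (h' (ux q))^T = h' (ux q).
  by move=> bq; apply/matrixP => i j; rewrite mxE !h'E.
have KE q : box p r q -> forall X Y, K q X Y = kundt_metric H' W' h' q X Y.
  move=> bq; apply: (adapted_pullback (ad _ (bU _ bq))) => //.
  - exact: h'T.
  - by move=> j; rewrite mxE.
  - by move=> i j; exact: h'E.
exists (box p r), H', W', h'; split.
- by split=> //; exact: box_center.
- split; first exact: sK.
    apply: (smooth_mx ob) => i j; rewrite ord1.
    have -> : (fun q => W' q 0 j) = (fun q => 2 * K q d_u (d_x j)).
      by apply/funext => q; rewrite mxE.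
    exact: (smooth_mul ob (smooth_cst _ _) (sK d_u (d_x j))).
  rewrite open_ux_box //.
  have oD := @open_norm_ball R (R * 'rV[R]_m)%type (ux p) r.
  apply: (smooth_mx oD) => i j.
  have := smooth_comp finite_dim_coordinates oD _ (smooth_ux_slice p oD) (sK (d_x i) (d_x j)).
  move=> /(_ (fun y => @ux_image_box R m p r y r0)).
  have -> // : (fun y => h' y i j) = (fun y => K (ux_slice p y) (d_x i) (d_x j)).
  by apply/funext => y; rewrite mxE.
- move=> q bq; split; first exact: h'T.
  have [_ hpos] := pos _ (bN1 _ bq).
  apply: (adapted_positive _ (ad _ (bU _ bq)) hpos (KE _ bq)) => Z.
  exact: diffeomorphism_injective diffeo (bU _ bq).
- move=> q bq X Y; rewrite -KE // /pullback gE //; exact: bN1.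
Qed.

Lemma pseudogroupP U phi : kundt_pseudogroup U phi <->
  local_diffeomorphism U phi /\ (forall q, U q -> adapted ('d phi q)).
Proof.
split=> [pg|[diffeo ad]]; last by split=> //; exact: adapted_preserves.
by split=> [|q Uq]; [exact: pg.1|exact: pseudogroup_adapted pg Uq].
Qed.

Lemma kundt_pseudogroup_form U phi : kundt_pseudogroup U phi <->
  local_diffeomorphism U phi /\ locally_has_kundt_form U phi.
Proof.
rewrite pseudogroupP; split=> -[diffeo ad]; split=> //.
  exact: adapted_kundt_form.
move=> q Uq; have [N [oN Nq NU form]] := ad q Uq.
apply: kundt_form_adapted form => //.
by have [_ _ sphi _] := diffeo; exact: smooth_differentiable sphi Uq.
Qed.

End KundtMetrics.

(** * Flows and the Lie algebra *)

Section RealFunctions.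
Context {R : realType}.

Lemma is_derive_locally_cst (V : normedModType R) (f : R -> V) (e : R) c D : 0 < e ->
  (forall t : R, `|t| < e -> f t = c) -> is_derive (0 : R) 1 f D -> D = 0.
Proof.
move=> e0 fc /is_derive_unique; apply; apply/is_deriveP => eps eps0; exists e => // h he.
by rewrite add0r [h *: 1]mulr1 !fc ?normr0 // subrr scaler0 subrr normr0 mulr_ge0 // ltW.
Qed.

Lemma is_derive_mul0 (f g : R -> R) (t : R) Df Dg :
  is_derive t 1 f Df -> is_derive t 1 g Dg ->
  is_derive t 1 (fun s => f s * g s) (f t * Dg + Df * g t).
Proof.
move=> df dg; have := is_deriveM df dg.
by rewrite -[f t *: Dg]/(f t * Dg) -[g t *: Df]/(g t * Df) [g t * Df]mulrC.
Qed.

Lemma is_derive_mul_balanced (f g : R -> R) (t a b : R) :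
  is_derive t 1 f (f t * b) -> is_derive t 1 g (g t * a) -> b + a = 0 ->
  is_derive t 1 (fun s => f s * g s) 0.
Proof.
move=> df dg ba; have := is_derive_mul0 df dg.
have -> : f t * (g t * a) + f t * b * g t = f t * g t * (b + a) by ring.
by rewrite ba mulr0.
Qed.

Lemma constant_near_zero (f : R -> R) (e t : R) :
  (forall s : R, `|s| < e -> is_derive s 1 f 0) -> `|t| < e -> f t = f 0.
Proof.
move=> df te; apply/eqP; rewrite -subr_eq0 -normr_le0.
have := @mean_value_norm R R f (fun=> 0) 0 t 0; rewrite mul0r; apply=> [s s0t|s _].
  apply: df; apply: le_lt_trans te; case/orP: s0t => /andP[h1 h2].
    by rewrite !ger0_norm // (le_trans h1 h2).
  by rewrite !ler0_norm ?lerN2 // (le_trans h1 h2).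
by rewrite normr0.
Qed.

Lemma is_derive_reciprocal (f g : R -> R) (e Df Dg : R) : 0 < e ->
  (forall t : R, `|t| < e -> f t * g t = 1) -> f 0 = 1 -> g 0 = 1 ->
  is_derive (0 : R) 1 f Df -> is_derive (0 : R) 1 g Dg -> Df + Dg = 0.
Proof.
move=> e0 fg f0 g0 df dg.
have := is_derive_locally_cst e0 fg (is_derive_mul0 df dg).
by rewrite f0 g0 mul1r mulr1 addrC.
Qed.

End RealFunctions.

(** * The differential of a flow *)

Section FlowVariation.
Context {R : realType} {E : normedModType R}.
Variables (U N : set E) (f : E -> E) (e : R) (Phi : R -> E -> E).
Hypotheses (fE : finite_dim E) (oU : open U) (oN : open N) (sf : smooth_on U f).
Hypothesis flow : is_flow U f e N Phi.
Local Notation D := (flow_domain e N).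

Let oD : open D := open_flow_domain oN.
Let sPhi : smooth_on D (fun s => Phi s.1 s.2) := smooth_flow fE oU oN sf flow.

Lemma smooth_flow_at (t : R) : `|t| < e -> smooth_on N (Phi t).
Proof.
move=> te; apply: (@smooth_comp R E (R * E)%type E (fun q => (t, q)) (fun s => Phi s.1 s.2) N D).
- exact: finite_dim_pair finite_dim_R fE.
- exact: oN.
- by [].
- exact: (smooth_pair oN (smooth_cst _ _) (@smooth_id _ _ _)).
- exact: sPhi.
Qed.

Lemma flow_differential (t : R) q w : `|t| < e -> N q ->
  'D_(0 : R, w) (fun s => Phi s.1 s.2) (t, q) = 'd (Phi t) q w.
Proof.
move=> te Nq; have Dtq : D (t, q) by [].
have dF := smooth_differentiable sPhi Dtq.
have dPhi := smooth_differentiable (smooth_flow_at te) Nq.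
rewrite deriveE //; apply: is_derive_unique (is_derive_diff w dPhi).
apply: (@is_derive_slice R E E (Phi t) (fun h => Phi t (q + h *: w)) N q w _ oN Nq
  (fun _ _ => erefl)).2.
apply: (@is_derive_slice R (R * E)%type E (fun s => Phi s.1 s.2)
  (fun h => Phi t (q + h *: w)) D (t, q) (0, w) _ oD Dtq _).1.
  by move=> h _ /=; rewrite scaler0 addr0.
exact: is_derive_diff.
Qed.

Lemma flow_time_derive s : D s -> 'D_(1 : R, 0 : E) (fun s => Phi s.1 s.2) s = f (Phi s.1 s.2).
Proof.
case: s => t q Dtq; have [te Nq] : `|t| < e /\ N q by [].
have dF := smooth_differentiable sPhi Dtq.
have dt := (flow.2 t q te Nq).2.
rewrite deriveE //; apply: is_derive_unique (is_derive_diff _ dF) _.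
apply: (@is_derive_slice R (R * E)%type E (fun s => Phi s.1 s.2)
  (fun h => Phi (t + h) q) D (t, q) (1, 0) _ oD Dtq _).2.
  by move=> h _ /=; rewrite scaler0 addr0 [h *: 1]mulr1.
by apply: (is_derive_shift_arg (f := Phi^~ q)); rewrite addr0.
Qed.

(** The differential of [Phi t] is a partial derivative of the joint map in [(t, q)]. Symmetry of
    second derivatives moves the time derivative inside, where it is [f] composed with the flow, and
    the chain rule applies. *)
Lemma flow_variation (t : R) q w : `|t| < e -> N q ->
  is_derive t 1 (fun s => 'd (Phi s) q w) ('d f (Phi t q) ('d (Phi t) q w)).
Proof.
move=> te Nq; have Dtq : D (t, q) by [].
pose F s := Phi s.1 s.2 : E.
pose G := 'D_(0 : R, w) F.
have dF : differentiable F (t, q) := smooth_differentiable sPhi Dtq.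
have dG : differentiable G (t, q).
  exact: (smooth_differentiable (smooth_derive _ sPhi) Dtq).
have UPhi : U (Phi t q) := (flow.2 t q te Nq).1.
have df := smooth_differentiable sf UPhi.
have GE (h : R) : D ((t, q) + h *: (1, 0)) -> G ((t, q) + h *: (1, 0)) = 'd (Phi (t + h)) q w.
  rewrite (_ : (t, q) + h *: (1, 0) = (t + h, q)).
    by move=> [te' _]; exact: flow_differential.
  by rewrite /= -[RHS]/((t + h, q)); congr (_, _); rewrite /= ?scaler0 ?addr0 // [h *: 1]mulr1.
have G'E : 'D_(1 : R, 0 : E) G (t, q) = 'd f (Phi t q) ('d (Phi t) q w).
  rewrite /G (derive_commute _ _ oD Dtq (sPhi 2%N)).
  rewrite (derive_ext _ oD Dtq flow_time_derive).
  rewrite (derive_comp (f := F) (g := f)) //.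
  by rewrite /F flow_differential // deriveE.
rewrite -G'E; apply: is_derive_shift0.
apply: (@is_derive_slice R (R * E)%type E G (fun h => 'd (Phi (t + h)) q w) D (t, q) (1, 0) _
  oD Dtq GE).1.
by rewrite deriveE //; exact: is_derive_diff.
Qed.

Lemma flow_initial_differential q w : 0 < e -> N q -> 'd (Phi 0) q w = w.
Proof.
move=> e0 Nq; have te : `|(0 : R)| < e by rewrite normr0.
rewrite -deriveE; last exact: (smooth_differentiable (smooth_flow_at te) Nq).
exact: (derive_local_id w oN Nq flow.1).
Qed.

Lemma flow_variation0 q w : 0 < e -> N q ->
  is_derive (0 : R) 1 (fun s => 'd (Phi s) q w) ('d f q w).
Proof.
move=> e0 Nq; have te : `|(0 : R)| < e by rewrite normr0.
by have := flow_variation w te Nq; rewrite flow_initial_differential // flow.1.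
Qed.

(** The curves [Phi s (Phi t q)] and [Phi (t + s) q] agree at [s = 0], hence on their common time
    interval, which contains [- t]. *)
Lemma flow_inverse (t : R) q : `|t| < e -> N q -> N (Phi t q) -> Phi (- t) (Phi t q) = q.
Proof.
move=> te Nq NPhi; move: (te); rewrite ltr_norml => /andP[te1 te2].
have e0 : 0 < e by exact: le_lt_trans te.
pose a := Num.max (- e) (- e - t); pose b := Num.min e (e - t).
have abE s : a < s < b -> `|s| < e /\ `|t + s| < e.
  rewrite gt_max lt_min !ltr_norml => /andP[/andP[h1 h2] /andP[h3 h4]].
  by split; apply/andP; split; lra.
have in0 : a < 0 < b by rewrite gt_max lt_min; apply/andP; split; apply/andP; split; lra.
have int : a < - t < b by rewrite gt_max lt_min; apply/andP; split; apply/andP; split; lra.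
have := @ode_unique R E U f (fun s => Phi s (Phi t q)) (fun s => Phi (t + s) q) a b 0 fE oU
  (sf 1%N) in0 _ _ _ (- t) int.
rewrite subrr flow.1 // => -> //.
- exact: flow.1.
- by rewrite addr0.
- by move=> s /abE[se _]; exact: flow.2.
- move=> s /abE[_ tse]; have [h1 h2] := flow.2 _ q tse Nq; split=> //.
  exact: is_derive_shift_arg.
Qed.

(* [P V] solves a homogeneous linear equation when [V' = 'd f (Phi t q) V], so it
   stays zero. *)
Lemma flow_kernel (G : normedModType R) (P : {linear E -> G}) (i : G -> E) (k : R) q w :
  continuous P -> (forall y, `|i y| <= k * `|y|) -> 0 < e -> N q ->
  (forall (t : R) X, `|t| < e ->
     P ('d f (Phi t q) X) = P ('d f (Phi t q) (i (P X)))) ->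
  P w = 0 -> forall t : R, `|t| < e -> P ('d (Phi t) q w) = 0.
Proof.
move=> Pc ik e0 Nq Pd Pw t te.
have [kP kP0 kPP] := linear_norm_le Pc.
have nE s : (`|s| < e) = (- e < s < e) by rewrite ltr_norml.
apply: (@vanishing_of_derivative_bound R G (fun s => P ('d (Phi s) q w))
  (fun s => P ('d f (Phi s q) ('d (Phi s) q w))) (- e) e 0); last by rewrite -nE.
- by rewrite -nE normr0.
- by rewrite flow_initial_differential.
- move=> s; rewrite -nE => se; apply: (is_derive_linear_comp Pc); exact: flow_variation.
move=> s; rewrite -nE => se _; have [Us ds] := flow.2 s q se Nq.
have [L [r [L0 r0 rU DL _]]] := locally_lipschitz fE oU Us (sf 1%N).
have r2 : 0 < r / 2 by rewrite divr_gt0.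
have [d d0 dP] := (continuous_atP _ _).1 (is_derive_continuous ds) _ r2.
exists d, (kP * (L * k)); split=> // s'; rewrite -nE => s'e s'd.
have near : `|Phi s' q - Phi s q| < r by apply: le_lt_trans (dP _ s'd) _; lra.
have df := smooth_differentiable sf (rU _ near).
rewrite Pd //; apply: le_trans (kPP _) _; rewrite -!mulrA ler_wpM2l ?(ltW kP0) //.
rewrite -deriveE //; apply: le_trans (DL _ near _) _.
by rewrite ler_wpM2l ?(ltW L0).
Qed.

End FlowVariation.

(** * Vector fields generating the pseudogroup *)

Section LieAlgebra.
Context {R : realType} {m : nat}.
Local Notation E := (coordinates R m : normedModType R).
Local Notation d_u := (d_u R m : E).
Local Notation d_v := (d_v R m : E).
Local Notation d_x i := (d_x R i : E).
Implicit Types (p q X Y Z w : E) (U N : set E) (xi : E -> E) (Phi : R -> E -> E).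

Lemma is_local_flowP U xi (e : R) N Phi : is_local_flow U xi e N Phi <->
  smooth_on (flow_domain e N) (fun s => Phi s.1 s.2) /\ is_flow U xi e N Phi.
Proof.
have eE (t : R) : (t \in `]- e, e[) = (`|t| < e) by rewrite in_itv /= ltr_norml.
have -> : flow_domain e N = `]- e, e[ `*` N.
  by apply/seteqP; split=> [[t q] [/= te Nq]|[t q] [/= te Nq]]; split=> //=; move: te;
    rewrite eE.
split=> [[h1 h2 h3]|[h1 [h2 h3]]].
- by split=> //; split=> // t q te Nq; apply: h3; rewrite ?eE.
- by split=> // t q te Nq; apply: h3; rewrite -?eE.
Qed.

Lemma triangular_d_v (L : {linear E -> E}) X : triangular L -> ux X = 0 ->
  dv (L X) = dv X * dv (L d_v).
Proof.
move=> tr X0; have -> : X = dv X *: d_v.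
  apply: coordinates_eq => [|i|].
  - by rewrite duZ du_d_v mulr0 /du -/(ux X) X0.
  - by rewrite dxZ dx_d_v mulr0 /dx -/(ux X) X0 mxE.
  - by rewrite dvZ dv_d_v mulr1.
by rewrite linearZ !dvZ dv_d_v mulr1.
Qed.

(** The factorization through [ux] that [flow_kernel] takes as hypothesis, with [y |-> (y, 0)] as
    right inverse of the projection. *)
Lemma triangular_ux (L : {linear E -> E}) X : triangular L ->
  ux (L X) = ux (L (ux X, 0)).
Proof.
move=> [v0 x0 _]; have XE : X = (ux X, 0) + dv X *: d_v.
  apply: coordinates_eq => [|i|].
  - by rewrite duDZ du_d_v mulr0 addr0.
  - by rewrite dxDZ dx_d_v mulr0 addr0.
  - by rewrite dvDZ dv_d_v mulr1 add0r.
rewrite [in LHS]XE linearD linearZ -[LHS]/(ux (L (ux X, 0)) + dv X *: ux (L d_v)).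
have -> : ux (L d_v) = 0; last by rewrite scaler0 addr0.
apply: injective_projections; first exact: v0.
by apply/rowP => i; rewrite mxE -[LHS]/(dx i (L d_v)).
Qed.

Lemma du_scaled (a b : R) : du (a *: d_u) * b = a * b.
Proof. by rewrite duZ du_d_u mulr1. Qed.

Lemma flow_adapted U N xi (e : R) Phi (t : R) q : open U -> open N -> smooth_on U xi ->
  (forall z, U z -> infinitesimally_adapted ('d xi z)) ->
  is_flow U xi e N Phi -> `|t| < e -> N q -> adapted ('d (Phi t) q).
Proof.
move=> oU oN sxi ad flow te Nq.
have fE := @finite_dim_coordinates R m.
have e0 : 0 < e by exact: le_lt_trans te.
have tr (s : R) : `|s| < e -> triangular ('d xi (Phi s q)).
  by move=> se; have [] := ad _ (flow.2 s q se Nq).1.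
have init w : 'd (Phi 0) q w = w by exact: flow_initial_differential flow _ _ _ _.
(* [uxP] and [duP] say that the two members of the flag are carried along the flow; each is the
   kernel of a projection through which the triangular linearized field factors. *)
have uxP (s : R) w : `|s| < e -> ux w = 0 -> ux ('d (Phi s) q w) = 0.
  move=> se w0; apply: (flow_kernel fE oU oN sxi flow (P := ux_lin) (i := fun y => (y, 0)) (k := 1)
    (@ux_lin_continuous R m)) => // [y|z X ze].
    by rewrite mul1r prod_normE /= normr0 ge_max lexx normr_ge0.
  exact: triangular_ux (tr z ze).
have duP (s : R) w : `|s| < e -> du w = 0 -> du ('d (Phi s) q w) = 0.
  move=> se w0; apply: (flow_kernel fE oU oN sxi flow (P := du_lin) (i := fun a => a *: d_u)
    (k := `|d_u|) (@du_lin_continuous R m)) => // [a|z X ze].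
    by rewrite normrZ mulrC.
  have tz := tr z ze.
  exact: (etrans (triangular_du X tz) (esym (etrans (triangular_du _ tz) (du_scaled _ _)))).
split.
  have uxv := uxP t d_v te erefl.
  split=> [|i|j].
  - by rewrite /du -/(ux _) uxv.
  - by rewrite /dx -/(ux _) uxv mxE.
  - exact: duP.
(* Triangularity turns the variational equation into scalar equations for [J] and [K], with opposite
   coefficients, so [J * K] keeps its initial value 1. *)
pose J (s : R) := du ('d (Phi s) q d_u); pose K (s : R) := dv ('d (Phi s) q d_v).
have dJ (s : R) : `|s| < e -> is_derive s 1 J (J s * du ('d xi (Phi s q) d_u)).
  move=> se; rewrite -(triangular_du _ (tr s se)).
  apply: (is_derive_linear_comp (l := du_lin) (@du_lin_continuous R m)).
  exact: (flow_variation fE oU oN sxi flow).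
have dK (s : R) : `|s| < e -> is_derive s 1 K (K s * dv ('d xi (Phi s q) d_v)).
  move=> se; rewrite -(triangular_d_v (tr s se)); last exact: uxP.
  apply: (is_derive_linear_comp (l := dv_lin) (@dv_lin_continuous R m)).
  exact: (flow_variation fE oU oN sxi flow).
have JK0 : J 0 * K 0 = 1 by rewrite /J /K !init du_d_u dv_d_v mulr1.
apply: etrans JK0; apply: (constant_near_zero (f := fun s => J s * K s) (e := e) _ te) => s se.
exact: (is_derive_mul_balanced (dJ s se) (dK s se) (ad _ (flow.2 s q se Nq).1).2).
Qed.

Lemma lie_algebra_adapted U xi p : open U -> kundt_lie_algebra U xi -> U p ->
  infinitesimally_adapted ('d xi p).
Proof.
move=> oU [sxi lie] Up.
have [N [e [Phi [[oN Np NU] e0 /is_local_flowP[_ flow] pg]]]] := lie p Up.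
have fE := @finite_dim_coordinates R m.
have ad (t : R) : `|t| < e -> adapted ('d (Phi t) p).
  move=> te; apply: pseudogroup_adapted Np; apply: pg.
  by rewrite in_itv /= -ltr_norml.
have init w : 'd (Phi 0) p w = w.
  exact: (flow_initial_differential fE oU oN sxi flow).
have var w : is_derive (0 : R) 1 (fun s => 'd (Phi s) p w) ('d xi p w).
  exact: (flow_variation0 fE oU oN sxi flow).
have varl (l : {linear E -> R}) w : continuous l ->
    is_derive (0 : R) 1 (fun s => l ('d (Phi s) p w)) (l ('d xi p w)).
  by move=> lc; exact: is_derive_linear_comp lc (var w).
have varu w := varl du_lin w (@du_lin_continuous R m).
have varv w := varl dv_lin w (@dv_lin_continuous R m).
split; first split.
- apply: (is_derive_locally_cst (c := 0) e0 _ (varu d_v)) => t te.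
  by have [[v0 _ _] _] := ad t te; exact: v0.
- move=> i; have vari := varl (dx_lin i) d_v (@dx_lin_continuous R m i).
  apply: (is_derive_locally_cst (c := 0) e0 _ vari) => t te.
  by have [[_ v0 _] _] := ad t te; exact: v0.
- move=> j; apply: (is_derive_locally_cst (c := 0) e0 _ (varu (d_x j))) => t te.
  by have [[_ _ x0] _] := ad t te; exact: x0.
apply: (is_derive_reciprocal e0 _ _ _ (varu d_u) (varv d_v)) => [t te||].
- by have [_ JK] := ad t te; exact: JK.
- exact: (congr1 (fun X : E => du X) (init d_u)).
- exact: (congr1 (fun X : E => dv X) (init d_v)).
Qed.

(** The flow must consist of diffeomorphisms onto open images, so it is restricted to a box and a
    time interval for which trajectories end inside the larger domain [M], from where they can be
    run backwards. *)
Lemma adapted_lie_algebra U xi : open U -> smooth_on U xi ->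
  (forall q, U q -> infinitesimally_adapted ('d xi q)) -> kundt_lie_algebra U xi.
Proof.
move=> oU sxi ad; split=> // p Up.
have fE := @finite_dim_coordinates R m.
have [e [M [Phi [e0 oM Mp flow _]]]] := local_flow_continuous fE oU (sxi 1%N) Up.
have sF := smooth_flow fE oU oM sxi flow.
have Dp : flow_domain e M (0, p) by split=> //=; rewrite normr0.
have oV := open_preimage_smooth (open_flow_domain (e := e) oM) oM sF.
have Vp : (flow_domain e M `&` (fun s => Phi s.1 s.2) @^-1` M) (0, p).
  by split=> //; rewrite /= flow.1.
have [d d0 dP] := open_normP oV Vp.
have dV (t : R) q : `|t| < d -> box p d q -> [/\ `|t| < e, M q & M (Phi t q)].
  move=> td bq; have [|[/= te Mq] /= MPhi] := dP (t, q); last by split.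
  by rewrite /= norm_pair_lt /= subr0 td.
have dN (t : R) : `|t| < d -> `|- t| < d by rewrite normrN.
have bM q : box p d q -> M q by move=> /(dV 0)[]; rewrite ?normr0.
have ob : open (box p d) by exact: open_box.
have flow' : is_flow U xi d (box p d) Phi.
  split=> [q /bM|t q td bq]; first exact: flow.1.
  by have [te Mq _] := dV t q td bq; exact: flow.2.
exists (box p d), d, Phi; split=> //.
- split=> //; first exact: box_center.
  move=> q /bM Mq; rewrite -(flow.1 q Mq); apply: (flow.2 0 q _ Mq).1.
  by rewrite normr0.
- by apply/is_local_flowP; split=> //; exact: smooth_flow flow'.
move=> t; rewrite in_itv /= -ltr_norml => td.
have te : `|t| < e by have [] := dV t p td (box_center p d0).
have te' : `|- t| < e by rewrite normrN.
have sPhi := smooth_flow_at fE oU oM sxi flow te'.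
apply/pseudogroupP; split; last first.
  by move=> q bq; exact: flow_adapted flow' td bq.
(* Writing the image as a preimage under [Phi (- t)] makes it open by continuity, with no inverse
   function theorem. *)
have imE : Phi t @` box p d = M `&` Phi (- t) @^-1` box p d.
  apply/seteqP; split=> [_ [q bq <-]|z [Mz /= bz]].
    have [_ Mq MPhi] := dV t q td bq; split=> //=.
    by rewrite (flow_inverse fE oU sxi flow).
  exists (Phi (- t) z) => //.
  have := flow_inverse fE oU sxi flow te' Mz; rewrite opprK; apply.
  exact: bM.
split=> //.
- by rewrite imE; exact: open_preimage_smooth.
- exact: (smooth_flow_at fE oU ob sxi flow' td).
exists (Phi (- t)).
  by rewrite imE; apply: smooth_sub sPhi => z [].
move=> q bq; have [_ Mq MPhi] := dV t q td bq.
exact: (flow_inverse fE oU sxi flow).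
Qed.

Lemma lie_algebra_form U xi : open U ->
  (kundt_lie_algebra U xi <-> locally_has_kundt_generator_form U xi).
Proof.
move=> oU; split=> [lie|form].
  apply: (generator_form_of_adapted oU lie.1) => q Uq; exact: (lie_algebra_adapted oU lie Uq).
apply: adapted_lie_algebra => // [|q Uq].
  apply: smooth_local => q Uq; have [N [oN Nq NU fN]] := form q Uq.
  by exists N => //; exact: smooth_generator_form.
by have [N [oN Nq NU fN]] := form q Uq; exact: generator_form_adapted fN.
Qed.

End LieAlgebra.

Theorem theorem1 (R : realType) (n : nat) (hn : (3 <= n)%N) :
  (forall (U : set (coordinates R (n - 2)%N))
      (phi : coordinates R (n - 2)%N -> coordinates R (n - 2)%N),
    kundt_pseudogroup U phi <->
    local_diffeomorphism U phi /\ locally_has_kundt_form U phi)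
  /\
  (forall (U : set (coordinates R (n - 2)%N))
      (xi : coordinates R (n - 2)%N -> coordinates R (n - 2)%N),
    open U ->
    (kundt_lie_algebra U xi <-> locally_has_kundt_generator_form U xi)).
Proof.
by split=> [U phi|U xi oU]; [exact: kundt_pseudogroup_form|exact: lie_algebra_form].
Qed.
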